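(* Let $d\ge 3$, let $\Omega\subset\mathbb{R}^d$ be a smooth bounded domain, and let $f$ be the constant permittivity profile $f=1$ in $\Omega$, $f=0$ outside $\Omega$. Let $f^{\ast}$ be the symmetric decreasing rearrangement of $f$. Then $$\lambda^{\ast}(f^{\ast})\le \lambda^{\ast}(f).$$
   Context: Pull-in voltage: for a profile $h$ on $\mathbb{R}^d$, $\lambda^{\ast}(h)$ is the supremum of all $\lambda>0$ for which the problem $$-\Delta u(x)=\lambda\frac{h(x)}{(1-u(x))^2},\quad 0\le u(x)<1,\quad x\in\mathbb{R}^d,\qquad u(x)\to 0\ \text{ as } |x|\to\infty,$$ possesses at least one solution. This problem is identified with the equivalent integral problem $$u(x)=\lambda\int_{\mathbb{R}^d}\varepsilon_d(x-y)\frac{h(y)}{(1-u(y))^2}\,dy,\qquad 0\le u(x)<1,$$ where $\varepsilon_d(x-y)=\frac{1}{(d-2)\sigma_d|x-y|^{d-2}}$ is the fundamental solution of $-\Delta$ and $\sigma_d=2\pi^{d/2}/\Gamma(d/2)$ is the surface area of the unit sphere in $\mathbb{R}^d$; solutions are understood in this sense. Symmetric decreasing rearrangement: for a measurable set $A$ of finite measure, $A^{\ast}$ is the open ball centered at the origin with the same Lebesgue measure as $A$; for a nonnegative measurable $h$ whose positive level sets have finite measure, $h^{\ast}(x)=\int_0^\infty\chi_{\{h>t\}^{\ast}}(x)\,dt$. (In particular, $f^{\ast}$ is the indicator function of the ball $B$ centered at the origin with $|B|=|\Omega|$.) *)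

(* Defs.v *)
From HB Require Import structures.
From mathcomp Require Import all_boot all_order all_algebra.
From mathcomp Require Import all_classical all_reals all_analysis.

Set Implicit Arguments.
Unset Strict Implicit.
Unset Printing Implicit Defensive.

Import Order.TTheory GRing.Theory Num.Theory.
Import numFieldNormedType.Exports.

Local Open Scope classical_set_scope.
Local Open Scope ring_scope.

(* As for n.-tuple T, the sigma-algebra on row vectors is generated by the
   coordinate functions; for T = R it is the Borel sigma-algebra of R^n. *)
Definition rV_display : measure_display -> measure_display.
Proof. exact. Qed.

Section measurable_rV.
Context {d} {T : measurableType d}.
Variable n : nat.

Let coord : 'I_n -> 'rV[T]_n -> T := fun i x => x ord0 i.

Let rV_set0 : g_sigma_preimage coord set0.
Proof. exact: sigma_algebra0. Qed.

Let rV_setC A : g_sigma_preimage coord A -> g_sigma_preimage coord (~` A).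
Proof. exact: sigma_algebraC. Qed.

Let rV_bigcup (F : _^nat) : (forall i, g_sigma_preimage coord (F i)) ->
  g_sigma_preimage coord (\bigcup_i (F i)).
Proof. exact: sigma_algebra_bigcup. Qed.

HB.instance Definition _ := @isMeasurable.Build (rV_display d) 'rV[T]_n
  (g_sigma_preimage coord) rV_set0 rV_setC rV_bigcup.

End measurable_rV.

Section measurable_fun_rV.
Context {d1 d2} {T1 : measurableType d1} {T2 : measurableType d2}.

Lemma measurable_rV_coord n (i : 'I_n) :
  measurable_fun setT (fun x : 'rV[T2]_n => x ord0 i).
Proof.
move=> _ Y mY; rewrite setTI; apply: sub_sigma_algebra => /=.
rewrite -bigcup_seq/=; exists i => /=; first by rewrite mem_index_enum.
by exists Y => //; rewrite setTI.
Qed.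

Lemma measurable_fun_rV n (f : T1 -> 'rV[T2]_n) :
  (forall i, measurable_fun setT (fun x => f x ord0 i)) ->
  measurable_fun setT f.
Proof.
move=> mf _ Y mY; rewrite setTI; move: Y mY.
apply: (@smallest_sub _ _ _ [set A | measurable (f @^-1` A)]).
  split.
  - by rewrite /= preimage_set0; exact: measurable0.
  - by move=> A mA; rewrite setTD /= preimage_setC; exact: measurableC.
  - by move=> F mF; rewrite /= preimage_bigcup; apply: bigcupT_measurable.
rewrite -bigcup_seq/= => A [i _ [B mB <-]] /=.
by rewrite setTI -comp_preimage -[X in measurable X]setTI; exact: mf.
Qed.

End measurable_fun_rV.

Section rV_cons.
Context {d} {T : measurableType d} {n : nat}.

Definition rV_cons (p : T * 'rV[T]_n) : 'rV[T]_n.+1 :=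
  \row_i oapp (p.2 ord0) p.1 (unlift ord0 i).

Definition rV_uncons (x : 'rV[T]_n.+1) : T * 'rV[T]_n :=
  (x ord0 ord0, \row_j x ord0 (lift ord0 j)).

Lemma rV_consK : cancel rV_cons rV_uncons.
Proof.
move=> [a v]; congr pair; first by rewrite mxE unlift_none.
by apply/rowP => j; rewrite !mxE liftK.
Qed.

Lemma rV_unconsK : cancel rV_uncons rV_cons.
Proof.
by move=> x; apply/rowP => i; rewrite mxE; case: unliftP => [j|] ->//=; rewrite mxE.
Qed.

Lemma measurable_rV_cons : measurable_fun setT rV_cons.
Proof.
apply: measurable_fun_rV => i; rewrite /rV_cons.
under eq_fun do rewrite mxE.
case: unliftP => [j _|_] /=; last exact: measurable_fst.
apply: (@measurableT_comp _ _ _ _ _ _ (fun x : 'rV[T]_n => x ord0 j)) => //.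
exact: measurable_rV_coord.
Qed.

Lemma measurable_rV_uncons : measurable_fun setT rV_uncons.
Proof.
apply: measurable_fun_pair; first exact: measurable_rV_coord.
apply: measurable_fun_rV => i.
under eq_fun do rewrite mxE.
exact: measurable_rV_coord.
Qed.

End rV_cons.

Section lebesgue_rV.
Context {R : realType}.
Local Open Scope ereal_scope.
Local Notation Rn n := 'rV[measurableTypeR R]_n.

Section step.
Variables (n : nat) (mu : {sigma_finite_measure set (Rn n) -> \bar R}).

Definition lebesgue_rV_step : set (Rn n.+1) -> \bar R :=
  pushforward (lebesgue_measure \x mu) rV_cons.

Let step0 : lebesgue_rV_step set0 = 0.
Proof. by rewrite /lebesgue_rV_step /pushforward preimage_set0 measure0. Qed.

Let step_ge0 A : 0 <= lebesgue_rV_step A.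
Proof. exact: (measure_ge0 (lebesgue_measure \x mu)). Qed.

Let step_sigma_additive : semi_sigma_additive lebesgue_rV_step.
Proof.
move=> F mF tF mUF; rewrite /lebesgue_rV_step /pushforward preimage_bigcup.
have mcons (A : set (Rn n.+1)) : measurable A -> measurable (rV_cons @^-1` A).
  by move=> mA; rewrite -[X in measurable X]setTI; exact: measurable_rV_cons.
apply: measure_semi_sigma_additive.
- by move=> k; exact: mcons.
- apply/trivIsetP => /= i j _ _ ij; rewrite -preimage_setI.
  by move/trivIsetP : tF => /(_ _ _ _ _ ij) ->//; rewrite preimage_set0.
- by rewrite -preimage_bigcup; exact: mcons.
Qed.

HB.instance Definition _ := isMeasure.Build _ _ _ lebesgue_rV_step
  step0 step_ge0 step_sigma_additive.

Let step_sigma_finite : sigma_finite setT lebesgue_rV_step.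
Proof.
have /sigma_finiteP[F [TF ndF Foo]] := sigma_finiteT (@lebesgue_measure R).
have /sigma_finiteP[G [TG ndG Goo]] := sigma_finiteT mu.
exists (fun k => rV_uncons @^-1` (F k `*` G k)).
  rewrite -preimage_bigcup; apply/esym/seteqP; split => // x _ /=.
  have [i _ Fi] : (\bigcup_k F k) (rV_uncons x).1 by rewrite -TF.
  have [j _ Gj] : (\bigcup_k G k) (rV_uncons x).2 by rewrite -TG.
  exists (maxn i j) => //; split.
  - by move: Fi; exact/subsetPset/ndF/leq_maxl.
  - by move: Gj; exact/subsetPset/ndG/leq_maxr.
move=> k; have [mF Fkoo] := Foo k; have [mG Gkoo] := Goo k; split.
  rewrite -[X in measurable X]setTI; apply: measurable_rV_uncons => //.
  exact: measurableX.
rewrite /lebesgue_rV_step /pushforward -comp_preimage.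
rewrite (_ : rV_uncons \o _ = id); last by apply/funext => p; exact: rV_consK.
by rewrite preimage_id product_measure1E// lte_mul_pinfty// ge0_fin_numE.
Qed.

HB.instance Definition _ := Measure_isSigmaFinite.Build _ _ _
  lebesgue_rV_step step_sigma_finite.

End step.

(* Lebesgue measure on R^n, as an iterated product measure *)
Fixpoint lebesgue_rV n : {sigma_finite_measure set (Rn n) -> \bar R} :=
  if n is m.+1 then lebesgue_rV_step (lebesgue_rV m)
  else @dirac _ (Rn 0) (0%R : 'rV[R]_0) R.

Lemma lebesgue_rV_box n (A : 'I_n -> set (measurableTypeR R)) :
  (forall i, measurable (A i)) ->
  lebesgue_rV n [set x | forall i, A i (x ord0 i)] =
  \prod_(i < n) lebesgue_measure (A i).
Proof.
elim: n A => [|n IHn] A mA.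
  rewrite big_ord0 /= diracE mem_set//= => i.
  by case: i.
pose B := [set x : Rn n | forall i, A (lift ord0 i) (x ord0 i)].
have mB : measurable B.
  have -> : B = \bigcap_(i in [set: 'I_n])
      ((fun x : Rn n => x ord0 i) @^-1` A (lift ord0 i)).
    by apply/seteqP; split => [x /= Bx i _|x /= Bx i]; exact: Bx.
  apply: fin_bigcap_measurable => // i _.
  by rewrite -[X in measurable X]setTI; exact: measurable_rV_coord.
rewrite big_ord_recl -IHn// -/B -product_measure1E//.
rewrite /= /lebesgue_rV_step /pushforward.
congr (product_measure1 _ _ _).
apply/seteqP; split => [[a v] /= H|[a v] [/= Ha Hv] i].
  split => /=.
    by have := H ord0; rewrite mxE unlift_none.
  by move=> i; have := H (lift ord0 i); rewrite mxE liftK.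
by rewrite mxE; case: unliftP => [j ->|->] /=.
Qed.

End lebesgue_rV.

Section euclidean_space.
Context {R : realType} {n : nat}.
Implicit Types x c : 'rV[R]_n.

(* The library norm `|x| on 'rV[R]_n is the sup norm. *)
Definition enorm x : R := Num.sqrt (\sum_i x ord0 i ^+ 2).

Definition eball c (r : R) : set 'rV[R]_n := [set x | enorm (x - c) < r].

Fixpoint Ck (k : nat) (g : 'rV[R]_n -> R) : Prop :=
  continuous g /\
  if k is k'.+1 then
    forall i : 'I_n, (forall x, derivable g x (delta_mx ord0 i)) /\
      Ck k' (fun x => 'D_(delta_mx ord0 i) g x)
  else True.

Definition smooth_fun (g : 'rV[R]_n -> R) := forall k, Ck k g.

End euclidean_space.

Section smooth_domains.
Context {R : realType} {d : nat}.
Implicit Types Omega : set 'rV[R]_d.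

(* Near each boundary point p (Omega is meant to be open), and up to relabelling and
   reorienting the coordinate axes (the choice of i and s), Omega is the region
   above the graph of a smooth function of the other coordinates. *)
Definition smooth_boundary Omega :=
  forall p, (closure Omega `\` Omega) p ->
  exists (r : R) (i : 'I_d) (s : bool) (g : 'rV[R]_d.-1 -> R),
    [/\ 0 < r, smooth_fun g &
     Omega `&` eball p r =
     [set x | g (col' i x) < (-1) ^+ s * x ord0 i] `&` eball p r].

Definition smooth_bounded_domain Omega :=
  [/\ open Omega, connected Omega, Omega !=set0,
      bounded_set Omega & smooth_boundary Omega].

End smooth_domains.

Section rearrangement.
Context {R : realType} {d : nat}.
Local Open Scope ereal_scope.

(* For 0 < d there is exactly one such radius as soon as A has finite measure;
   otherwise the radius defaults to 0. *)
Definition set_rearr (A : set 'rV[R]_d) : set 'rV[R]_d :=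
  eball 0 (xget 0%R [set r : R | (0 <= r)%R /\
                                 lebesgue_rV d (eball 0 r) = lebesgue_rV d A]).

Definition superlevel (h : 'rV[R]_d -> \bar R) (t : R) : set 'rV[R]_d :=
  [set y | t%:E < h y].

Definition fun_rearr (h : 'rV[R]_d -> \bar R) (x : 'rV[R]_d) : \bar R :=
  \int[lebesgue_measure]_(t in `]0%R, +oo[)
    (\1_(set_rearr (superlevel h t)) x)%:E.

End rearrangement.

Section pull_in.
Context {R : realType}.

Definition Gamma (a : R) : R :=
  \int[lebesgue_measure]_(t in `]0, +oo[) (t `^ (a - 1) * expR (- t)).

Definition sphere_area (d : nat) : R :=
  2 * pi `^ (d%:R / 2) / Gamma (d%:R / 2).

(* Only used for 3 <= d; the value at z = 0 is 0, which is harmless since points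
   are Lebesgue-negligible. *)
Definition fund_sol (d : nat) (z : 'rV[R]_d) : R :=
  ((d - 2)%:R * sphere_area d * enorm z ^+ (d - 2))^-1.

Local Open Scope ereal_scope.

(* The integral is extended-real valued, so the equation entails that it is
   finite at every x. *)
Definition is_solution (d : nat) (lambda : R) (h : 'rV[R]_d -> \bar R)
    (u : 'rV[R]_d -> R) :=
  [/\ measurable_fun setT u,
      forall x, (0 <= u x < 1)%R &
      forall x, (u x)%:E = lambda%:E *
        \int[lebesgue_rV d]_y
          ((fund_sol (x - y))%:E * (h y * ((1 - u y) ^- 2)%:E))].

Definition pull_in_voltage (d : nat) (h : 'rV[R]_d -> \bar R) : \bar R :=
  ereal_sup [set lambda%:E | lambda in
    [set lambda : R | (0 < lambda)%R /\ exists u, is_solution lambda h u]].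

End pull_in.

(* Main.v *)
(* Iterating p |-> 1_E + p u, u |-> lambda * (fund_sol convolved with p^2) from 0 increases to
   the minimal solution u, with p = 1_E / (1 - u). If |A| <= |C| and C is a centered ball, the
   iterates for A are weakly majorized by those for C: their integrals over any set are at
   most the integrals for C over any centered set of at least the same measure. This
   relation is preserved by sums, by products (layer cake) and by the potential, the last
   through Riesz' rearrangement inequality. Hence the iterates for Omega stay below the value
   at the origin of a solution for the ball, which is < 1, and converge to a solution for
   Omega with the same lambda.

   Riesz' inequality is proved by polarization: polarizing both sets at the same hyperplane,
   with the origin on the favoured side, never decreases their interaction. Averaging over
   all hyperplanes shows that as long as a set has an excess of at least some theta > 0
   outside its centered target, some polarization reduces that excess by an amount depending
   only on theta and on a ball containing the set, so that finitely many polarizations drive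
   it below theta. *)
From HB Require Import structures.
From mathcomp Require Import all_boot all_order all_algebra.
From mathcomp Require Import all_classical all_reals all_analysis measurable_realfun.
From mathcomp Require Import ring lra.
Require Import Defs.

Set Implicit Arguments.
Unset Strict Implicit.
Unset Printing Implicit Defensive.

Import Order.TTheory GRing.Theory Num.Theory.
Import numFieldNormedType.Exports.

Local Open Scope classical_set_scope.
Local Open Scope ring_scope.

(** The nonlinearity enters only as the square of $p = 1/(1-u)$ on the set, and $p = 1 + pu$ there
    is a geometric series. So majorization has to pass through sums, products and potentials only,
    never through composition with a function. The delicate operation is the product. It is compared
    through $\int gW \le \int \tilde g W' \le \int g'W'$, where $\tilde g$ is the rearrangement of
    $g$. This demands that the functions on the ball side be radially nonincreasing, that $g'$ be
    finite, and that the superlevel sets of $g$ have finite measure. All three conditions are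
    carried along the iteration: monotonicity comes from a reflection argument for potentials,
    finiteness from the given solution for the ball, which dominates the iterates there, and finite
    superlevel sets from $p = 0$ off the set. The bound by the value at the origin must hold at
    every point. It is obtained by regarding the translated kernel as one more function majorized by
    the kernel. For this the kernel has to be radially nonincreasing everywhere, so it is given the
    value infinity at the origin, and the argument runs in the extended reals until the final
    limit. *)

Local Notation Rn R n := 'rV[measurableTypeR R]_n.

(** * Measurability of vector-valued maps and measure-preserving changes of variables *)

Section measurability.
Context {R : realType} d (T : measurableType d).

Lemma measurable_coordP n (i : 'I_n) (f : T -> Rn R n) :
  measurable_fun setT f -> measurable_fun setT (fun t => f t ord0 i : R).
Proof.
move=> mf.
have := measurableT_comp (@measurable_rV_coord _ (measurableTypeR R) n i) mf.
exact.
Qed.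

Lemma measurable_rVP n (f : T -> Rn R n) :
  (forall i, measurable_fun setT (fun t => f t ord0 i : R)) ->
  measurable_fun setT f.
Proof. by move=> mf; apply: measurable_fun_rV => i; exact: mf. Qed.

Lemma measurable_rVD n (f g : T -> Rn R n) :
  measurable_fun setT f -> measurable_fun setT g ->
  measurable_fun setT (fun t => f t + g t).
Proof.
move=> mf mg; apply: measurable_rVP => i; under eq_fun do rewrite mxE.
by apply: measurable_funD; exact: measurable_coordP.
Qed.

Lemma measurable_rVZ n (a : T -> R) (f : T -> Rn R n) :
  measurable_fun setT a -> measurable_fun setT f ->
  measurable_fun setT (fun t => a t *: f t).
Proof.
move=> ma mf; apply: measurable_rVP => i; under eq_fun do rewrite mxE.
by apply: measurable_funM => //; exact: measurable_coordP.
Qed.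

Lemma measurable_rVN n (f : T -> Rn R n) :
  measurable_fun setT f -> measurable_fun setT (fun t => - f t).
Proof.
move=> mf; under eq_fun do rewrite -scaleN1r.
by apply: measurable_rVZ => //; exact: measurable_cst.
Qed.

Lemma measurable_rVB n (f g : T -> Rn R n) :
  measurable_fun setT f -> measurable_fun setT g ->
  measurable_fun setT (fun t => f t - g t).
Proof.
by move=> mf mg; apply: measurable_rVD => //; exact: measurable_rVN.
Qed.

End measurability.

Section measure_preserving.
Context {R : realType} d (T : measurableType d).
Variable m : {measure set T -> \bar R}.
Local Open Scope ereal_scope.

Lemma measurable_preimage d' (T' : measurableType d') (phi : T -> T') A :
  measurable_fun setT phi -> measurable A -> measurable (phi @^-1` A).
Proof. by move=> mphi mA; rewrite -[X in measurable X]setTI; exact: mphi. Qed.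

Lemma ge0_integral_preserve (phi : T -> T) (f : T -> \bar R) :
  measurable_fun setT phi ->
  (forall A, measurable A -> m (phi @^-1` A) = m A) ->
  measurable_fun setT f -> (forall x, 0 <= f x) ->
  \int[m]_x f (phi x) = \int[m]_x f x.
Proof.
move=> mphi mE mf f0.
rewrite -[LHS]/(\int[m]_(x in phi @^-1` setT) (f \o phi) x).
rewrite -ge0_integral_pushforward//.
by apply: eq_measure_integral => A mA _; exact: mE.
Qed.

End measure_preserving.

(** * Lebesgue measure on row vectors *)

Section translation.
Context {R : realType}.
Local Open Scope ereal_scope.

Lemma lebesgue_measure_translate (a : R) (A : set (measurableTypeR R)) :
  measurable A ->
  lebesgue_measure ((fun t : measurableTypeR R => (t + a)%R) @^-1` A) =
  lebesgue_measure A.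
Proof.
move=> mA.
have mT : measurable_fun setT
    ((fun t => (t + a)%R) : measurableTypeR R -> measurableTypeR R).
  have : measurable_fun setT ((fun t : R => (t + a)%R) : R -> R).
    by apply: measurable_funD.
  exact.
pose P := pushforward (@lebesgue_measure R)
  ((fun t => (t + a)%R) : measurableTypeR R -> measurableTypeR R).
apply/esym; rewrite -[RHS]/(P A).
apply: lebesgue_measure_unique => //= _ [[b c]] _ <-.
rewrite /P /pushforward.
have -> : (fun t : R => (t + a)%R) @^-1` `]b, c]%classic =
    `](b - a)%R, (c - a)%R]%classic.
  by apply/seteqP; split => t /=; rewrite !in_itv/= ltrBlDr lerBrDr.
rewrite !lebesgue_measure_itv/= !lte_fin ltrD2r; case: ifPn => // _.
by rewrite -!EFinB; congr (_%:E); ring.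
Qed.

Lemma measurable_consr n (t : R) :
  measurable_fun setT (fun v : Rn R n => rV_cons (t : measurableTypeR R, v)).
Proof.
apply: measurableT_comp; first exact: measurable_rV_cons.
exact: pair1_measurable.
Qed.

Lemma rV_consD n (a : Rn R n.+1) (t : R) (v : Rn R n) :
  (rV_cons (t : measurableTypeR R, v) + a =
   rV_cons ((t + (rV_uncons a).1)%R : measurableTypeR R, v + (rV_uncons a).2))%R.
Proof.
apply/rowP => i; rewrite !mxE /=; case: unliftP => [j ->|->] //=.
by rewrite !mxE.
Qed.

(** Slicing along the first coordinate, the induction hypothesis absorbs the translation inside each
    slice, and the one-dimensional case absorbs the shift of the slice index. *)
Lemma lebesgue_rV_translate n (a : Rn R n) (A : set (Rn R n)) :
  measurable A ->
  lebesgue_rV n ((fun x => (x + a)%R) @^-1` A) = lebesgue_rV n A.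
Proof.
elim: n a A => [|n IHn] a A mA.
  rewrite (_ : _ @^-1` A = A)//; apply/seteqP.
  by split => x /=; rewrite (_ : (x + a)%R = x)//; apply/rowP => -[].
rewrite /= /lebesgue_rV_step /pushforward /product_measure1.
pose F (t : measurableTypeR R) :=
  lebesgue_rV n ((fun v => rV_cons (t, v)) @^-1` A).
have FE t : F t = lebesgue_rV n (xsection (rV_cons @^-1` A) t).
  by rewrite /F xsectionE.
rewrite -(_ : \int[lebesgue_measure]_t F t =
  \int[lebesgue_measure]_t (lebesgue_rV n \o xsection (rV_cons @^-1` A)) t);
  last by apply: eq_integral => t _; exact: FE.
transitivity (\int[lebesgue_measure]_t F (t + (rV_uncons a).1)%R).
  apply: eq_integral => t _ /=; rewrite /F.
  rewrite -(IHn (rV_uncons a).2); last first.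
    by apply: measurable_preimage => //; exact: measurable_consr.
  congr (lebesgue_rV n _); rewrite xsectionE; apply/seteqP.
  by split => v /=; rewrite rV_consD.
apply: (ge0_integral_preserve (phi := fun t : measurableTypeR R =>
  (t + (rV_uncons a).1)%R : measurableTypeR R)).
- have : measurable_fun setT ((fun t : R => (t + (rV_uncons a).1)%R) : R -> R).
    by apply: measurable_funD.
  exact.
- by move=> B mB; exact: lebesgue_measure_translate.
- rewrite (_ : F = lebesgue_rV n \o xsection (rV_cons @^-1` A)).
    apply: measurable_fun_xsection; apply: measurable_preimage => //.
    exact: measurable_rV_cons.
  by apply/funext => t; exact: FE.
- by move=> t; exact: measure_ge0.
Qed.

End translation.

Section indicators.
Context {R : realType} d (T : measurableType d).
Variable m : {measure set T -> \bar R}.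
Local Open Scope ereal_scope.

Lemma measurable_indic_comp d' (T' : measurableType d') (phi : T -> T') A :
  measurable A -> measurable_fun setT phi ->
  measurable_fun setT (fun t => (\1_A (phi t))%:E : \bar R).
Proof.
move=> mA mphi; apply/measurable_EFinP.
apply: (measurableT_comp (f := \1_A : T' -> R) (g := phi)) => //.
Qed.

Lemma indic_ge0 (A : set T) x : 0 <= (\1_A x)%:E :> \bar R.
Proof. by rewrite lee_fin indicE; case: (_ \in _). Qed.

Lemma integral_indicT (A : set T) :
  measurable A -> \int[m]_x (\1_A x)%:E = m A.
Proof. by move=> mA; rewrite integral_indic// setIT. Qed.

End indicators.
Arguments indic_ge0 {R d T}.

Section haar.
Context {R : realType} {n : nat}.
Local Open Scope ereal_scope.
Local Notation mu := (lebesgue_rV n : {sigma_finite_measure set (Rn R n) -> \bar R}).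

Lemma integral_translate (a : Rn R n) (f : Rn R n -> \bar R) :
  measurable_fun setT f -> (forall x, 0 <= f x) ->
  \int[mu]_x f (x + a)%R = \int[mu]_x f x.
Proof.
apply: (ge0_integral_preserve (phi := fun x : Rn R n => (x + a)%R : Rn R n)).
  exact: measurable_rVD.
by move=> A; exact: lebesgue_rV_translate.
Qed.

(* Two evaluations of the double integral of 1_A(x) 1_B(L y - x). *)
Lemma haar_linear (L L' : Rn R n -> Rn R n) (A B : set (Rn R n)) :
  measurable_fun setT L -> {morph L : x y / (x + y)%R} -> cancel L' L ->
  measurable A -> measurable B ->
  mu A * mu (L @^-1` B) = mu (-%R @^-1` B) * mu (L @^-1` A).
Proof.
move=> mL LD L'K mA mB.
have mLC C : measurable C -> measurable (L @^-1` C).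
  by move=> mC; exact: measurable_preimage.
have mN : measurable_fun setT (fun x : Rn R n => - x : Rn R n)%R.
  exact: measurable_rVN.
have mNB : measurable (-%R @^-1` B : set (Rn R n)).
  exact: (measurable_preimage mN).
have m1 d (T : measurableType d) (phi : T -> Rn R n) :
    measurable_fun setT phi -> measurable_fun setT (L \o phi).
  by move=> mphi; exact: measurableT_comp.
have shift C z : measurable C ->
    \int[mu]_y (\1_C (L y + z)%R)%:E = mu (L @^-1` C).
  move=> mC; rewrite -(integral_indicT mu (mLC _ mC)).
  rewrite -[RHS](integral_translate (L' z)).
  - by apply: eq_integral => y _; rewrite -[in LHS](L'K z) -LD.
  - exact: (measurable_indic_comp (mLC _ mC) (phi := id)).

  - by move=> x; exact: indic_ge0.
pose f (p : Rn R n * Rn R n) : \bar R :=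
  (\1_A p.1)%:E * (\1_B (L p.2 - p.1)%R)%:E.
pose g (p : Rn R n * Rn R n) : \bar R :=
  (\1_A (p.1 + L p.2)%R)%:E * (\1_B (- p.1)%R)%:E.
have mf : measurable_fun setT f.
  apply: emeasurable_funM.
    exact: measurable_indic_comp.
  apply: measurable_indic_comp => //; apply: measurable_rVB => //.
  exact: m1.
have mg : measurable_fun setT g.
  apply: emeasurable_funM; apply: measurable_indic_comp => //.
    by apply: measurable_rVD => //; exact: m1.
  by apply: measurable_rVN.
have f0 p : 0 <= f p by rewrite mule_ge0// indic_ge0.
have g0 p : 0 <= g p by rewrite mule_ge0// indic_ge0.
transitivity (\int[mu]_x \int[mu]_y f (x, y)).
  rewrite -(integral_indicT mu mA) -ge0_integralZr//; last first.
    exact: (measurable_indic_comp mA (phi := id)).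
  apply: eq_integral => x _; rewrite -(shift B (- x)%R)// -ge0_integralZl//.
  by apply: measurable_indic_comp => //; apply: measurable_rVB => //; exact: m1.
rewrite fubini_tonelli//.
transitivity (\int[mu]_y \int[mu]_x g (x, y)).
  apply: eq_integral => y _.
  rewrite -[LHS](integral_translate (L y)); last 2 first.
  - exact: measurable_fun_pair1.
  - by move=> x.
  by apply: eq_integral => x _; rewrite /f /g /= opprD addrCA subrr addr0.
rewrite -fubini_tonelli// -(integral_indicT mu mNB) -ge0_integralZr//; last first.
  exact: (measurable_indic_comp mNB (phi := id)).
apply: eq_integral => x _; rewrite -(shift A x)// -ge0_integralZl//; last first.
  by apply: measurable_indic_comp => //; apply: measurable_rVD => //; exact: m1.
by apply: eq_integral => y _; rewrite /g muleC /= (addrC x).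
Qed.

End haar.

(** * The Euclidean inner product and the volume of balls *)

Section dot.
Context {R : realType} {n : nat}.
Implicit Types x y z w : Rn R n.

Definition dot x y : R := \sum_i x ord0 i * y ord0 i.

Lemma dotC x y : dot x y = dot y x.
Proof. by apply: eq_bigr => i _; rewrite mulrC. Qed.

Lemma dotDl x y z : dot (x + y) z = dot x z + dot y z.
Proof. by rewrite -big_split; apply: eq_bigr => i _; rewrite mxE mulrDl. Qed.

Lemma dotZl a x y : dot (a *: x) y = a * dot x y.
Proof. by rewrite mulr_sumr; apply: eq_bigr => i _; rewrite mxE mulrA. Qed.

Lemma dotNl x y : dot (- x) y = - dot x y.
Proof. by rewrite -scaleN1r dotZl mulN1r. Qed.

Lemma dotDr x y z : dot z (x + y) = dot z x + dot z y.
Proof. by rewrite dotC dotDl !(dotC _ z). Qed.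

Lemma dotZr a x y : dot x (a *: y) = a * dot x y.
Proof. by rewrite dotC dotZl dotC. Qed.

Lemma dotNr x y : dot x (- y) = - dot x y.
Proof. by rewrite dotC dotNl dotC. Qed.

Definition dotE := (dotDl, dotDr, dotZl, dotZr, dotNl, dotNr).

Lemma dot_ge0 x : 0 <= dot x x.
Proof. by apply: sumr_ge0 => i _; rewrite -expr2 sqr_ge0. Qed.

Lemma dot_eq0 x : (dot x x == 0) = (x == 0).
Proof.
apply/idP/eqP => [|->]; last first.
  by rewrite -(scale0r 0) dotZl mul0r.
rewrite psumr_eq0 => [/allP x0|i _]; last by rewrite -expr2 sqr_ge0.
apply/rowP => i; rewrite mxE; have /implyP/(_ isT) := x0 i (mem_index_enum i).
by rewrite mulf_eq0 orbb => /eqP.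
Qed.

Lemma dot0r x : dot x 0 = 0.
Proof. by rewrite -(scale0r x) dotZr mul0r. Qed.

Lemma dot_gt0 x : (0 < dot x x) = (x != 0).
Proof. by rewrite lt_def dot_ge0 andbT dot_eq0. Qed.

Lemma enormE x : enorm x = Num.sqrt (dot x x).
Proof. by congr Num.sqrt; apply: eq_bigr => i _; rewrite expr2. Qed.

Lemma enorm_ge0 x : 0 <= enorm x. Proof. exact: sqrtr_ge0. Qed.

Lemma sqr_enorm x : enorm x ^+ 2 = dot x x.
Proof. by rewrite enormE sqr_sqrtr// dot_ge0. Qed.

Lemma enorm_le x y : (enorm x <= enorm y) = (dot x x <= dot y y).
Proof. by rewrite -!sqr_enorm ler_sqr// nnegrE enorm_ge0. Qed.

Lemma enorm_lt_dot x (r : R) : 0 <= r -> (enorm x < r) = (dot x x < r ^+ 2).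
Proof. by move=> r0; rewrite -sqr_enorm ltr_sqr// nnegrE// enorm_ge0. Qed.

Lemma enorm_eq0 x : (enorm x == 0) = (x == 0).
Proof. by rewrite -sqrf_eq0 sqr_enorm dot_eq0. Qed.

Lemma enorm0 : enorm (0 : Rn R n) = 0.
Proof. by apply/eqP; rewrite enorm_eq0. Qed.

Lemma enormN x : enorm (- x) = enorm x.
Proof. by rewrite !enormE !dotE opprK. Qed.

Lemma enormZ a x : enorm (a *: x) = `|a| * enorm x.
Proof.
rewrite !enormE !dotE mulrA -expr2 sqrtrM ?sqr_ge0//.
by rewrite sqrtr_sqr.
Qed.

Lemma coord_le_enorm x i : `|x ord0 i| <= enorm x.
Proof.
rewrite -(ler_pXn2r (ltn0Sn 1)) ?nnegrE ?enorm_ge0// sqr_enorm real_normK ?num_real//.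
rewrite /dot (bigD1 i)//= expr2 lerDl sumr_ge0// => j _.
by rewrite -expr2 sqr_ge0.
Qed.

Lemma dot_le_coord x (a : R) :
  (forall i, `|x ord0 i| <= a) -> dot x x <= n%:R * a ^+ 2.
Proof.
move=> xa; rewrite -[n in n%:R]card_ord mulrC -sumr_const mulr_sumr.
apply: ler_sum => i _; rewrite mulr1 -expr2.
rewrite -[leLHS]real_normK ?num_real// ler_pXn2r ?nnegrE//.
by rewrite (le_trans _ (xa i)).
Qed.

Lemma measurable_dot d (T : measurableType d) (f g : T -> Rn R n) :
  measurable_fun setT f -> measurable_fun setT g ->
  measurable_fun setT (fun t => dot (f t) (g t)).
Proof.
move=> mf mg; apply: measurable_sum => i.
by apply: measurable_funM; exact: measurable_coordP.
Qed.

Lemma measurable_enorm d (T : measurableType d) (f : T -> Rn R n) :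
  measurable_fun setT f -> measurable_fun setT (fun t => enorm (f t)).
Proof.
move=> mf; under eq_fun do rewrite enormE.
apply: measurableT_comp; last exact: measurable_dot.
apply: continuous_measurable_fun; exact: sqrt_continuous.
Qed.

Lemma measurable_eball x (r : R) : measurable (eball x r : set (Rn R n)).
Proof.
rewrite -[X in measurable X]setTI.
have mf : measurable_fun setT (fun y : Rn R n => enorm (y - x)).
  by apply: measurable_enorm; exact: measurable_rVB.
rewrite (_ : eball x r = (fun y => enorm (y - x)) @^-1` `]-oo, r[%classic).
  by apply: mf.
by apply/seteqP; split => y /=; rewrite in_itv.
Qed.

End dot.

Section ball_measure.
Context {R : realType} {n : nat}.
Local Open Scope ereal_scope.
Local Notation mu := (lebesgue_rV n : {sigma_finite_measure set (Rn R n) -> \bar R}).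

Definition cube (a : R) : set (Rn R n) := [set x | forall i, (- a <= x ord0 i <= a)%R].

Lemma cubeE a : cube a = [set x | forall i, `[(- a)%R, a]%classic (x ord0 i : R)].
Proof. by apply/seteqP; split => x /= h i; have := h i; rewrite /= in_itv. Qed.

Lemma measurable_cube a : measurable (cube a).
Proof.
have -> : cube a = \bigcap_(i in [set: 'I_n])
    ((fun x : Rn R n => x ord0 i) @^-1` `[(- a)%R, a]%classic).
  by rewrite cubeE; apply/seteqP; split => [x /= Bx i _|x /= Bx i]; exact: Bx.
apply: fin_bigcap_measurable => // i _.
by apply: (measurable_preimage (measurable_rV_coord i)); exact: measurable_itv.
Qed.

Lemma lebesgue_cube a : (0 <= a)%R -> mu (cube a) = (((a *+ 2) ^+ n)%R)%:E.
Proof.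
move=> a0; rewrite cubeE.
rewrite (lebesgue_rV_box (A := fun=> `[(- a)%R, a]%classic)); last first.
  by move=> i; exact: measurable_itv.
rewrite lebesgue_measure_itv/= lte_fin.
have -> : (if (- a < a)%R then a%:E - (- a)%:E else 0) = (a *+ 2)%:E.
  case: ifPn => [_|]; first by rewrite -EFinB opprK mulr2n.
  rewrite -leNgt => h; have -> : a = 0%R by lra.
  by rewrite mul0rn.
by rewrite prodEFin prodr_const card_ord.
Qed.

Lemma eball_sub_cube (r : R) : eball 0 r `<=` cube r.
Proof.
move=> x; rewrite /eball /= subr0 => xr i.
by rewrite -ler_norml (le_trans (coord_le_enorm x i))// ltW.
Qed.

(** The half-side [r / n.+1%:R] makes $n (r/(n+1))^2 < r^2$ strict, in dimension 0 as well. *)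
Lemma cube_sub_eball (r : R) : (0 < r)%R -> cube (r / n.+1%:R) `<=` eball 0 r.
Proof.
move=> r0 x xr; rewrite /eball /= subr0 enorm_lt_dot ?ltW//.
have /le_lt_trans : (dot x x <= n%:R * (r / n.+1%:R) ^+ 2)%R.
  by apply: dot_le_coord => i; rewrite ler_norml.
apply; rewrite expr_div_n mulrCA gtr_pMr ?exprn_gt0// ltr_pdivrMr ?exprn_gt0//.
by rewrite mul1r -natrX ltr_nat expnS mulSn expn1 ltnS leq_addr.
Qed.

Lemma eball_eq0 (r : R) : (r <= 0)%R -> eball 0 r = set0 :> set (Rn R n).
Proof.
move=> r0; rewrite -subset0 => x; rewrite /eball /= ltNge.
by rewrite (le_trans r0)// enorm_ge0.
Qed.

Lemma lebesgue_eball_lty (r : R) : mu (eball 0 r) < +oo.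
Proof.
have [r0|r0] := leP r 0%R.
  by rewrite eball_eq0 ?measure0.
apply: (@le_lt_trans _ _ (mu (cube r))).
  apply: le_measure; rewrite ?inE//; [exact: measurable_eball|exact: measurable_cube|].
  exact: eball_sub_cube.
by rewrite lebesgue_cube ?ltry// ltW.
Qed.

Lemma lebesgue_eball_gt0 (r : R) : (0 < r)%R -> 0 < mu (eball 0 r).
Proof.
move=> r0; apply: (@lt_le_trans _ _ (mu (cube (r / n.+1%:R)))).
  rewrite lebesgue_cube; last by rewrite divr_ge0// ltW.
  by rewrite lte_fin exprn_gt0// pmulrn_lgt0// divr_gt0.
apply: le_measure; rewrite ?inE//; [exact: measurable_cube|exact: measurable_eball|].
exact: cube_sub_eball.
Qed.

(** By [haar_linear] the scaling factor can be read off a single test set, here the cube of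
    half-side 1, whose preimage is the cube of half-side [r^-1]. *)
Lemma lebesgue_scale (r : R) (A : set (Rn R n)) : (0 < r)%R -> measurable A ->
  mu ((fun x : Rn R n => (r *: x)%R) @^-1` A) = (r ^- n)%:E * mu A.
Proof.
move=> r0 mA.
have mL : measurable_fun setT (fun x : Rn R n => (r *: x)%R : Rn R n).
  by apply: measurable_rVZ => //; exact: measurable_cst.
have := @haar_linear R n (fun x => (r *: x)%R) (fun x => (r^-1 *: x)%R)
  A (cube 1) mL (fun x y => scalerDr _ _ _).
have LK : cancel (fun x : Rn R n => (r^-1 *: x)%R) (fun x : Rn R n => (r *: x)%R).
  by move=> x; rewrite scalerA divff ?scale1r// gt_eqF.
move=> /(_ LK mA (measurable_cube _)).
have -> : -%R @^-1` cube 1 = cube 1.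
  by apply/seteqP; split => x /= h i; move: (h i); rewrite mxE; lra.
have -> : (fun x : Rn R n => (r *: x)%R) @^-1` cube 1 = cube r^-1.
  apply/seteqP; split => x /= h i; move: (h i); rewrite mxE.
    rewrite -[r^-1%R]mul1r -mulNr ler_pdivrMr// ler_pdivlMr//.
    by rewrite mulrC.
  rewrite -[r^-1%R]mul1r -mulNr ler_pdivrMr// ler_pdivlMr//.
  by rewrite mulrC.
rewrite !lebesgue_cube// ?invr_ge0 ?ltW// => h.
have two : ((1 *+ 2) ^+ n != 0 :> R)%R by rewrite expf_neq0// mulr2n; lra.
have : ((1 *+ 2) ^- n)%:E * (((1 *+ 2) ^+ n)%:E * mu ((fun x => (r *: x)%R) @^-1` A))
    = ((1 *+ 2) ^- n)%:E * (mu A * ((r^-1 *+ 2) ^+ n)%:E) by rewrite h.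
rewrite muleA -EFinM mulVf// mul1e => ->.
rewrite muleCA -EFinM muleC; congr (_%:E * _).
by rewrite -(mulr_natr r^-1 2) exprMn mulrCA mulVf ?mulr1 ?exprVn.
Qed.

Lemma lebesgue_eball (r : R) : (0 <= r)%R -> (0 < n)%N ->
  mu (eball 0 r) = (r ^+ n)%:E * mu (eball 0 1).
Proof.
rewrite le_eqVlt => /predU1P[<- n0|r0 _].
  rewrite expr0n gtn_eqF// mul0e.
  by rewrite eball_eq0 ?measure0.
have -> : eball 0 r = (fun x : Rn R n => (r^-1 *: x)%R) @^-1` eball 0 1.
  apply/seteqP; split => x; rewrite /eball /= !subr0 enormZ gtr0_norm ?invr_gt0//.
    by rewrite mulrC ltr_pdivrMr// mul1r.
  by rewrite mulrC ltr_pdivrMr// mul1r.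
rewrite lebesgue_scale ?invr_gt0//; last exact: measurable_eball.
by rewrite exprVn invrK.
Qed.

(** The test set for [haar_linear] is now the unit ball. It equals its preimage under [L] and has
    positive finite measure, so the factor is 1 and no determinant appears. *)
Lemma lebesgue_isometry (L : Rn R n -> Rn R n) (A : set (Rn R n)) :
  measurable_fun setT L -> {morph L : x y / (x + y)%R} -> involutive L ->
  (forall x, dot (L x) (L x) = dot x x) -> measurable A ->
  mu (L @^-1` A) = mu A.
Proof.
move=> mL LD LK Ldot mA.
have mB : measurable (eball 0 1 : set (Rn R n)) by exact: measurable_eball.
have := haar_linear mL LD LK mA mB.
have -> : -%R @^-1` eball 0 1 = eball 0 1 :> set (Rn R n).
  by apply/seteqP; split => x; rewrite /eball /= !subr0 enormN.
have -> : L @^-1` eball 0 1 = eball 0 1 :> set (Rn R n).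
  by apply/seteqP; split => x; rewrite /eball /= !subr0 !enormE Ldot.
have fB : mu (eball 0 1) \is a fin_num.
  by rewrite ge0_fin_numE ?measure_ge0// lebesgue_eball_lty.
have B0 : (0 < fine (mu (eball 0 1)))%R.
  by rewrite fine_gt0// lebesgue_eball_lty lebesgue_eball_gt0//.
rewrite -(fineK fB) muleC => /(congr1 (fun z => (fine (mu (eball 0 1)))^-1%:E * z)).
by rewrite !muleA -!EFinM mulVf ?gt_eqF// !mul1e.
Qed.

Lemma lebesgue_eball_radius (m : \bar R) : (0 < n)%N -> 0 <= m -> m < +oo ->
  exists2 r : R, (0 <= r)%R & mu (eball 0 r) = m.
Proof.
move=> n0 m0 moo.
have B0 : (0 < fine (mu (eball 0 1)))%R.
  by rewrite fine_gt0// lebesgue_eball_lty lebesgue_eball_gt0//.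
exists ((fine m / fine (mu (eball 0 1))) `^ n%:R^-1)%R; first exact: powR_ge0.
rewrite lebesgue_eball ?powR_ge0//.
have fB : mu (eball 0 1) \is a fin_num.
  by rewrite ge0_fin_numE ?measure_ge0// lebesgue_eball_lty.
have fm : m \is a fin_num by rewrite ge0_fin_numE.
rewrite -powR_mulrn ?powR_ge0// -powRrM mulVf ?pnatr_eq0 -?lt0n// powRr1; last first.
  by rewrite divr_ge0 ?fine_ge0.
by rewrite -[in X in _ * X](fineK fB) -EFinM divfK ?gt_eqF// fineK.
Qed.

End ball_measure.

(** * Reflections and polarization *)

Section reflections.
Context {R : realType} {n : nat}.
Variables (w : Rn R n) (c : R).
Hypothesis w0 : w != 0.
Implicit Types x y p : Rn R n.
Local Notation mu := (lebesgue_rV n : {sigma_finite_measure set (Rn R n) -> \bar R}).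

(* The reflection in the hyperplane [2 <x, w> = c |w|^2]; the coefficient is a signed
   distance to it. *)
Definition refl_coef x : R := c - 2 * dot x w / dot w w.
Definition refl x : Rn R n := x + refl_coef x *: w.

Let ww0 : dot w w != 0. Proof. by rewrite dot_eq0. Qed.

Lemma refl_coef0 : refl_coef 0 = c.
Proof. by rewrite /refl_coef dotC dot0r mulr0 mul0r subr0. Qed.

Lemma refl_coefK x : refl_coef (refl x) = - refl_coef x.
Proof. by rewrite /refl_coef /refl !dotE /refl_coef; field. Qed.

Lemma reflK : involutive refl.
Proof.
by move=> x; rewrite {1}/refl refl_coefK /refl scaleNr -addrA subrr addr0.
Qed.

Lemma refl_fix x : refl_coef x = 0 -> refl x = x.
Proof. by rewrite /refl => ->; rewrite scale0r addr0. Qed.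

(** All comparisons of distances rest on this identity: whether reflecting [y] brings it closer to
    [p] is decided by the sign of the product of the two coefficients, that is, by whether the
    points lie on the same side of the hyperplane. Taking [p = 0], whose coefficient is [c], yields
    [refl_enorm]. *)
Lemma refl_dist p y : dot (p - refl y) (p - refl y) =
  dot (p - y) (p - y) + refl_coef p * refl_coef y * dot w w.
Proof.
rewrite /refl !dotE.
have dpw : 2 * dot p w = (c - refl_coef p) * dot w w by rewrite /refl_coef; field.
have dyw : 2 * dot y w = (c - refl_coef y) * dot w w by rewrite /refl_coef; field.
rewrite (dotC w p) (dotC w y) (dotC y p); move: (refl_coef p) (refl_coef y) dpw dyw => a b H1 H2.
have -> : dot p w = (c - a) * dot w w / 2 by rewrite -H1; field.
have -> : dot y w = (c - b) * dot w w / 2 by rewrite -H2; field.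
by field.
Qed.

Lemma dotBC x y : dot (x - y) (x - y) = dot (y - x) (y - x).
Proof. by rewrite -(opprB y x) dotNl dotNr opprK. Qed.

Lemma refl_isometry x y : dot (refl x - refl y) (refl x - refl y) = dot (x - y) (x - y).
Proof.
have := refl_dist (refl x) (refl y); rewrite reflK !refl_coefK mulrNN.
have := refl_dist y x; rewrite (dotBC y) (dotBC y x) => -> h.
by apply: (addIr (refl_coef x * refl_coef y * dot w w)); rewrite -h; ring.
Qed.

Lemma refl_enorm x : enorm (refl x) ^+ 2 = enorm x ^+ 2 + c * refl_coef x * dot w w.
Proof.
have := refl_dist 0 x; rewrite !sub0r refl_coef0 !sqr_enorm.
by rewrite !dotNl !dotNr !opprK.
Qed.

Lemma reflBl x y : enorm (refl x - y) = enorm (x - refl y).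
Proof. by rewrite !enormE -[in LHS](reflK y) refl_isometry. Qed.

Lemma refl_enormB x y : enorm (refl x - refl y) = enorm (x - y).
Proof. by rewrite !enormE refl_isometry. Qed.

Lemma refl_enorm_le p y : 0 <= refl_coef p * refl_coef y ->
  enorm (p - y) <= enorm (p - refl y).
Proof. by rewrite enorm_le refl_dist lerDl => h; rewrite mulr_ge0// dot_ge0. Qed.

Lemma refl_enorm_ge p y : refl_coef p * refl_coef y <= 0 ->
  enorm (p - refl y) <= enorm (p - y).
Proof.
by rewrite enorm_le refl_dist gerDl => h; rewrite mulr_le0_ge0// dot_ge0.
Qed.

Lemma measurable_refl_coef : measurable_fun setT refl_coef.
Proof.
apply: measurable_funB => //; apply: measurable_funM => //.
by apply: measurable_funM => //; apply: measurable_dot.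
Qed.

Lemma measurable_refl : measurable_fun setT refl.
Proof.
apply: measurable_rVD => //; apply: measurable_rVZ => //.
exact: measurable_refl_coef.
Qed.

End reflections.

Section reflection_measure.
Context {R : realType} {n : nat}.
Variables (w : Rn R n) (c : R).
Hypothesis w0 : w != 0.
Local Open Scope ereal_scope.
Local Notation mu := (lebesgue_rV n : {sigma_finite_measure set (Rn R n) -> \bar R}).

(** An affine reflection is the linear one, with [c = 0], followed by the translation by [c *: w];
    the linear one preserves norms. *)
Lemma lebesgue_refl (A : set (Rn R n)) :
  measurable A -> mu (refl w c @^-1` A) = mu A.
Proof.
move=> mA.
rewrite -(lebesgue_rV_translate (c *: w)%R mA).
have mB : measurable ((fun x : Rn R n => (x + c *: w)%R) @^-1` A).
  apply: (measurable_preimage (phi := fun x : Rn R n => (x + c *: w)%R : Rn R n)) => //.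
  exact: measurable_rVD.
rewrite -[RHS](lebesgue_isometry (L := refl w 0) _ _ _ _ mB).
- congr (lebesgue_rV n _); apply/seteqP; split => x /=;
  by rewrite /refl /refl_coef sub0r -addrA -scalerDl (addrC _ c).
- exact: measurable_refl.
- move=> x y; rewrite /refl /refl_coef !sub0r dotDl mulrDr mulrDl opprD scalerDl.
  by rewrite addrACA.
- exact: reflK.
- by move=> x; rewrite -!sqr_enorm refl_enorm// mul0r mul0r addr0.
Qed.

Lemma integral_refl (f : Rn R n -> \bar R) :
  measurable_fun setT f -> (forall x, 0 <= f x) ->
  \int[mu]_x f (refl w c x) = \int[mu]_x f x.
Proof.
apply: (ge0_integral_preserve (phi := refl w c)); first exact: measurable_refl.
by move=> A; exact: lebesgue_refl.
Qed.

End reflection_measure.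

(** * Double integrals and polarized sets *)

Section iterated_integrals.
Context {R : realType} d1 d2 (T1 : measurableType d1) (T2 : measurableType d2).
Variables (m1 : {sigma_finite_measure set T1 -> \bar R})
          (m2 : {sigma_finite_measure set T2 -> \bar R}).
Local Open Scope ereal_scope.
Implicit Types f g : T1 * T2 -> \bar R.

Lemma measurable_integral2 f : measurable_fun setT f -> (forall p, 0 <= f p) ->
  measurable_fun setT (fun x => \int[m2]_y f (x, y)).
Proof. by move=> mf f0; exact: measurable_fun_fubini_tonelli_F. Qed.

Definition integral2 f : \bar R := \int[m1]_x \int[m2]_y f (x, y).

Lemma integral2_ge0 f : (forall p, 0 <= f p) -> 0 <= integral2 f.
Proof. by move=> f0; apply: integral_ge0 => x _; exact: integral_ge0. Qed.

Lemma le_integral2 f g :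
  measurable_fun setT f -> measurable_fun setT g ->
  (forall p, 0 <= f p) -> (forall p, f p <= g p) ->
  integral2 f <= integral2 g.
Proof.
move=> mf mg f0 fg; have g0 p : 0 <= g p by exact: le_trans (fg p).
apply: ge0_le_integral => //.
- by move=> x _; exact: integral_ge0.
- exact: measurable_integral2.
- exact: measurable_integral2.
- move=> x _; apply: ge0_le_integral => //; exact: measurable_fun_pair2.
Qed.

Lemma integral2D f g :
  measurable_fun setT f -> measurable_fun setT g ->
  (forall p, 0 <= f p) -> (forall p, 0 <= g p) ->
  integral2 (fun p => f p + g p) = integral2 f + integral2 g.
Proof.
move=> mf mg f0 g0; rewrite /integral2 -ge0_integralD//.
- apply: eq_integral => x _; rewrite ge0_integralD//; exact: measurable_fun_pair2.
- by move=> x _; exact: integral_ge0.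
- exact: measurable_integral2.
- by move=> x _; exact: integral_ge0.
- exact: measurable_integral2.
Qed.

End iterated_integrals.
Arguments integral2 {R d1 d2 T1 T2} m1 m2 f.

Section ereal_double.
Context {R : realDomainType}.
Local Open Scope ereal_scope.

Lemma lee_double (x y : \bar R) : 0 <= y -> x + x <= y + y -> x <= y.
Proof.
move=> y0; rewrite leNgt => h; rewrite leNgt; apply: contra h => yx.
by apply: lteD.
Qed.

Lemma lee_quadruple (x y a b : \bar R) : 0 <= y ->
  (x + x) + (x + x) = a -> (y + y) + (y + y) = b -> a <= b -> x <= y.
Proof.
move=> y0 <- <- h; apply: lee_double => //; apply: lee_double => //.
exact: adde_ge0.
Qed.

End ereal_double.

(** In positive dimension these are the empty set, the whole space, and the open and closed balls
    about the origin. No radius is named, so that superlevel sets of radially nonincreasing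
    functions qualify at once. *)
Definition centered {R : realType} {n} (C : set (Rn R n)) :=
  forall x y, C x -> enorm y <= enorm x -> C y.

Definition rdec {R : realType} {n} {d : Order.disp_t} {T : porderType d}
    (f : Rn R n -> T) :=
  forall x y, enorm x <= enorm y -> (f y <= f x)%O.

Section polarization.
Context {R : realType} {n : nat}.
Variables (w : Rn R n) (c : R).
Hypotheses (w0 : w != 0) (c0 : c <= 0).
Local Open Scope ereal_scope.
Local Notation mu := (lebesgue_rV n : {sigma_finite_measure set (Rn R n) -> \bar R}).
Local Notation s := (refl w c).
Local Notation coef := (refl_coef w c).
Implicit Types A E C : set (Rn R n).

(** The favoured side is [coef x <= 0], which contains the origin since [coef 0 = c]. From a mirror
    pair with just one point in [A], the polarized set keeps the point on that side. *)
Definition polar A : set (Rn R n) :=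
  [set x | if (coef x <= 0)%R then A x \/ A (s x) else A x /\ A (s x)].

Lemma polarE A x :
  (x \in polar A) = if (coef x <= 0)%R then (x \in A) || (s x \in A)
                    else (x \in A) && (s x \in A).
Proof.
apply/idP/idP; rewrite inE /polar /=; case: ifPn => _.
- by move=> [/mem_set ->|/mem_set ->]//; rewrite orbT.
- by move=> [/mem_set -> /mem_set ->].
- by move=> /orP[/set_mem|/set_mem]; [left|right].
- by move=> /andP[/set_mem ? /set_mem ?].
Qed.

Lemma measurable_polar A : measurable A -> measurable (polar A).
Proof.
move=> mA.
have mH : measurable [set x | (coef x <= 0)%R].
  rewrite (_ : [set x | _] = coef @^-1` `]-oo, 0%R]%classic); last first.
    by apply/seteqP; split => x /=; rewrite in_itv.
  apply: measurable_preimage; last exact: measurable_itv.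
  exact: measurable_refl_coef.
have mS : measurable (s @^-1` A).
  by apply: measurable_preimage => //; exact: measurable_refl.
rewrite (_ : polar A = [set x | (coef x <= 0)%R] `&` (A `|` s @^-1` A) `|`
   ~` [set x | (coef x <= 0)%R] `&` (A `&` s @^-1` A)).
  apply: measurableU; apply: measurableI => //; [exact: measurableU| | exact: measurableI].
  exact: measurableC.
apply/seteqP; split => x; rewrite /polar /=; first by case: ifPn => [|/negP]; [left|right].
by move=> [[->]|[/negP/negbTE ->]].
Qed.

Lemma integral_refl_double (f : Rn R n -> \bar R) :
  measurable_fun setT f -> (forall x, 0 <= f x) ->
  \int[mu]_x f x + \int[mu]_x f x = \int[mu]_x (f x + f (s x)).
Proof.
move=> mf f0; rewrite ge0_integralD// ?integral_refl//.
by apply: measurableT_comp => //; exact: measurable_refl.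
Qed.

(** Polarization only redistributes points within mirror pairs, so the sum of the indicator over a
    pair is unchanged. Doubling the measures turns this into a pointwise identity; on the hyperplane
    both points of the pair coincide. *)
Lemma lebesgue_polar A : measurable A -> mu (polar A) = mu A.
Proof.
move=> mA; have mP := measurable_polar mA.
have dE B : measurable B -> mu B + mu B = \int[mu]_x ((\1_B x)%:E + (\1_B (s x))%:E).
  move=> mB; rewrite -integral_indicT// integral_refl_double//.
  exact: (measurable_indic_comp mB (phi := id)).
have : mu (polar A) + mu (polar A) = mu A + mu A.
  rewrite !dE//; apply: eq_integral => x _; rewrite -!EFinD; congr (_%:E).
  rewrite !indicE !polarE refl_coefK// reflK// oppr_le0.
  have := @refl_fix _ _ w c x.
  have [_ _|_ _|h /(_ h) ->] := ltgtP (coef x) 0%R;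
    by case: (x \in A) => /=; rewrite ?orbT ?orbF ?andbT ?andbF// addrC.
by move=> h; apply/eqP; rewrite eq_le; apply/andP; split; apply: lee_double => //;
  rewrite h.
Qed.

Lemma refl_centered C x : centered C ->
  if (coef x <= 0)%R then s x \in C -> x \in C else x \in C -> s x \in C.
Proof.
move=> hC; case: ifPn => [h /set_mem sC|]; rewrite ?inE.
  apply: hC sC _; rewrite -(ler_pXn2r (ltn0Sn 1)) ?nnegrE ?enorm_ge0//.
  by rewrite refl_enorm// lerDl mulr_ge0 ?dot_ge0// mulr_le0.
rewrite -ltNge => /ltW h xC; apply: hC xC _.
rewrite -(ler_pXn2r (ltn0Sn 1)) ?nnegrE ?enorm_ge0//.
by rewrite refl_enorm// gerDl mulr_le0_ge0 ?dot_ge0// mulr_le0_ge0.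
Qed.

(** If [x] is in [A] but not in [C], and [s x] is in [C] but not in [A], then [x] lies on the
    unfavoured side because [C] is centered; polarization therefore exchanges [x] for [s x], a point
    of [C]. No mirror pair loses points in [C], so after doubling the inequality holds pair by
    pair. *)
Lemma polar_gain A C : measurable A -> measurable C -> centered C ->
  mu (A `&` C) + mu ((A `\` C) `&` s @^-1` (C `\` A)) <= mu (polar A `&` C).
Proof.
move=> mA mC hC; have mP := measurable_polar mA.
have mG : measurable ((A `\` C) `&` s @^-1` (C `\` A)).
  apply: measurableI; first exact: measurableD.
  by apply: measurable_preimage; [exact: measurable_refl|exact: measurableD].
pose f x : \bar R := (\1_(A `&` C) x)%:E + (\1_((A `\` C) `&` s @^-1` (C `\` A)) x)%:E.
have mI B : measurable B -> measurable_fun setT (fun x : Rn R n => (\1_B x)%:E : \bar R).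
  by move=> mB; exact: (measurable_indic_comp mB (phi := id)).
have mAC := measurableI _ _ mA mC; have mPC := measurableI _ _ mP mC.
have -> : mu (A `&` C) + mu ((A `\` C) `&` s @^-1` (C `\` A)) = \int[mu]_x f x.
  rewrite ge0_integralD//.
  - by rewrite !integral_indicT.
  - exact: mI.
  - exact: mI.
have mf : measurable_fun setT f by apply: emeasurable_funD; exact: mI.
have f0 x : 0 <= f x by rewrite adde_ge0 ?indic_ge0.
apply: lee_double => //; rewrite integral_refl_double//.
rewrite -(integral_indicT mu mPC) integral_refl_double//; last exact: mI.
have mps : measurable_fun setT s by exact: measurable_refl.
apply: ge0_le_integral => //.
- by move=> x _; rewrite adde_ge0.
- by apply: emeasurable_funD => //; exact: measurableT_comp.
- by apply: emeasurable_funD; [exact: mI|exact: measurable_indic_comp].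
have inI B D y : (y \in B `&` D) = (y \in B) && (y \in D).
  by apply/idP/andP => [/set_mem[/mem_set -> /mem_set ->]|[/set_mem ? /set_mem ?]];
    rewrite ?inE.
have gE y : (y \in (A `\` C) `&` s @^-1` (C `\` A)) =
    [&& y \in A, y \notin C, s y \in C & s y \notin A].
  apply/idP/and4P; rewrite !notin_setE !inE; first by move=> [[? ?] [? ?]].
  by move=> [? ? ? ?].
move=> x _; rewrite /f !indicE !gE !inI reflK// !polarE refl_coefK//.
rewrite reflK// oppr_le0 -!EFinD lee_fin.
have := refl_centered x hC; have := @refl_fix _ _ w c x.
have [h _|h _|h /(_ h) ->] := ltgtP (coef x) 0%R.
- case: (x \in A); case: (x \in C); case: (s x \in A); case: (s x \in C) => //= H;
  rewrite ?(H isT) -!natrD ler_nat//; by have := H isT.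
- case: (x \in A); case: (x \in C); case: (s x \in A); case: (s x \in C) => //= H;
  rewrite -!natrD ler_nat//; by have := H isT.
- by case: (x \in A); case: (x \in C) => //= H; rewrite -!natrD ler_nat.
Qed.

End polarization.

(** The inequality behind [interaction_polar], on one quadruple of reflected pairs. Here [h1], [h2]
    are the coefficients of two points [x] and [y]; [a], [a'] say whether [x] and its mirror image
    belong to the first set, [e], [e'] say the same for [y] and the second set; [k1] is the kernel
    between [x] and [y], [k2] the kernel between [x] and the mirror image of [y]. *)
Lemma polarized_products_le {R : realFieldType} (h1 h2 k1 k2 : R) (a a' e e' : bool) :
  (h1 = 0 -> a = a') -> (h2 = 0 -> e = e') ->
  (0 <= h1 * h2 -> k2 <= k1) -> (h1 * h2 <= 0 -> k1 <= k2) ->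
  a%:R * e%:R * k1 + a'%:R * e'%:R * k1 + (a%:R * e'%:R * k2 + a'%:R * e%:R * k2) <=
  (if h1 <= 0 then a || a' else a && a')%:R * (if h2 <= 0 then e || e' else e && e')%:R * k1 +
  (if 0 <= h1 then a' || a else a' && a)%:R * (if 0 <= h2 then e' || e else e' && e)%:R * k1 +
  ((if h1 <= 0 then a || a' else a && a')%:R * (if 0 <= h2 then e' || e else e' && e)%:R * k2 +
   (if 0 <= h1 then a' || a else a' && a)%:R * (if h2 <= 0 then e || e' else e && e')%:R * k2).
Proof.
move=> fa fe kle kge.
have [hx|hx|hx] := ltgtP h1 0; have [hy|hy|hy] := ltgtP h2 0.
- have {kle kge} kk : k2 <= k1 by apply: kle; rewrite mulr_le0// ltW.
  by case: a a' e e' {fa fe} => -[] [] [] /=; lra.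
- have {kle kge} kk : k1 <= k2 by apply: kge; rewrite mulr_le0_ge0// ltW.
  by case: a a' e e' {fa fe} => -[] [] [] /=; lra.
- have {kle kge} kk : k2 <= k1 by apply: kle; rewrite hy mulr0.
  by rewrite (fe hy); case: a a' e' {fa fe e} => -[] [] /=; lra.
- have {kle kge} kk : k1 <= k2 by apply: kge; rewrite mulr_ge0_le0// ltW.
  by case: a a' e e' {fa fe} => -[] [] [] /=; lra.
- have {kle kge} kk : k2 <= k1 by apply: kle; rewrite mulr_ge0// ltW.
  by case: a a' e e' {fa fe} => -[] [] [] /=; lra.
- have {kle kge} kk : k2 <= k1 by apply: kle; rewrite hy mulr0.
  by rewrite (fe hy); case: a a' e' {fa fe e} => -[] [] /=; lra.
- have {kle kge} kk : k2 <= k1 by apply: kle; rewrite hx mul0r.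
  by rewrite (fa hx); case: a' e e' {fa fe a} => -[] [] /=; lra.
- have {kle kge} kk : k2 <= k1 by apply: kle; rewrite hx mul0r.
  by rewrite (fa hx); case: a' e e' {fa fe a} => -[] [] /=; lra.
- by rewrite (fa hx) (fe hy); case: a' e' {fa fe} => -[] /=; lra.
Qed.

(** * Polarization does not decrease the interaction of two sets *)

Section interaction.
Context {R : realType} {n : nat}.
Local Open Scope ereal_scope.
Local Notation mu := (lebesgue_rV n : {sigma_finite_measure set (Rn R n) -> \bar R}).
Implicit Types (A E C : set (Rn R n)) (k : Rn R n -> R).

Definition interaction_fun k A E (p : Rn R n * Rn R n) : \bar R :=
  (\1_A p.1 * \1_E p.2 * k (p.1 - p.2)%R)%:E.

Definition interaction k A E : \bar R := integral2 mu mu (interaction_fun k A E).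

Lemma measurable_interaction_fun k A E :
  measurable_fun setT k -> measurable A -> measurable E ->
  measurable_fun setT (interaction_fun k A E).
Proof.
move=> mk mA mE; apply/measurable_EFinP; apply: measurable_funM.
  apply: measurable_funM.
    by apply/measurable_EFinP; exact: (measurable_indic_comp mA measurable_fst).
  by apply/measurable_EFinP; exact: (measurable_indic_comp mE measurable_snd).
by apply: measurableT_comp => //; exact: measurable_rVB.
Qed.

Lemma interaction_fun_ge0 k A E p : (forall x, 0 <= k x)%R ->
  0 <= interaction_fun k A E p.
Proof.
by move=> k0; rewrite lee_fin mulr_ge0// mulr_ge0// indicE; case: (_ \in _).
Qed.

Section reflection.
Variables (w : Rn R n) (c : R).
Hypotheses (w0 : w != 0%R) (c0 : (c <= 0)%R).
Local Notation s := (refl w c).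
Local Notation coef := (refl_coef w c).

(** Averaging over the four ways of reflecting each variable or not: inequalities between double
    integrals may then be checked on four reflected pairs at once. *)
Lemma integral2_refl_quadruple (f : Rn R n * Rn R n -> \bar R) :
  measurable_fun setT f -> (forall p, 0 <= f p) ->
  (integral2 mu mu f + integral2 mu mu f) + (integral2 mu mu f + integral2 mu mu f) =
  integral2 mu mu (fun p => (f p + f (s p.1, s p.2)) + (f (p.1, s p.2) + f (s p.1, p.2))).
Proof.
move=> mf f0; set I := integral2 mu mu f; have ms := measurable_refl w c.
have m2 : measurable_fun setT (fun p => f (p.1, s p.2)).
  apply: measurableT_comp => //; apply: measurable_fun_pair => //.
  exact: measurableT_comp.
have m3 : measurable_fun setT (fun p => f (s p.1, p.2)).
  apply: measurableT_comp => //; apply: measurable_fun_pair => //.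
  exact: measurableT_comp.
have m4 : measurable_fun setT (fun p => f (s p.1, s p.2)).
  by apply: measurableT_comp => //; apply: measurable_fun_pair => //; exact: measurableT_comp.
have I2 : I = integral2 mu mu (fun p => f (p.1, s p.2)).
  apply: eq_integral => x _; rewrite (integral_refl c w0 (f := fun y => f (x, y)))//.
  exact: measurable_fun_pair2.
have I3 : I = integral2 mu mu (fun p => f (s p.1, p.2)).
  symmetry; apply: (integral_refl c w0 (f := fun x => \int[mu]_y f (x, y))).
    exact: measurable_integral2.
  by move=> x; exact: integral_ge0.
have I4 : I = integral2 mu mu (fun p => f (s p.1, s p.2)).
  rewrite I2; symmetry.
  apply: (integral_refl c w0 (f := fun x => \int[mu]_y f (x, s y))).
    by apply: (measurable_integral2 _ m2) => p.
  by move=> x; exact: integral_ge0.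
have D1 := integral2D mu mu mf m4 f0 (fun p => f0 _).
have D2 := integral2D mu mu m2 m3 (fun p => f0 _) (fun p => f0 _).
have D3 := integral2D mu mu (emeasurable_funD mf m4) (emeasurable_funD m2 m3)
  (fun p => adde_ge0 (f0 _) (f0 _)) (fun p => adde_ge0 (f0 _) (f0 _)).
by symmetry; apply: (eq_trans D3); rewrite D1 D2 -I2 -I3 -I4.
Qed.

Lemma interaction_polar k A E : measurable_fun setT k -> (forall x, 0 <= k x)%R ->
  rdec k -> measurable A -> measurable E ->
  interaction k A E <= interaction k (polar w c A) (polar w c E).
Proof.
move=> mk k0 hk mA mE.
have mA' := measurable_polar w c mA; have mE' := measurable_polar w c mE.
have mf := measurable_interaction_fun mk mA mE.
have mg := measurable_interaction_fun mk mA' mE'.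
have f0 p : 0 <= interaction_fun k A E p by exact: interaction_fun_ge0.
have g0 p : 0 <= interaction_fun k (polar w c A) (polar w c E) p.
  exact: interaction_fun_ge0.
have ms := measurable_refl w c.
apply: (lee_quadruple (integral2_ge0 mu mu g0) (integral2_refl_quadruple mf f0)
  (integral2_refl_quadruple mg g0)).
have quad F : measurable_fun setT F -> measurable_fun setT
    (fun p : Rn R n * Rn R n => (F p + F (s p.1, s p.2)) + (F (p.1, s p.2) + F (s p.1, p.2))
      : \bar R).
  move=> mF; apply: emeasurable_funD; apply: emeasurable_funD => //;
  by apply: measurableT_comp => //; apply: measurable_fun_pair => //; exact: measurableT_comp.
have q0 F : (forall p, 0 <= F p) -> forall p : Rn R n * Rn R n,
    0 <= (F p + F (s p.1, s p.2)) + (F (p.1, s p.2) + F (s p.1, p.2)) :> \bar R.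
  by move=> F0 p; rewrite !adde_ge0.
apply: le_integral2; [exact: quad|exact: quad|exact: q0|].
move=> [x y] /=; rewrite /interaction_fun /= -!EFinD lee_fin !indicE.
rewrite !polarE !refl_coefK// !reflK// !oppr_le0.
have kE a b : enorm a = enorm b -> k a = k b.
  by move=> ab; apply/eqP; rewrite eq_le !hk// ab.
rewrite (kE (s x - s y)%R (x - y)%R); last exact: refl_enormB.
rewrite (kE (s x - y)%R (x - s y)%R); last exact: reflBl.
have kle : (0 <= coef x * coef y)%R -> (k (x - s y) <= k (x - y))%R.
  by move=> h; apply: hk; exact: refl_enorm_le.
have kge : (coef x * coef y <= 0)%R -> (k (x - y) <= k (x - s y))%R.
  by move=> h; apply: hk; exact: refl_enorm_ge.
have fx (B : set (Rn R n)) z : coef z = 0%R -> (z \in B) = (s z \in B) by move=> /refl_fix ->.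
move: (fx A x) (fx E y) kle kge.
exact: polarized_products_le.
Qed.

End reflection.
End interaction.

(** * Riesz' rearrangement inequality *)

Section averaging.
Context {R : realType} {n : nat}.
Local Open Scope ereal_scope.
Local Notation mu := (lebesgue_rV n : {sigma_finite_measure set (Rn R n) -> \bar R}).
Local Notation leb := (@lebesgue_measure R).
Implicit Types (P Q A C : set (Rn R n)) (w x : Rn R n) (r theta eta T gamma : R).

Lemma measurable_line (w : Rn R n) :
  measurable_fun setT (fun p : measurableTypeR R * Rn R n => p.2 + (p.1 : R) *: w)%R.
Proof.
apply: measurable_rVD => //; apply: measurable_rVZ => //.
Qed.

Lemma measurable_indic12 : measurable_fun setT
  (fun s : measurableTypeR R => (\1_(`[1%R, 2%R]%classic : set R) s)%:E : \bar R).
Proof.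
apply: (measurable_indic_comp (phi := id) (A := `[1%R, 2%R]%classic : set (measurableTypeR R))) => //.
Qed.

(* The substitution [c = s + 2 <x, w> / |w|^2] turns the reflections orthogonal to [w] into
   translations along [w]. *)
Lemma average_reflections P Q w r eta gamma :
  measurable P -> measurable Q -> w != 0%R -> (0 < eta)%R -> (eta <= enorm w)%R ->
  P `<=` eball 0 r -> (forall x y, P x -> Q y -> (enorm y < enorm x)%R) ->
  (forall c, (c <= 0)%R -> mu (P `&` refl w c @^-1` Q) <= gamma%:E) ->
  \int[leb]_s ((\1_(`[1%R, 2%R]%classic : set R) s)%:E *
     mu (P `&` [set x | Q (x + s *: w)%R])) <= ((r ^+ 2 / eta ^+ 2 + 1) * gamma)%:E.
Proof.
move=> mP mQ w0 eta0 etaw Pr PQ gain; set T := (r ^+ 2 / eta ^+ 2 + 1)%R.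
pose f (p : measurableTypeR R * Rn R n) : \bar R :=
  (\1_(`[1%R, 2%R]%classic : set R) p.1)%:E * ((\1_P p.2)%:E * (\1_Q (p.2 + p.1 *: w)%R)%:E).
pose g (p : measurableTypeR R * Rn R n) : \bar R :=
  (\1_(`[(- T)%R, 0%R]%classic : set R) p.1)%:E * ((\1_P p.2)%:E * (\1_Q (refl w p.1 p.2))%:E).
have m1 (A : set (measurableTypeR R)) : measurable A -> measurable_fun setT
    (fun p : measurableTypeR R * Rn R n => (\1_A p.1)%:E : \bar R).
  by move=> mA; exact: (measurable_indic_comp mA measurable_fst).
have m2 A : measurable A -> measurable_fun setT
    (fun p : measurableTypeR R * Rn R n => (\1_A p.2)%:E : \bar R).
  by move=> mA; exact: (measurable_indic_comp mA measurable_snd).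
have mr : measurable_fun setT (fun p : measurableTypeR R * Rn R n => refl w p.1 p.2).
  apply: measurable_rVD => //; apply: measurable_rVZ => //.
  apply: measurable_funB; first exact: measurable_fst.
  by apply: measurable_funM => //; apply: measurable_funM => //; exact: measurable_dot.
have mf : measurable_fun setT f.
  apply: emeasurable_funM; first by apply: m1; exact: measurable_itv.
  apply: emeasurable_funM; first exact: m2.
  exact: (measurable_indic_comp mQ (measurable_line w)).
have mg : measurable_fun setT g.
  apply: emeasurable_funM; first by apply: m1; exact: measurable_itv.
  apply: emeasurable_funM; first exact: m2.
  exact: (measurable_indic_comp mQ mr).
have f0 p : 0 <= f p by rewrite !mule_ge0// indic_ge0.
have g0 p : 0 <= g p by rewrite !mule_ge0// indic_ge0.
have sect (phi : Rn R n -> Rn R n) : measurable_fun setT phi ->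
    mu (P `&` phi @^-1` Q) = \int[mu]_x ((\1_P x)%:E * (\1_Q (phi x))%:E).
  move=> mphi; have mPQ : measurable (P `&` phi @^-1` Q).
    by apply: measurableI => //; exact: measurable_preimage.
  rewrite -(integral_indicT mu mPQ); apply: eq_integral => x _.
  by rewrite indicI -EFinM.
have -> : \int[leb]_s ((\1_(`[1%R, 2%R]%classic : set R) s)%:E *
    mu (P `&` [set x | Q (x + s *: w)%R])) = \int[leb]_s \int[mu]_x f (s, x).
  apply: eq_integral => s _; rewrite (sect (fun x => x + s *: w)%R); last exact: measurable_rVD.
  rewrite -ge0_integralZl//.
  apply: emeasurable_funM; first exact: (measurable_indic_comp mP (phi := id)).
  by apply: (measurable_indic_comp mQ); exact: measurable_rVD.
apply: (@le_trans _ _ (\int[leb]_c \int[mu]_x g (c, x))).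
  rewrite (fubini_tonelli _ mf f0) (fubini_tonelli _ mg g0).
  apply: ge0_le_integral => //.
  - by move=> x _; exact: integral_ge0.
  - exact: measurable_fun_fubini_tonelli_G.
  - exact: measurable_fun_fubini_tonelli_G.
  move=> x _; set b := (2 * dot x w / dot w w)%R.
  rewrite -[leRHS](ge0_integral_preserve (phi := fun s : measurableTypeR R =>
     (s + b)%R : measurableTypeR R)); last 4 first.
  - have : measurable_fun setT ((fun t : R => (t + b)%R) : R -> R) by apply: measurable_funD.
    exact.
  - by move=> B mB; exact: lebesgue_measure_translate.
  - exact: measurable_fun_pair1.
  - by move=> s.
  apply: ge0_le_integral => //.
  - exact: measurable_fun_pair1.
  - have mb : measurable_fun setT ((fun t : R => (t + b)%R) : R -> R) by apply: measurable_funD.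
    apply: (measurableT_comp (f := fun s : measurableTypeR R => g (s, x))
      (g := fun t : measurableTypeR R => (t + b)%R : measurableTypeR R)).
      exact: measurable_fun_pair1.
    exact: mb.
  move=> s _; rewrite /f /g /= /refl /refl_coef -/b addrK.
  rewrite !indicE; have [xP|xP] := boolP (x \in P); last by rewrite /= !(mul0e, mule0).
  have [yQ|yQ] := boolP ((x + s *: w)%R \in Q); last by rewrite /= !mule0.
  have [s12|s12] := boolP (s \in _); last by rewrite /= mul0e mule_ge0// lee_fin.
  suff -> : (s + b)%R \in (`[(- T)%R, 0%R]%classic : set R) by [].
  move: s12 xP yQ; rewrite !inE /= !in_itv/= => /andP[s1 s2] xP yQ.
  have wgt0 : (0 < dot w w)%R by rewrite dot_gt0.
  have xr : (dot x x <= r ^+ 2)%R.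
    have := Pr _ xP; rewrite /eball /= subr0 => xr.
    by rewrite -sqr_enorm ler_pXn2r// ?nnegrE ?enorm_ge0// ?ltW// (le_lt_trans _ xr)// enorm_ge0.
  have we : (eta ^+ 2 <= dot w w)%R.
    by rewrite -sqr_enorm ler_pXn2r// ?nnegrE ?enorm_ge0// ltW.
  (* Lower bound: $-b|w|^2 = -2\langle x,w\rangle \le |x|^2 + |w|^2 \le T|w|^2$, by $|x| \le r$ and
     $|w| \ge \eta$; this is the origin of [T]. Upper bound: $|x+sw|^2 - |x|^2 = (s+b)s|w|^2$ is
     negative, since points of [Q] are closer to the origin than points of [P]. *)
  apply/andP; split.
    have bw : (b * dot w w = 2 * dot x w)%R by rewrite /b; field; rewrite gt_eqF.
    have := dot_ge0 (x + w); rewrite !dotE (dotC w x) => sq.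
    have : (- (b * dot w w) <= r ^+ 2 + dot w w)%R by rewrite bw; lra.
    have Te : (r ^+ 2 + dot w w <= T * dot w w)%R.
      rewrite /T mulrDl mul1r lerD2r -mulrA ler_peMr ?sqr_ge0//.
      by rewrite mulrC ler_pdivlMr ?mul1r// exprn_gt0.
    move=> h; have := le_trans h Te; rewrite -mulNr ler_pM2r// => h2; lra.
  have yx := PQ _ _ xP yQ.
  have yE : refl w (s + b) x = (x + s *: w)%R by rewrite /refl /refl_coef -/b addrK.
  have := refl_enorm (s + b) w0 x; rewrite yE /refl_coef -/b addrK => e2.
  have : (enorm (x + s *: w) ^+ 2 < enorm x ^+ 2)%R.
    by rewrite ltr_pXn2r// ?nnegrE ?enorm_ge0.
  rewrite e2 gtrDl pmulr_llt0// pmulr_llt0; last by rewrite (lt_le_trans _ s1).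
  exact: ltW.
apply: (@le_trans _ _ (\int[leb]_(c in `[(- T)%R, 0%R]%classic) gamma%:E)).
  rewrite [leRHS]integral_mkcond; apply: ge0_le_integral => //.
  - by move=> c _; exact: integral_ge0.
  - exact: measurable_integral2.
  - apply: (measurable_restrictT _ _).1 => //.
  move=> c _; rewrite /g /= patchE indicE; case: ifPn => cT.
    under eq_integral do rewrite mul1e.
    rewrite -sect; last exact: measurable_refl.
    by apply: gain; move: cT; rewrite inE /= in_itv/= => /andP[].
  by under eq_integral do rewrite mul0e; rewrite integral0.
rewrite integral_cst//= lebesgue_measure_itv/= lte_fin.
have T0 : (0 < T)%R by rewrite ltr_pwDr// divr_ge0// sqr_ge0.
by rewrite oppr_lt0 T0 opprK add0e -EFinM mulrC.
Qed.

(** The measure of the [x] in [P] with $x + sw \in Q$ is integrated over [w] in [W] and [s] in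
    $[1,2]$ in both orders. For fixed [x] and [s], the vectors [w] that lead into [Q] form a set of
    measure $s^{-n}|Q| \ge 2\rho$, of which the ball of radius [eta] removes at most [rho]. Short
    vectors are excluded because the bound of [average_reflections] degenerates as [eta] tends to
    0. *)
Lemma average_lines P Q r theta rho eta K (W : set (Rn R n)) :
  measurable P -> measurable Q -> measurable W ->
  P `<=` eball 0 r -> Q `<=` eball 0 r -> (0 <= theta)%R -> (0 <= rho)%R ->
  theta%:E <= mu P -> theta%:E <= mu Q -> (2 ^- n * theta = rho *+ 2)%R ->
  mu (eball 0 eta) = rho%:E -> eball 0 (2 * r) `<=` W `|` eball 0 eta -> (0 <= K)%R ->
  (forall w, W w -> \int[leb]_s ((\1_(`[1%R, 2%R]%classic : set R) s)%:E *
     mu (P `&` [set x | Q (x + s *: w)%R])) <= K%:E) ->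
  (theta * rho)%:E <= mu W * K%:E.
Proof.
move=> mP mQ mW Pr Qr th0 rho0 thP thQ rhoE etaE Weta K0 lineK.
pose I12 := `[1%R, 2%R]%classic : set R.
pose f (p : (Rn R n * measurableTypeR R) * Rn R n) : \bar R :=
  (\1_P p.2)%:E * (\1_Q (p.2 + p.1.2 *: p.1.1)%R)%:E.
have mline : measurable_fun setT
    (fun p : (Rn R n * measurableTypeR R) * Rn R n => p.2 + (p.1.2 : R) *: p.1.1)%R.
  have m12 : measurable_fun setT
      (fun p : (Rn R n * measurableTypeR R) * Rn R n => p.1.2).
    exact: (measurableT_comp measurable_snd measurable_fst).
  have m11 : measurable_fun setT
      (fun p : (Rn R n * measurableTypeR R) * Rn R n => p.1.1).
    exact: (measurableT_comp measurable_fst measurable_fst).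
  apply: measurable_rVD; first exact: measurable_snd.
  by apply: measurable_rVZ => //; exact: m12.
have mf : measurable_fun setT f.
  apply: emeasurable_funM; first exact: (measurable_indic_comp mP measurable_snd).
  exact: (measurable_indic_comp mQ mline).
have f0 p : 0 <= f p by rewrite !mule_ge0// indic_ge0.
pose M (p : Rn R n * measurableTypeR R) := \int[mu]_x f (p, x).
have mM : measurable_fun setT M by exact: measurable_integral2.
have M0 p : 0 <= M p by exact: integral_ge0.
have ME w (s : R) : mu (P `&` [set x | Q (x + s *: w)%R]) = M (w, s).
  have mPQ : measurable (P `&` [set x | Q (x + s *: w)%R]).
    apply: measurableI => //.
    apply: (measurable_preimage (phi := fun x : Rn R n => (x + s *: w)%R : Rn R n)) => //.
    exact: measurable_rVD.
  rewrite -(integral_indicT mu mPQ); apply: eq_integral => x _.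
  by rewrite /f /= indicI EFinM.
pose H (p : Rn R n * measurableTypeR R) : \bar R :=
  (\1_W p.1)%:E * ((\1_I12 p.2)%:E * M p).
have mW1 : measurable_fun setT (fun p : Rn R n * measurableTypeR R => (\1_W p.1)%:E : \bar R).
  exact: (measurable_indic_comp mW measurable_fst).
have mI : measurable (I12 : set (measurableTypeR R)) by exact: measurable_itv.
have mI1 : measurable_fun setT
    (fun p : Rn R n * measurableTypeR R => (\1_I12 p.2)%:E : \bar R).
  exact: (measurable_indic_comp mI measurable_snd).
have mH : measurable_fun setT H.
  by apply: emeasurable_funM => //; exact: emeasurable_funM.
have H0 p : 0 <= H p by rewrite !mule_ge0// lee_fin.
apply: (@le_trans _ _ (\int[mu]_w \int[leb]_s H (w, s))); last first.
  rewrite -(integral_indicT mu mW) -ge0_integralZr//; last first.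
    exact: (measurable_indic_comp mW (phi := id)).
  apply: ge0_le_integral => //.
  - by move=> w _; exact: integral_ge0.
  - exact: measurable_integral2.
  - by apply: emeasurable_funM => //; exact: (measurable_indic_comp mW (phi := id)).
  move=> w _; rewrite /H /= indicE; have [/set_mem Ww|_] := boolP (w \in W); last first.
    by under eq_integral do rewrite mul0e; rewrite integral0 mul0e.
  rewrite mul1e (le_trans _ (lineK _ Ww))// le_eqVlt; apply/orP; left; apply/eqP.
  by apply: eq_integral => s _; rewrite mul1e ME.
rewrite (fubini_tonelli _ mH H0).
apply: (@le_trans _ _ (\int[leb]_s ((\1_I12 s)%:E * (theta * rho)%:E))).
  rewrite ge0_integralZr//.
  - rewrite integral_indicT//= lebesgue_measure_itv/= lte_fin ltr1n/=.
    by rewrite -EFinB -EFinM lee_fin; lra.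
  - exact: measurable_indic12.
  - by rewrite lee_fin mulr_ge0.
apply: ge0_le_integral => //.
- by move=> s _; rewrite mule_ge0// lee_fin// mulr_ge0.
- by apply: emeasurable_funM => //; exact: measurable_indic12.
- exact: measurable_fun_fubini_tonelli_G.
move=> s _; rewrite /H /= indicE.
have [/set_mem|_] := boolP (s \in I12); last first.
  by rewrite mul0e integral_ge0// => w _; rewrite mule_ge0// mul0e.
rewrite /I12 /= in_itv/= => /andP[s1 s2]; rewrite mul1e.
have s0 : (0 < s)%R by rewrite (lt_le_trans _ s1).
pose h (p : Rn R n * Rn R n) : \bar R := (\1_W p.1)%:E * f ((p.1, s), p.2).
have mh : measurable_fun setT h.
  apply: emeasurable_funM; first exact: (measurable_indic_comp mW measurable_fst).
  apply: (measurableT_comp mf); apply: measurable_fun_pair => //.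
  by apply: measurable_fun_pair.
have h0 p : 0 <= h p by rewrite mule_ge0// lee_fin.
have -> : \int[mu]_w ((\1_W w)%:E * (1 * M (w, s))) = \int[mu]_w \int[mu]_x h (w, x).
  apply: eq_integral => w _; rewrite mul1e -ge0_integralZl//.
  exact: measurable_fun_pair2.
rewrite (fubini_tonelli _ mh h0).
apply: (@le_trans _ _ (\int[mu]_x ((\1_P x)%:E * rho%:E))).
  rewrite ge0_integralZr//; last exact: (measurable_indic_comp mP (phi := id)).
  by rewrite (integral_indicT mu mP) EFinM lee_wpmul2r// lee_fin.
apply: ge0_le_integral => //.
- by move=> x _; rewrite mule_ge0// lee_fin.
- by apply: emeasurable_funM => //; exact: (measurable_indic_comp mP (phi := id)).
- exact: measurable_fun_fubini_tonelli_G.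
move=> x _; rewrite /h /f /= indicE.
have [/set_mem xP|_] := boolP (x \in P); last first.
  by rewrite mul0e; apply: integral_ge0 => w _; rewrite mul0e mule0.
rewrite mul1e; pose V := [set w : Rn R n | Q (x + s *: w)%R].
have mV : measurable V.
  apply: (measurable_preimage (phi := fun w : Rn R n => (x + s *: w)%R : Rn R n)) => //.
  by apply: measurable_rVD => //; apply: measurable_rVZ => //; exact: measurable_cst.
have -> : \int[mu]_w ((\1_W w)%:E * (1 * (\1_Q (x + s *: w)%R)%:E)) = mu (W `&` V).
  have mWV := measurableI _ _ mW mV.
  rewrite -(integral_indicT mu mWV); apply: eq_integral => w _.
  by rewrite mul1e indicI EFinM.
have muV : (rho *+ 2)%:E <= mu V.
  have -> : V = (fun w : Rn R n => s *: w)%R @^-1` ((fun y : Rn R n => y + x)%R @^-1` Q).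
    by apply/seteqP; split => w; rewrite /V /= addrC.
  rewrite lebesgue_scale//; last first.
    apply: (measurable_preimage (phi := fun y : Rn R n => (y + x)%R : Rn R n)) => //.
    exact: measurable_rVD.
  rewrite lebesgue_rV_translate// -rhoE EFinM lee_pmul//.
    by rewrite lee_fin lef_pV2 ?posrE ?exprn_gt0// lerXn2r// nnegrE// ltW.
(* With $y = x + sw$ and $s \ge 1$, $|w|^2 \le |y-x|^2 \le 2|x|^2 + 2|y|^2 < 4r^2$; the middle
   inequality is the nonnegativity of $|x+y|^2$. *)
have VB : V `<=` eball 0 (2 * r)%R.
  move=> w yQ; have xr := Pr _ xP; have yr := Qr _ yQ.
  move: xr yr; rewrite /eball /= !subr0 => xr yr.
  have r0 : (0 <= r)%R by rewrite (le_trans (enorm_ge0 x))// ltW.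
  rewrite enorm_lt_dot// in xr; rewrite enorm_lt_dot// in yr.
  rewrite enorm_lt_dot ?mulr_ge0//.
  have := dot_ge0 (x + (x + s *: w))%R.
  rewrite !dotE (dotC w x) in yr *.
  have w0 := dot_ge0 w.
  have : (dot w w <= s * (s * dot w w))%R.
    by rewrite mulrA ler_peMl// -[leLHS]mulr1 ler_pM//.
  move: yr xr; rewrite exprMn; lra.
have : mu V <= mu (W `&` V) + mu (eball 0 eta).
  apply: (@le_trans _ _ (mu ((W `&` V) `|` eball 0 eta))); last first.
    by apply: measureU2; [exact: measurableI|exact: measurable_eball].
  apply: le_measure; rewrite ?inE//.
    by apply: measurableU; [exact: measurableI|exact: measurable_eball].
  by move=> w Vw; have [Ww|] := Weta _ (VB _ Vw); [left|right].
rewrite etaE => hV; have := le_trans muV hV.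
rewrite mulr2n EFinD leeD2rE//.
Qed.

Lemma centered_lt C x y : centered C -> ~ C x -> C y -> (enorm y < enorm x)%R.
Proof. by move=> hC Cx Cy; rewrite ltNge; apply/negP => h; apply: Cx; exact: hC h. Qed.

Lemma le_measure_setD A C : measurable A -> measurable C -> mu A < +oo ->
  mu A <= mu C -> mu (A `\` C) <= mu (C `\` A).
Proof.
move=> mA mC Aoo; rewrite (measureDI mu mA mC) (measureDI mu mC mA) (setIC C A).
by rewrite leeD2rE// ge0_fin_numE// (le_lt_trans _ Aoo)// measureIl.
Qed.

(** If every admissible reflection gained less than [gamma], [average_reflections] would bound each
    average along a line by $T\gamma$, and [average_lines] would give $\theta\rho \le m T\gamma$,
    with [m] the volume of the ball of radius $2r$. The chosen [gamma] makes the right side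
    $\theta\rho/2$. *)
Lemma reflection_gain r theta : (0 < n)%N -> (0 < r)%R -> (0 < theta)%R ->
  exists2 gamma, (0 < gamma)%R & forall A C, measurable A -> measurable C -> centered C ->
    A `<=` eball 0 r -> mu A <= mu C -> theta%:E <= mu (A `\` C) ->
    exists w c, [/\ w != 0%R, (c <= 0)%R &
      gamma%:E <= mu ((A `\` C) `&` refl w c @^-1` (C `\` A))].
Proof.
move=> n0 r0 th0.
(* Dilation by $s \le 2$ leaves at least $2^{-n}\theta$ of a set of measure [theta]; half of this is
   sacrificed to the short vectors. *)
pose rho := (2 ^- n * theta / 2)%R.
have rho0 : (0 < rho)%R by rewrite !mulr_gt0// ?invr_gt0 ?exprn_gt0.
have [eta eta_ge0 etaE] := @lebesgue_eball_radius R n rho%:E n0 (ltW rho0) (ltry _).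
have eta0 : (0 < eta)%R.
  rewrite lt_def eta_ge0 andbT; apply/eqP => eta0; move: etaE.
  by rewrite eta0 eball_eq0// measure0 => -[] rhoE; rewrite -rhoE ltxx in rho0.
pose T := (r ^+ 2 / eta ^+ 2 + 1)%R.
have T0 : (0 < T)%R by rewrite ltr_pwDr// divr_ge0// sqr_ge0.
pose m := fine (mu (eball 0 (2 * r))).
have m0 : (0 < m)%R by rewrite fine_gt0// lebesgue_eball_lty lebesgue_eball_gt0// mulr_gt0.
have mE : mu (eball 0 (2 * r)) = m%:E.
  by rewrite fineK// ge0_fin_numE// lebesgue_eball_lty.
pose gamma := (theta * rho / (2 * (T * m)))%R.
have gamma0 : (0 < gamma)%R by rewrite divr_gt0// !mulr_gt0.
exists gamma => // A C mA mC hC Ar AC thA.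
apply: contrapT => noref.
have small w c : w != 0%R -> (c <= 0)%R ->
    mu ((A `\` C) `&` refl w c @^-1` (C `\` A)) <= gamma%:E.
  move=> w0 c0; rewrite leNgt; apply/negP => h; apply: noref.
  by exists w, c; split => //; exact: ltW.
have Aoo : mu A < +oo.
  apply: (le_lt_trans _ (lebesgue_eball_lty r)); apply: le_measure; rewrite ?inE//.
  exact: measurable_eball.
have [x0 [Ax0 Cx0]] : (A `\` C) !=set0.
  by apply/set0P/eqP => A0; move: thA; rewrite A0 measure0 lee_fin leNgt th0.
have mP := measurableD mA mC; have mQ := measurableD mC mA.
have Pr : (A `\` C) `<=` eball 0 r by move=> x [/Ar].
(* Points of [C] are closer to the origin than [x0], which is in [A] but not in [C]; so the ball
   that contains [A] also contains what [C] has outside [A]. *)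
have Qr : (C `\` A) `<=` eball 0 r.
  move=> y [Cy _]; have := Ar _ Ax0; rewrite /eball /= !subr0.
  exact/lt_trans/(centered_lt hC Cx0 Cy).
pose W : set (Rn R n) := eball 0 (2 * r) `\` eball 0 eta.
have mW : measurable W by apply: measurableD; exact: measurable_eball.
have := average_lines (K := (T * gamma)%R) mP mQ mW Pr Qr (ltW th0) (ltW rho0) thA
  (le_trans thA (le_measure_setD mA mC Aoo AC)).
move=> /(_ eta).
have -> : (2 ^- n * theta = rho *+ 2)%R.
  by rewrite /rho -[RHS]mulr_natr divfK.
move=> /(_ erefl etaE).
have cover : eball 0 (2 * r) `<=` W `|` eball 0 eta.
  by move=> w Bw; have [|] := pselect (eball 0 eta w); [right|left; split].
move=> /(_ cover (mulr_ge0 (ltW T0) (ltW gamma0))) bad.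
have /bad : forall w, W w -> \int[leb]_s ((\1_(`[1%R, 2%R]%classic : set R) s)%:E *
    mu ((A `\` C) `&` [set x | (C `\` A) (x + s *: w)%R])) <= (T * gamma)%:E.
  move=> w [_ Bw]; have etaw : (eta <= enorm w)%R.
    by move: Bw; rewrite /eball /= subr0 => /negP; rewrite -leNgt.
  have w0 : w != 0%R by rewrite -enorm_eq0 gt_eqF// (lt_le_trans eta0).
  apply: (average_reflections (r := r) (eta := eta)) => //.
    by move=> x y [Ax Cx] [Cy _]; exact: (centered_lt hC Cx Cy).
  by move=> c; exact: small.
apply/negP; rewrite -ltNge.
have WB : mu W <= m%:E.
  rewrite -mE; apply: le_measure; rewrite ?inE//; first exact: measurable_eball.
  exact: subDsetl.
apply: (@le_lt_trans _ _ (m%:E * (T * gamma)%:E)).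
  by rewrite lee_wpmul2r// lee_fin mulr_ge0// ltW.
rewrite -EFinM lte_fin /gamma.
have -> : (m * (T * (theta * rho / (2 * (T * m)))) = theta * rho / 2)%R.
  by field; rewrite !gt_eqF.
by rewrite ltr_pdivrMr// ltr_pMr ?mulr_gt0// ltr1n.
Qed.

End averaging.

(** A pair of points in the product of two sets either lies in the product of their targets, or has
    its first component outside the first target, or its second outside the second. *)
Lemma indic_split_le {R : realFieldType} (k M : R) (a c e d : bool) : 0 <= k <= M ->
  a%:R * e%:R * k <= c%:R * d%:R * k +
    (M * ((a && ~~ c)%:R * e%:R) + M * (a%:R * (e && ~~ d)%:R)).
Proof.
by move=> /andP[k0 kM]; case: a; case: c; case: e; case: d => /=; lra.
Qed.

(** * Riesz' inequality for bounded kernels and bounded sets *)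

Section riesz.
Context {R : realType} {n : nat}.
Local Open Scope ereal_scope.
Local Notation mu := (lebesgue_rV n : {sigma_finite_measure set (Rn R n) -> \bar R}).
Implicit Types (A E C D : set (Rn R n)) (w : Rn R n) (c r : R).

Lemma polar_sub A C w c : w != 0%R -> (c <= 0)%R -> centered C ->
  A `<=` C -> polar w c A `<=` C.
Proof.
move=> w0 c0 hC AC x; rewrite /polar /=; have := refl_centered w0 c0 x hC.
case: ifPn => _ h; last by move=> [/AC].
by move=> [/AC//|/AC Csx]; move: h; rewrite !inE; exact.
Qed.

Lemma eball_centered r : centered (eball 0 r : set (Rn R n)).
Proof. by move=> x y; rewrite /eball /= !subr0 => xr yx; exact: le_lt_trans xr. Qed.

Lemma sub_eball_lty A r : measurable A -> A `<=` eball 0 r -> mu A < +oo.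
Proof.
move=> mA Ar; apply: (le_lt_trans _ (lebesgue_eball_lty r)).
by apply: le_measure; rewrite ?inE//; exact: measurable_eball.
Qed.

(** Since polarization preserves the measure of [A], what [polar_gain] adds inside [C] disappears
    outside; finiteness of that measure permits the subtraction. *)
Lemma polar_excess A C w c : w != 0%R -> (c <= 0)%R -> measurable A -> measurable C ->
  centered C -> mu A < +oo ->
  mu (polar w c A `\` C) + mu ((A `\` C) `&` refl w c @^-1` (C `\` A)) <= mu (A `\` C).
Proof.
move=> w0 c0 mA mC hC Aoo.
have mP := measurable_polar w c mA.
have gain := polar_gain w0 c0 mA mC hC.
have PE := lebesgue_polar c w0 mA.
have AE : mu A = mu (A `\` C) + mu (A `&` C) by exact: measureDI.
have PE2 : mu A = mu (polar w c A `\` C) + mu (polar w c A `&` C).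
  by rewrite -PE; exact: measureDI.
have fin B : mu B <= mu A -> mu B \is a fin_num.
  by move=> BA; rewrite ge0_fin_numE// (le_lt_trans BA).
have f1 : mu (A `\` C) \is a fin_num by apply: fin; apply: le_measure; rewrite ?inE//; exact: measurableD.
have f2 : mu (A `&` C) \is a fin_num by apply: fin; exact: measureIl.
have f3 : mu (polar w c A `\` C) \is a fin_num.
  by apply: fin; rewrite PE2 leeDl.
have f4 : mu (polar w c A `&` C) \is a fin_num.
  by apply: fin; rewrite PE2 leeDr.
have f5 : mu ((A `\` C) `&` refl w c @^-1` (C `\` A)) \is a fin_num.
  rewrite ge0_fin_numE// (le_lt_trans _ (_ : mu (A `\` C) < +oo))//.
    apply: measureIl; first exact: measurableD.
    by apply: measurable_preimage; [exact: measurable_refl|exact: measurableD].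
  by rewrite -ge0_fin_numE.
move: gain AE PE2; rewrite -(fineK f1) -(fineK f2) -(fineK f3) -(fineK f4) -(fineK f5).
move=> gain AE PE2; move: PE2; rewrite AE -!EFinD => -[] PE2.
by move: gain; rewrite -!EFinD !lee_fin => gain; lra.
Qed.

(** No sequence of polarizations is built. Among all admissible pairs one takes a pair whose total
    excess is within [gamma] of the infimum. If that total were at least [e], one of the two sets
    would have excess at least [e / 2]; a suitable reflection lowers this excess by [gamma] without
    raising the other one, and so falls below the infimum. *)
Lemma bounded_riesz_approx (k : Rn R n -> R) A E C D r (e : R) : (0 < n)%N -> (0 < r)%R -> (0 < e)%R ->
  measurable_fun setT k -> (forall x, 0 <= k x)%R -> rdec k ->
  measurable A -> measurable E -> measurable C -> measurable D ->
  centered C -> centered D -> A `<=` eball 0 r -> E `<=` eball 0 r ->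
  mu A <= mu C -> mu E <= mu D ->
  exists A' E', [/\ measurable A' /\ measurable E',
    A' `<=` eball 0 r /\ E' `<=` eball 0 r,
    interaction k A E <= interaction k A' E',
    mu (A' `\` C) < e%:E & mu (E' `\` D) < e%:E].
Proof.
move=> n0 r0 e0 mk k0 hk mA mE mC mD hC hD Ar Er AC ED.
(* Both sets are polarized at the same hyperplane, so admissibility concerns the pair. Recording the
   equality of measures keeps the hypothesis [mu A <= mu C] of [reflection_gain] available. *)
pose ok (p : set (Rn R n) * set (Rn R n)) := [/\ measurable p.1 /\ measurable p.2,
    p.1 `<=` eball 0 r /\ p.2 `<=` eball 0 r, interaction k A E <= interaction k p.1 p.2,
    mu p.1 = mu A & mu p.2 = mu E].
pose excess (p : set (Rn R n) * set (Rn R n)) : R :=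
  (fine (mu (p.1 `\` C)) + fine (mu (p.2 `\` D)))%R.
have fin A' B : measurable A' -> measurable B -> A' `<=` eball 0 r ->
    mu (A' `\` B) \is a fin_num.
  move=> mA' mB Ar'; rewrite ge0_fin_numE// (sub_eball_lty (r := r))//.
    exact: measurableD.
  by move=> x [/Ar'].
apply: contrapT => none.
have big p : ok p -> (e <= excess p)%R.
  move=> [[m1 m2] [s1 s2] kp _ _]; rewrite leNgt; apply/negP => small; apply: none.
  exists p.1, p.2; split => //.
    rewrite -(fineK (fin _ _ m1 mC s1)) lte_fin (le_lt_trans _ small)//.
    by rewrite lerDl fine_ge0.
  rewrite -(fineK (fin _ _ m2 mD s2)) lte_fin (le_lt_trans _ small)//.
  by rewrite lerDr fine_ge0.
pose S := [set excess p | p in ok].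
have okAE : ok (A, E) by split.
have infS : has_inf S.
  by split; [exists (excess (A, E)), (A, E)|exists e => _ [p okp <-]; exact: big].
have [gamma gamma0 gain] := @reflection_gain R n r (e / 2) n0 r0 (divr_gt0 e0 (ltr0Sn _ _)).
have [_ [p okp <-] pS] := inf_adherent gamma0 infS.
have [[m1 m2] [s1 s2] kp p1 p2] := okp.
have step w c : w != 0%R -> (c <= 0)%R -> ok (polar w c p.1, polar w c p.2).
  move=> w0 c0; split.
  - by split; exact: measurable_polar.
  - by split; apply: polar_sub => //; exact: eball_centered.
  - by apply: (le_trans kp); exact: interaction_polar.
  - by rewrite -p1; exact: lebesgue_polar.
  - by rewrite -p2; exact: lebesgue_polar.
have gain_fin B F w c : measurable B -> measurable F -> B `<=` eball 0 r ->
    mu ((B `\` F) `&` refl w c @^-1` (F `\` B)) \is a fin_num.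
  move=> mB mF Br; rewrite ge0_fin_numE// (le_lt_trans _ (_ : mu (B `\` F) < +oo))//.
    apply: measureIl; first exact: measurableD.
    by apply: measurable_preimage; [exact: measurable_refl|exact: measurableD].
  by rewrite -ge0_fin_numE// fin.
have fine_le B F w c : w != 0%R -> (c <= 0)%R -> measurable B -> B `<=` eball 0 r ->
    measurable F -> centered F ->
    (fine (mu (polar w c B `\` F)) + fine (mu ((B `\` F) `&` refl w c @^-1` (F `\` B))) <=
     fine (mu (B `\` F)))%R.
  move=> w0 c0 mB Br mF hF; have mP := measurable_polar w c mB.
  have Boo := sub_eball_lty mB Br.
  have := polar_excess w0 c0 mB mF hF Boo.
  have f1 := fin _ _ mB mF Br.
  have f2 : mu (polar w c B `\` F) \is a fin_num.
    by apply: fin => //; apply: polar_sub => //; exact: eball_centered.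
  have f3 := gain_fin _ _ w c mB mF Br.
  by rewrite -(fineK f1) -(fineK f2) -(fineK f3) -EFinD lee_fin.
have inf_le w c : w != 0%R -> (c <= 0)%R ->
    (inf S <= excess (polar w c p.1, polar w c p.2))%R.
  move=> w0 c0; apply: ge_inf; first by case: infS.
  exists (polar w c p.1, polar w c p.2); [exact: step|exact: erefl].
have absurd w c : w != 0%R -> (c <= 0)%R ->
    gamma%:E <= mu ((p.1 `\` C) `&` refl w c @^-1` (C `\` p.1)) \/
    gamma%:E <= mu ((p.2 `\` D) `&` refl w c @^-1` (D `\` p.2)) -> False.
  move=> w0 c0 gain2; have := inf_le w c w0 c0.
  have f1 := fine_le p.1 C w c w0 c0 m1 s1 mC hC.
  have f2 := fine_le p.2 D w c w0 c0 m2 s2 mD hD.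
  have g1 : (0 <= fine (mu ((p.1 `\` C) `&` refl w c @^-1` (C `\` p.1))))%R by exact: fine_ge0.
  have g2 : (0 <= fine (mu ((p.2 `\` D) `&` refl w c @^-1` (D `\` p.2))))%R by exact: fine_ge0.
  have g3 : (gamma <= fine (mu ((p.1 `\` C) `&` refl w c @^-1` (C `\` p.1))) \/
    gamma <= fine (mu ((p.2 `\` D) `&` refl w c @^-1` (D `\` p.2))))%R.
    by case: gain2 => h; [left|right]; rewrite -lee_fin fineK//;
      exact: gain_fin.
  move: pS; rewrite /excess /=; case: g3; lra.
have [h|h] : (e / 2 <= fine (mu (p.1 `\` C)) \/ e / 2 <= fine (mu (p.2 `\` D)))%R.
  have := big p okp; rewrite /excess => h.
  by have [?|?] := leP (e / 2)%R (fine (mu (p.1 `\` C))); [left|right; lra].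
- have [||w [c [w0 c0 hg]]] := gain p.1 C m1 mC hC s1.
  + by rewrite p1.
  + by rewrite -(fineK (fin _ _ m1 mC s1)) lee_fin.
  by apply: (absurd w c) => //; left.
- have [||w [c [w0 c0 hg]]] := gain p.2 D m2 mD hD s2.
  + by rewrite p2.
  + by rewrite -(fineK (fin _ _ m2 mD s2)) lee_fin.
  by apply: (absurd w c) => //; right.
Qed.

Lemma integral2_indic (M : R) A E : (0 <= M)%R -> measurable A -> measurable E ->
  integral2 mu mu (fun p => (M * (\1_A p.1 * \1_E p.2))%:E) = M%:E * (mu A * mu E).
Proof.
move=> M0 mA mE; rewrite /integral2 -(integral_indicT mu mA) -(integral_indicT mu mE).
rewrite -ge0_integralZr//; last 2 first.
- exact: (measurable_indic_comp mA (phi := id)).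
- by apply: integral_ge0 => x _; exact: indic_ge0.
rewrite -ge0_integralZl//; last 2 first.
- apply: emeasurable_funM => //; exact: (measurable_indic_comp mA (phi := id)).
- move=> x _; rewrite mule_ge0 ?indic_ge0//.
  by apply: integral_ge0 => y _; exact: indic_ge0.
apply: eq_integral => x _; rewrite muleA -ge0_integralZl//.
- by apply: eq_integral => y _; rewrite !EFinM muleA.
- exact: (measurable_indic_comp mE (phi := id)).
- by rewrite mule_ge0// indic_ge0.
Qed.

(** The approximating sets leave [C] and [D] only by measure [e], which costs at most $2Mem$ in
    interaction, [m] being the volume of the ball; then [e] tends to 0. *)
Lemma bounded_riesz (k : Rn R n -> R) (M : R) A E C D r :
  (0 < n)%N -> (0 < r)%R ->
  measurable_fun setT k -> (forall x, 0 <= k x <= M)%R -> rdec k ->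
  measurable A -> measurable E -> measurable C -> measurable D ->
  centered C -> centered D -> A `<=` eball 0 r -> E `<=` eball 0 r ->
  mu A <= mu C -> mu E <= mu D -> interaction k A E <= interaction k C D.
Proof.
move=> n0 r0 mk kM hk mA mE mC mD hC hD Ar Er AC ED.
have k0 x : (0 <= k x)%R by have /andP[] := kM x.
have M0 : (0 <= M)%R by have /andP[] := kM 0%R; exact: le_trans.
pose m := fine (mu (eball 0 r)).
have mE' : mu (eball 0 r) = m%:E by rewrite fineK// ge0_fin_numE// lebesgue_eball_lty.
have m0 : (0 < m)%R by rewrite fine_gt0// lebesgue_eball_lty lebesgue_eball_gt0.
have error e : (0 < e)%R ->
    interaction k A E <= interaction k C D + (M * (e * m) + M * (m * e))%:E.
  move=> e0.
  have [A' [E' [[mA' mE''] [Ar' Er'] AE eA eE]]] := bounded_riesz_approx n0 r0 e0 mk k0 hk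
    mA mE mC mD hC hD Ar Er AC ED.
  apply: (le_trans AE).
  have mAC := measurableD mA' mC; have mED := measurableD mE'' mD.
  have ball_le B : measurable B -> B `<=` eball 0 r -> mu B <= m%:E.
    by move=> mB Br; rewrite -mE'; apply: le_measure; rewrite ?inE//; exact: measurable_eball.
  pose g1 (p : Rn R n * Rn R n) : \bar R := (M * (\1_(A' `\` C) p.1 * \1_E' p.2))%:E.
  pose g2 (p : Rn R n * Rn R n) : \bar R := (M * (\1_A' p.1 * \1_(E' `\` D) p.2))%:E.
  have mg B F : measurable B -> measurable F -> measurable_fun setT
      (fun p : Rn R n * Rn R n => (M * (\1_B p.1 * \1_F p.2))%:E : \bar R).
    move=> mB mF; apply/measurable_EFinP; apply: measurable_funM => //.
    apply: measurable_funM; apply/measurable_EFinP.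
      exact: (measurable_indic_comp mB measurable_fst).
    exact: (measurable_indic_comp mF measurable_snd).
  have gge B F (p : Rn R n * Rn R n) : 0 <= (M * (\1_B p.1 * \1_F p.2))%:E :> \bar R.
    by rewrite lee_fin mulr_ge0// mulr_ge0.
  have fle p : interaction_fun k A' E' p <= interaction_fun k C D p + (g1 p + g2 p).
    rewrite /interaction_fun /g1 /g2 -!EFinD lee_fin !indicE.
    have := kM (p.1 - p.2)%R; have := k0 (p.1 - p.2)%R; move: (k _) => kp kp0 /andP[_ kpM].
    have inD B F (x : Rn R n) : (x \in B `\` F) = (x \in B) && (x \notin F).
      by apply/idP/andP; rewrite notin_setE !inE.
    by rewrite !inD; apply: indic_split_le; rewrite kp0.
  have k1 := measurable_interaction_fun mk mC mD.
  have k2 := fun p => interaction_fun_ge0 C D p k0.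
  apply: (@le_trans _ _ (interaction k C D + (integral2 mu mu g1 + integral2 mu mu g2))).
    rewrite -[X in _ + X]integral2D; [|exact: mg|exact: mg|exact: gge|exact: gge].
    rewrite -[leRHS]integral2D; [|exact: k1| |exact: k2|].
    - apply: le_integral2 fle; first exact: measurable_interaction_fun.
      + apply: emeasurable_funD => //; apply: emeasurable_funD; exact: mg.
      + by move=> p; exact: interaction_fun_ge0.
    - apply: emeasurable_funD; exact: mg.
    - by move=> p; rewrite adde_ge0 ?gge.
  rewrite leeD2l// !integral2_indic// EFinD !EFinM.
  rewrite leeD//; apply: lee_wpmul2l; rewrite ?lee_fin//; apply: lee_pmul => //.
  - exact: ltW.
  - exact: ball_le.
  - exact: ball_le.
  - exact: ltW.
apply/lee_addgt0Pr => e e0.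
(* The summand 1 keeps the denominator positive when [M] is 0. *)
have d0 : (0 < 2 * (M * m) + 1)%R by rewrite ltr_wpDl// !mulr_ge0// ltW.
have := error _ (divr_gt0 e0 d0) => /le_trans; apply.
rewrite leeD2l// lee_fin.
have -> : (M * (e / (2 * (M * m) + 1) * m) + M * (m * (e / (2 * (M * m) + 1))) =
  e * ((2 * (M * m)) / (2 * (M * m) + 1)))%R by field; rewrite gt_eqF.
by rewrite ler_piMr ?ltW// ltr_pdivrMr// mul1r ltrDl.
Qed.

End riesz.

(** * Monotone limits, and Riesz' inequality for arbitrary sets and extended-valued kernels *)

Section limits.
Context {R : realType}.
Local Open Scope ereal_scope.

Lemma le_integral_lim d (T : measurableType d) (m : {measure set T -> \bar R})
    (f : (T -> \bar R)^nat) (g : T -> \bar R) (b : \bar R) :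
  (forall j, measurable_fun setT (f j)) -> (forall j x, 0 <= f j x) ->
  (forall x, nondecreasing_seq (f ^~ x)) -> (forall x, f ^~ x @ \oo --> g x) ->
  (forall j, \int[m]_x f j x <= b) -> \int[m]_x g x <= b.
Proof.
move=> mf f0 ndf fg fb.
have -> : \int[m]_x g x = \int[m]_x limn (f ^~ x).
  by apply: eq_integral => x _; apply/esym/cvg_lim => //; exact: fg.
rewrite monotone_convergence//.
apply: lime_le; last by apply: nearW => j; exact: fb.
apply: ereal_nondecreasing_is_cvgn => i j ij.
by apply: ge0_le_integral => // x _; exact: ndf.
Qed.

Lemma le_integral2_lim d1 d2 (T1 : measurableType d1) (T2 : measurableType d2)
    (m1 : {sigma_finite_measure set T1 -> \bar R})
    (m2 : {sigma_finite_measure set T2 -> \bar R})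
    (f : (T1 * T2 -> \bar R)^nat) (g : T1 * T2 -> \bar R) (b : \bar R) :
  (forall j, measurable_fun setT (f j)) -> (forall j x, 0 <= f j x) ->
  (forall x, nondecreasing_seq (f ^~ x)) -> (forall x, f ^~ x @ \oo --> g x) ->
  (forall j, integral2 m1 m2 (f j) <= b) -> integral2 m1 m2 g <= b.
Proof.
move=> mf f0 ndf fg fb.
have mg : measurable_fun setT g.
  by apply: (emeasurable_fun_cvg f) => // x _; exact: fg.
have g0 x : 0 <= g x.
  have gx := fg x; rewrite -(cvg_lim _ gx)//; apply: lime_ge; first by apply/cvg_ex; exists (g x).
  by apply: nearW => j.
rewrite /integral2 -fubini_tonelli1//.
apply: (le_integral_lim mf f0 ndf fg) => j.
by rewrite fubini_tonelli1//; exact: fb.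
Qed.

Lemma cvg_truncate (x : \bar R) : 0 <= x ->
  (fun j : nat => mine x j%:R%:E) @ \oo --> x.
Proof.
case: x => [r| |//] _; last first.
  rewrite (_ : (fun j : nat => mine +oo j%:R%:E) = (fun j : nat => j%:R%:E)).
    exact/cvgeryP/cvgr_idn.
  by apply/funext => j; rewrite /mine ltNge leey.
apply: cvg_near_cst; near=> j.
rewrite /mine lte_fin; case: ifPn => //; rewrite -leNgt => h.
exfalso; move: h; apply/negP; rewrite -ltNge.
near: j; apply: nbhs_infty_gtr.
Unshelve. all: by end_near. Qed.

End limits.

Section extended_riesz.
Context {R : realType} {n : nat}.
Local Open Scope ereal_scope.
Local Notation mu := (lebesgue_rV n : {sigma_finite_measure set (Rn R n) -> \bar R}).
Implicit Types (A E C D : set (Rn R n)) (k f g : Rn R n -> \bar R).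

Definition extended_interaction_fun k A E (p : Rn R n * Rn R n) : \bar R :=
  (\1_A p.1)%:E * ((\1_E p.2)%:E * k (p.1 - p.2)%R).

Lemma measurable_extended_interaction_fun k A E :
  measurable_fun setT k -> measurable A -> measurable E ->
  measurable_fun setT (extended_interaction_fun k A E).
Proof.
move=> mk mA mE; apply: emeasurable_funM; first exact: (measurable_indic_comp mA measurable_fst).
apply: emeasurable_funM; first exact: (measurable_indic_comp mE measurable_snd).
by apply: (measurableT_comp mk); exact: measurable_rVB.
Qed.

Definition truncate k (j : nat) x : R := fine (mine (k x) j%:R%:E).

Lemma truncateE k j x : (forall x, 0 <= k x) -> (truncate k j x)%:E = mine (k x) j%:R%:E.
Proof.
move=> k0; rewrite fineK// ge0_fin_numE; first by rewrite gt_min ltry orbT.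
by rewrite le_min k0 lee_fin ler0n.
Qed.

(** The kernel is truncated at height [j] and the two sets are cut by the ball of radius [j + 1],
    positive already for [j = 0]; the targets [C] and [D] stay fixed, so monotone convergence is
    needed on the left side only. *)
Lemma riesz k A E C D : (0 < n)%N ->
  measurable_fun setT k -> (forall x, 0 <= k x) -> rdec k ->
  measurable A -> measurable E -> measurable C -> measurable D ->
  centered C -> centered D -> mu A <= mu C -> mu E <= mu D ->
  integral2 mu mu (extended_interaction_fun k A E) <=
  integral2 mu mu (extended_interaction_fun k C D).
Proof.
move=> n0 mk k0 hk mA mE mC mD hC hD AC ED.
pose B (j : nat) : set (Rn R n) := eball 0 j.+1%:R.
have mB j : measurable (B j) by exact: measurable_eball.
have mt j : measurable_fun setT (truncate k j).
  apply/measurable_EFinP; rewrite (_ : EFin \o _ = fun x => mine (k x) j%:R%:E).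
    exact: measurable_mine.
  by apply/funext => x; rewrite /= truncateE.
have tj j x : (0 <= truncate k j x <= j%:R)%R.
  by rewrite -!lee_fin truncateE// le_min k0 lee_fin ler0n ge_min lexx orbT.
have ht j : rdec (truncate k j).
  move=> x y xy; rewrite -lee_fin !truncateE// le_min !ge_min lexx orbT andbT.
  by rewrite hk.
have leK j : integral2 mu mu (interaction_fun (truncate k j) (A `&` B j) (E `&` B j)) <=
    integral2 mu mu (extended_interaction_fun k C D).
  apply: (@le_trans _ _ (interaction (truncate k j) C D)).
    apply: (bounded_riesz (M := j%:R) (r := j.+1%:R)) => //.
    - exact: measurableI.
    - exact: measurableI.
    - exact: (le_trans (measureIl _ _ _)).
    - exact: (le_trans (measureIl _ _ _)).
  apply: le_integral2.
  - exact: measurable_interaction_fun.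
  - exact: measurable_extended_interaction_fun.
  - by move=> p; apply: interaction_fun_ge0 => x; have /andP[] := tj j x.
  - move=> p; rewrite /interaction_fun /extended_interaction_fun !EFinM truncateE// -muleA.
    by do 2 rewrite lee_wpmul2l ?lee_fin//; rewrite ge_min lexx.
have inB x : exists N, forall j, (N <= j)%N -> x \in B j.
  have [N Nx] : exists N : nat, (enorm x < N%:R)%R.
    by exists (Num.truncn (enorm x)).+1; exact: truncnS_gt.
  exists N => j Nj; rewrite inE /B /eball /= subr0 (lt_le_trans Nx)//.
  by rewrite ler_nat (leq_trans Nj).
have nB x i j : (i <= j)%N -> x \in B i -> x \in B j.
  move=> ij; rewrite !inE /B /eball /= !subr0 => /lt_le_trans; apply.
  by rewrite ler_nat ltnS.
have inI F j x : (x \in F `&` B j) = (x \in F) && (x \in B j).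
  by apply/idP/andP; rewrite !inE.
apply: (le_integral2_lim _ _ _ _ leK).
- by move=> j; apply: measurable_interaction_fun => //; exact: measurableI.
- by move=> j p; apply: interaction_fun_ge0 => x; have /andP[] := tj j x.
- move=> p i j ij; rewrite /interaction_fun !indicE !inI !EFinM !truncateE//.
  apply: lee_pmul => //; rewrite ?le_min ?k0 ?lee_fin ?mulr_ge0 ?ler0n//.
    apply: ler_pM => //; rewrite ler_nat.
      by case: (p.1 \in A) => //=; case: (boolP (p.1 \in B i)) => // /(nB _ _ _ ij) ->.
    by case: (p.2 \in E) => //=; case: (boolP (p.2 \in B i)) => // /(nB _ _ _ ij) ->.
  by rewrite !ge_min lexx/= lee_fin ler_nat ij orbT.
- move=> p; have [N1 H1] := inB p.1; have [N2 H2] := inB p.2.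
  pose h j := (\1_A p.1)%:E * ((\1_E p.2)%:E * mine (k (p.1 - p.2)%R) j%:R%:E).
  apply: (cvg_trans (G := h @ \oo)).
    apply: near_eq_cvg; exists (maxn N1 N2) => // j /=; rewrite geq_max => /andP[h1 h2].
    rewrite /h /interaction_fun !indicE !inI H1// H2// !andbT !EFinM truncateE//.
    by rewrite muleA.
  rewrite /h /extended_interaction_fun !indicE.
  case: (p.1 \in A) => /=; last first.
    by apply: cvg_near_cst; apply: nearW => j; rewrite !mul0e.
  case: (p.2 \in E) => /=; last first.
    by apply: cvg_near_cst; apply: nearW => j; rewrite !mul0e.
  rewrite !mul1e; apply: cvg_trans (cvg_truncate (k0 _)).
  by apply: near_eq_cvg; apply: nearW => j; rewrite !mul1e.
Qed.

End extended_riesz.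

(** * Weak majorization of potentials *)

Section potential.
Context {R : realType} {n : nat}.
Local Open Scope ereal_scope.
Local Notation mu := (lebesgue_rV n : {sigma_finite_measure set (Rn R n) -> \bar R}).
Implicit Types (A E C D : set (Rn R n)) (k f g : Rn R n -> \bar R).

Definition pot k g (x : Rn R n) : \bar R := \int[mu]_y (k (x - y)%R * g y).

Lemma measurable_pot_fun k g : measurable_fun setT k -> measurable_fun setT g ->
  measurable_fun setT (fun p : Rn R n * Rn R n => k (p.1 - p.2)%R * g p.2).
Proof.
move=> mk mg; apply: emeasurable_funM; last exact: measurableT_comp.
by apply: (measurableT_comp mk); exact: measurable_rVB.
Qed.

Lemma measurable_kernel k (x : Rn R n) : measurable_fun setT k ->
  measurable_fun setT (fun y : Rn R n => k (x - y)%R).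
Proof. by move=> mk; apply: (measurableT_comp mk); exact: measurable_rVB. Qed.

Lemma measurable_pot k g : measurable_fun setT k -> (forall x, 0 <= k x) ->
  measurable_fun setT g -> (forall x, 0 <= g x) -> measurable_fun setT (pot k g).
Proof.
move=> mk k0 mg g0.
apply: (measurable_integral2 _ (measurable_pot_fun mk mg)) => p.
exact: mule_ge0.
Qed.

Lemma pot_ge0 k g x : (forall x, 0 <= k x) -> (forall x, 0 <= g x) -> 0 <= pot k g x.
Proof. by move=> k0 g0; apply: integral_ge0 => y _; exact: mule_ge0. Qed.

Lemma rdec_sym k x y : rdec k -> k (x - y)%R = k (y - x)%R.
Proof.
move=> hk; have e : enorm (x - y)%R = enorm (y - x)%R by rewrite -opprB enormN.
by apply/eqP; rewrite eq_le !hk// e.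
Qed.

(** For finite values this is $(a_1-a_2)(b_1-b_2) \ge 0$. If [a1] or [b1] is infinite, either the
    right side is infinite, or the other large factor is 0 and with it its smaller partner. *)
Lemma rearrangement_ineq2 (a1 a2 b1 b2 : \bar R) : 0 <= a2 -> 0 <= b2 ->
  a2 <= a1 -> b2 <= b1 -> a2 * b1 + a1 * b2 <= a1 * b1 + a2 * b2.
Proof.
move=> a20 b20 a21 b21.
have a10 := le_trans a20 a21; have b10 := le_trans b20 b21.
have ab2 : a2 * b2 != -oo by rewrite gt_eqF// (lt_le_trans (ltNyr 0%R))// mule_ge0.
have [b1y|b1y] := eqVneq b1 +oo.
  have [a10'|a10'] := eqVneq a1 0.
    have -> : a2 = 0 by apply/eqP; rewrite eq_le a20 -a10' a21.
    by rewrite a10' !mul0e.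
  have -> : a1 * b1 = +oo by rewrite b1y gt0_muley// lt0e a10' a10.
  by rewrite addye// leey.
have [a1y|a1y] := eqVneq a1 +oo.
  have [b10'|b10'] := eqVneq b1 0.
    have -> : b2 = 0 by apply/eqP; rewrite eq_le b20 -b10' b21.
    by rewrite b10' !mule0.
  have -> : a1 * b1 = +oo by rewrite a1y gt0_mulye// lt0e b10' b10.
  by rewrite addye// leey.
have fa1 : a1 \is a fin_num by rewrite ge0_fin_numE// ltey.
have fb1 : b1 \is a fin_num by rewrite ge0_fin_numE// ltey.
have fa2 : a2 \is a fin_num by rewrite ge0_fin_numE// (le_lt_trans a21)// ltey.
have fb2 : b2 \is a fin_num by rewrite ge0_fin_numE// (le_lt_trans b21)// ltey.
move: a20 b20 a21 b21 {ab2 a10 b10 a1y b1y}.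
rewrite -(fineK fa1) -(fineK fa2) -(fineK fb1) -(fineK fb2) -!EFinM -!EFinD !lee_fin.
by nra.
Qed.

(** Reflect in the hyperplane that bisects the segment from [x] to [x']. Its side containing [x]
    also contains the origin, so in each mirror pair the point on that side has the larger value of
    [f] and the larger kernel value seen from [x]; seen from [x'], the kernel values are exchanged.
    Here the favoured side is the one where [refl_coef] is nonnegative. *)
Lemma pot_rdec k f : measurable_fun setT k -> (forall x, 0 <= k x) -> rdec k ->
  measurable_fun setT f -> (forall x, 0 <= f x) -> rdec f -> rdec (pot k f).
Proof.
move=> mk k0 hk mf f0 hf x x' xx'.
have [->|nx] := eqVneq x x'; first by [].
(* [w], [c] define the reflection that exchanges [x] and [x']. *)
pose w := (x' - x)%R; have w0 : w != 0%R by rewrite subr_eq0 eq_sym.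
have ww0 : dot w w != 0%R by rewrite dot_eq0.
pose c := (1 + 2 * dot x w / dot w w)%R.
have cx : refl_coef w c x = 1%R by rewrite /refl_coef /c addrK.
have rx : refl w c x = x' by rewrite /refl cx scale1r /w addrC subrK.
have rx' : refl w c x' = x by rewrite -rx reflK.
have c0 : (0 <= c)%R.
  have := refl_enorm c w0 x; rewrite rx cx mulr1 => e.
  have : (enorm x ^+ 2 <= enorm x' ^+ 2)%R by rewrite ler_pXn2r// nnegrE enorm_ge0.
  by rewrite e lerDl pmulr_lge0// dot_gt0.
have double z : pot k f z + pot k f z = \int[mu]_y
    (k (z - y)%R * f y + k (z - refl w c y)%R * f (refl w c y)).
  apply: (@integral_refl_double _ _ w c w0 (fun y => k (z - y)%R * f y)).
    by apply: emeasurable_funM => //; exact: measurable_kernel.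
  by move=> y; exact: mule_ge0.
apply: lee_double; first exact: pot_ge0.
have ms := measurable_refl w c.
have mz (z : Rn R n) : measurable_fun setT
    (fun y : Rn R n => k (z - y)%R * f y + k (z - refl w c y)%R * f (refl w c y)).
  apply: emeasurable_funD; apply: emeasurable_funM => //.
  - exact: measurable_kernel.
  - by apply: (measurableT_comp (f := fun y : Rn R n => k (z - y)%R)) => //; exact: measurable_kernel.
  - exact: measurableT_comp.
rewrite !double; apply: ge0_le_integral => //.
  by move=> y _; rewrite adde_ge0// mule_ge0.
move=> y _.
have kE a b : enorm a = enorm b -> k a = k b.
  by move=> ab; apply/eqP; rewrite eq_le !hk// ab.
have -> : k (x' - refl w c y)%R = k (x - y)%R by apply: kE; rewrite -rx refl_enormB.
have -> : k (x' - y)%R = k (x - refl w c y)%R by apply: kE; rewrite -rx reflBl.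
have [yH|/ltW yH] := leP 0%R (refl_coef w c y).
  apply: rearrangement_ineq2 => //.
    by apply: hk; apply: refl_enorm_le => //; rewrite cx mul1r.
  apply: hf; rewrite -(ler_pXn2r (ltn0Sn 1)) ?nnegrE ?enorm_ge0//.
  by rewrite refl_enorm// lerDl mulr_ge0 ?dot_ge0// mulr_ge0.
rewrite addrC [leRHS]addrC; apply: rearrangement_ineq2 => //.
  by apply: hk; apply: refl_enorm_ge => //; rewrite cx mul1r.
apply: hf; rewrite -(ler_pXn2r (ltn0Sn 1)) ?nnegrE ?enorm_ge0//.
by rewrite refl_enorm// gerDl mulr_le0_ge0 ?dot_ge0// mulr_ge0_le0.
Qed.

End potential.

(** * Layer cake decomposition and rearrangement by layers *)

Section layer_cake.
Context {R : realType} {n : nat}.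
Local Open Scope ereal_scope.
Local Notation mu := (lebesgue_rV n : {sigma_finite_measure set (Rn R n) -> \bar R}).
Local Notation leb := (@lebesgue_measure R).
Implicit Types (A C D : set (Rn R n)) (g W : Rn R n -> \bar R)
  (S : set (measurableTypeR R * Rn R n)).

Lemma indic_xsection S s y : \1_S (s, y) = \1_(xsection S s) y :> R.
Proof. by rewrite !indicE mem_xsection. Qed.

Lemma integral_sections S W : measurable S -> measurable_fun setT W ->
  (forall y, 0 <= W y) ->
  \int[leb]_s \int[mu]_y ((\1_(xsection S s) y)%:E * W y) =
  \int[mu]_y (leb (ysection S y) * W y).
Proof.
move=> mS mW W0.
pose f (p : measurableTypeR R * Rn R n) : \bar R := (\1_S p)%:E * W p.2.
have mf : measurable_fun setT f.
  apply: emeasurable_funM; last exact: measurableT_comp.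
  exact: (measurable_indic_comp mS (phi := id)).
have f0 p : 0 <= f p by rewrite mule_ge0// lee_fin.
transitivity (\int[leb]_s \int[mu]_y f (s, y)).
  by apply: eq_integral => s _; apply: eq_integral => y _; rewrite -indic_xsection.
rewrite (fubini_tonelli _ mf f0); apply: eq_integral => y _.
have mSy := measurable_ysection y mS.
rewrite -(integral_indicT leb mSy) -ge0_integralZr//; last first.
  exact: (measurable_indic_comp mSy (phi := id)).
by apply: eq_integral => s _; rewrite /f /= !indicE mem_ysection.
Qed.

(** Collecting all superlevel sets in one subset of the product makes Tonelli's theorem applicable;
    the restriction to positive heights gives the section at [y] the length [g y]. *)
Definition superlevels g : set (measurableTypeR R * Rn R n) :=
  [set p | (0 < p.1)%R /\ p.1%:E < g p.2].

Lemma measurable_superlevels g : measurable_fun setT g -> measurable (superlevels g).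
Proof.
move=> mg.
have m1 : measurable_fun setT (fun p : measurableTypeR R * Rn R n => (p.1)%:E : \bar R).
  apply/measurable_EFinP; exact: measurable_fst.
rewrite (_ : superlevels g = (setT `&` [set p : measurableTypeR R * Rn R n | 0 < (p.1)%:E]) `&`
   (setT `&` [set p | (p.1)%:E < g p.2])).
  apply: measurableI; apply: measurable_lte => //; exact: measurableT_comp.
by apply/seteqP; split => p /=; rewrite lte_fin; [move=> []|move=> [[_ ?] [_ ?]]].
Qed.

Lemma lebesgue_ysection_superlevels g y : 0 <= g y ->
  leb (ysection (superlevels g) y) = g y.
Proof.
rewrite (_ : ysection _ _ = [set s : R | (0 < s)%R /\ s%:E < g y]); last first.
  by rewrite ysectionE.
case: (g y) => [r| |]// r0.
  rewrite (_ : [set _ | _] = `]0%R, r[%classic).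
    rewrite lebesgue_measure_itv/= lte_fin; case: ifPn => [_|]; first by rewrite sube0.
    by rewrite -leNgt => h; congr (_%:E); apply/eqP; rewrite eq_le -!lee_fin r0 lee_fin h.
  by apply/seteqP; split => s /=; rewrite in_itv/= lte_fin;
    [move=> [-> ->]|move=> /andP[]].
rewrite (_ : [set _ | _] = `]0%R, +oo[%classic).
  by rewrite lebesgue_measure_itv/= ltry.
by apply/seteqP; split => s /=; rewrite in_itv/= ltry andbT; [move=> []|].
Qed.

Lemma layer_cake g W : measurable_fun setT g -> (forall y, 0 <= g y) ->
  measurable_fun setT W -> (forall y, 0 <= W y) ->
  \int[mu]_y (g y * W y) =
  \int[leb]_s \int[mu]_y ((\1_(xsection (superlevels g) s) y)%:E * W y).
Proof.
move=> mg g0 mW W0; rewrite integral_sections//; last exact: measurable_superlevels.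
by apply: eq_integral => y _; rewrite lebesgue_ysection_superlevels.
Qed.

Lemma eball_measure_lt (a b : R) : (0 < n)%N -> (0 <= a)%R -> (0 <= b)%R ->
  (mu (eball 0 a) < mu (eball 0 b)) = (a < b)%R.
Proof.
move=> n0 a0 b0; rewrite (lebesgue_eball a0 n0) (lebesgue_eball b0 n0).
have B0 : (0 < fine (mu (eball 0 1)))%R.
  by rewrite fine_gt0// lebesgue_eball_lty lebesgue_eball_gt0.
have fB : mu (eball 0 1) \is a fin_num by rewrite ge0_fin_numE// lebesgue_eball_lty.
by rewrite -(fineK fB) -!EFinM lte_fin ltr_pM2r// ltr_pXn2r.
Qed.

(* The layers of the symmetric decreasing rearrangement of [g]. *)
Definition rearr_layers g : set (measurableTypeR R * Rn R n) :=
  [set p | mu (eball 0 (enorm p.2)) < mu (xsection (superlevels g) p.1)].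

Lemma measurable_rearr_layers g : (0 < n)%N -> measurable_fun setT g ->
  measurable (rearr_layers g).
Proof.
move=> n0 mg; have mS := measurable_superlevels mg.
rewrite -[X in measurable X]setTI; apply: measurable_lte => //.
  rewrite (_ : (fun _ => _) = fun p : measurableTypeR R * Rn R n =>
      (enorm p.2 ^+ n)%:E * mu (eball 0 1)); last first.
    by apply/funext => p; exact: lebesgue_eball (enorm_ge0 _) n0.
  apply: emeasurable_funM => //; apply/measurable_EFinP; apply: measurable_funX.
  exact: measurable_enorm.
apply: (measurableT_comp (f := fun s : measurableTypeR R => mu (xsection (superlevels g) s))) => //.
exact: measurable_fun_xsection.
Qed.

Lemma centered_rearr_layers g s : (0 < n)%N -> centered (xsection (rearr_layers g) s).
Proof.
move=> n0 x y; rewrite xsectionE /rearr_layers /= => h yx; apply: le_lt_trans h.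
by rewrite leNgt eball_measure_lt ?enorm_ge0// -leNgt.
Qed.

Lemma lebesgue_rearr_layers g s : (0 < n)%N -> measurable_fun setT g ->
  mu (xsection (superlevels g) s) < +oo ->
  mu (xsection (rearr_layers g) s) = mu (xsection (superlevels g) s).
Proof.
move=> n0 mg goo.
have [r r0 rE] := lebesgue_eball_radius n0 (measure_ge0 mu (xsection (superlevels g) s)) goo.
have E x : (mu (eball 0 (enorm x)) < mu (xsection (superlevels g) s)) = (enorm x < r)%R.
  by rewrite -rE eball_measure_lt ?enorm_ge0.
rewrite -[RHS]rE; congr (lebesgue_rV n _).
by apply/seteqP; split => x; rewrite xsectionE /rearr_layers /eball /= subr0 E.
Qed.

Lemma centered_nested A C : centered A -> centered C -> A `<=` C \/ C `<=` A.
Proof.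
move=> hA hC; have [AC|] := pselect (A `<=` C); first by left.
move=> /existsNP[x /not_implyP[Ax Cx]]; right => y Cy.
by apply: (hA x) => //; apply: ltW; exact: (centered_lt hC Cx Cy).
Qed.

Lemma centeredI A C : centered A -> centered C -> centered (A `&` C).
Proof. by move=> hA hC x y [Ax Cx] yx; split; [exact: hA yx|exact: hC yx]. Qed.

(** Centered sets are nested, so the intersection of [C] and [C'] is one of the two. *)
Lemma le_measureI A A' C C' : measurable A -> measurable A' -> measurable C ->
  measurable C' -> centered C -> centered C' -> mu A <= mu C -> mu A' <= mu C' ->
  mu (A `&` A') <= mu (C `&` C').
Proof.
move=> mA mA' mC mC' hC hC' AC AC'.
have [CC|CC] := centered_nested hC hC'.
  by rewrite (setIidl CC) (le_trans _ AC)// measureIl.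
by rewrite (setIidr CC) (le_trans _ AC')// measureIr.
Qed.

Lemma centered_superlevels g s : rdec g -> centered (xsection (superlevels g) s).
Proof.
move=> hg x y; rewrite !xsectionE /superlevels /= => -[s0 h] yx; split => //.
by apply: (lt_le_trans h); exact: hg.
Qed.

Lemma le_integral_sections S1 S2 f1 f2 :
  measurable S1 -> measurable S2 -> measurable_fun setT f1 -> measurable_fun setT f2 ->
  (forall y, 0 <= f1 y) -> (forall y, 0 <= f2 y) ->
  (forall s, \int[mu]_y ((\1_(xsection S1 s) y)%:E * f1 y) <=
             \int[mu]_y ((\1_(xsection S2 s) y)%:E * f2 y)) ->
  \int[leb]_s \int[mu]_y ((\1_(xsection S1 s) y)%:E * f1 y) <=
  \int[leb]_s \int[mu]_y ((\1_(xsection S2 s) y)%:E * f2 y).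
Proof.
move=> mS1 mS2 mf1 mf2 f10 f20 le12.
have mm S f : measurable S -> measurable_fun setT f -> (forall y, 0 <= f y) ->
    measurable_fun setT (fun s : measurableTypeR R =>
      \int[mu]_y ((\1_(xsection S s) y)%:E * f y)).
  move=> mS0 mf f0.
  pose F (p : measurableTypeR R * Rn R n) : \bar R := (\1_S p)%:E * f p.2.
  rewrite (_ : (fun _ => _) = fun s => \int[mu]_y F (s, y)); last first.
    by apply/funext => s; apply: eq_integral => y _; rewrite -indic_xsection.
  apply: measurable_integral2 => [|p]; last by rewrite mule_ge0// lee_fin.
  apply: emeasurable_funM; last exact: measurableT_comp.
  exact: (measurable_indic_comp mS0 (phi := id)).
apply: ge0_le_integral => //.
- by move=> s _; apply: integral_ge0 => y _; rewrite mule_ge0// lee_fin.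
- exact: mm.
- exact: mm.
Qed.

End layer_cake.

(** * Weak majorization and its stability under sums and products *)

Section majorization.
Context {R : realType} {n : nat}.
Hypothesis n0 : (0 < n)%N.
Local Open Scope ereal_scope.
Local Notation mu := (lebesgue_rV n : {sigma_finite_measure set (Rn R n) -> \bar R}).
Local Notation leb := (@lebesgue_measure R).
Implicit Types (A C D : set (Rn R n)) (g W : Rn R n -> \bar R).

(* Weak majorization, tested against centered sets only. *)
Definition majorized g g' := forall A C, measurable A -> measurable C -> centered C ->
  mu A <= mu C -> \int[mu]_x ((\1_A x)%:E * g x) <= \int[mu]_x ((\1_C x)%:E * g' x).

(** The symmetric decreasing rearrangement of [g], as the length of the set of heights whose
    rearranged layer contains [y]. *)
Definition rearr g y : \bar R := leb (ysection (rearr_layers g) y).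

Lemma measurable_indicE A : measurable A ->
  measurable_fun setT (fun x : Rn R n => (\1_A x)%:E : \bar R).
Proof. by move=> mA; exact: (measurable_indic_comp mA (phi := id)). Qed.

Lemma measurable_rearr g : measurable_fun setT g -> measurable_fun setT (rearr g).
Proof.
move=> mg; have mD := measurable_rearr_layers n0 mg.
exact: (measurable_fun_ysection leb mD).
Qed.

Lemma superlevels_neg g (s : R) : (s <= 0)%R -> xsection (superlevels g) s = set0.
Proof.
move=> s0; rewrite -subset0 => x; rewrite xsectionE /superlevels /= => -[].
by rewrite ltNge s0.
Qed.

Lemma integral_indicM A C : measurable A -> measurable C ->
  \int[mu]_x ((\1_A x)%:E * (\1_C x)%:E) = mu (A `&` C).
Proof.
move=> mA mC; have mAC := measurableI _ _ mA mC.
by rewrite -(integral_indicT mu mAC); apply: eq_integral => x _; rewrite indicI EFinM.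
Qed.

Lemma integral_two_pieces (tau : R) (c : \bar R) (f : R -> \bar R) :
  (0 <= tau)%R -> 0 <= c ->
  measurable_fun setT (f : measurableTypeR R -> \bar R) -> (forall s, 0 <= f s) ->
  \int[leb]_s ((\1_(`]0%R, tau]%classic : set R) s)%:E * c +
               (\1_(`]tau, +oo[%classic : set R) s)%:E * f s) =
  tau%:E * c + \int[leb]_s ((\1_(`]tau, +oo[%classic : set R) s)%:E * f s).
Proof.
move=> tau0 c0 mf f0.
have m1 : measurable (`]0%R, tau]%classic : set (measurableTypeR R)) by exact: measurable_itv.
have m2 : measurable (`]tau, +oo[%classic : set (measurableTypeR R)) by exact: measurable_itv.
have m1' := measurable_indic_comp (R := R) m1 (phi := id) (@measurable_id _ _ _).
have m2' := measurable_indic_comp (R := R) m2 (phi := id) (@measurable_id _ _ _).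
have tauE : leb `]0%R, tau]%classic = tau%:E.
  rewrite lebesgue_measure_itv/= lte_fin; case: ifPn => [_|]; first by rewrite sube0.
  by rewrite -leNgt => h; have -> : tau = 0%R by apply/eqP; rewrite eq_le tau0 h.
rewrite ge0_integralD//.
- congr (_ + _); rewrite ge0_integralZr//; congr (_ * _).
  exact: (etrans (integral_indicT leb m1) tauE).
- by move=> s _; rewrite mule_ge0// lee_fin.
- exact: emeasurable_funM.
- by move=> s _; rewrite mule_ge0// lee_fin.
- exact: emeasurable_funM.
Qed.

(** When [g] has a plateau, no superlevel set of [g] need have the measure of [C]. Instead of
    cutting plateaus, use the threshold [tau], the supremum of [g'] off [C]. Let [G] be the
    superlevel set of [g] at [tau], [D] its rearrangement, so that $|D| = |G|$, and [X] the
    contribution of the layers above [tau]. Then $\int_C \tilde g \le \tau|C| + X$ for the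
    rearrangement $\tilde g$ of [g]; next, $\tau|G| + X \le \int_G g \le \int_D g'$; and $\int_D g'
    + \tau|C| \le \int_C g' + \tau|D|$, because $g' \ge \tau$ on [C] and $g' \le \tau$ off it.
    Adding up and cancelling the finite $\tau|D|$ gives the claim. *)
Lemma rearr_le g g' C : measurable_fun setT g -> (forall y, 0 <= g y) ->
  (forall s, mu (xsection (superlevels g) s) < +oo) ->
  measurable_fun setT g' -> (forall y, 0 <= g' y) -> rdec g' -> (forall y, g' y < +oo) ->
  majorized g g' -> measurable C -> centered C ->
  \int[mu]_x ((\1_C x)%:E * rearr g x) <= \int[mu]_x ((\1_C x)%:E * g' x).
Proof.
move=> mg g0 goo mg' g'0 hg' g'oo gg' mC hC.
have mS := measurable_superlevels mg; have mD := measurable_rearr_layers n0 mg.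
have mSs s : measurable (xsection (superlevels g) s) by exact: measurable_xsection.
have mDs s : measurable (xsection (rearr_layers g) s) by exact: measurable_xsection.
have DS s := lebesgue_rearr_layers n0 mg (goo s).
have mr := measurable_rearr mg.
have m1 : measurable_fun setT (cst 1 : Rn R n -> \bar R) by exact: measurable_cst.
(* If [g'] vanishes off [C], majorization on the whole space suffices. This disposes of the cases in
   which [tau] would be 0 or the supremum of an empty set. *)
have [Cnull|] := pselect (forall y, ~ C y -> g' y = 0).
  have -> : \int[mu]_x ((\1_C x)%:E * g' x) = \int[mu]_x ((\1_setT x)%:E * g' x).
    apply: eq_integral => x _; rewrite !indicE in_setT mul1e.
    have [/set_mem xC|/negP xC] := boolP (x \in C); first by rewrite mul1e.
    by rewrite mul0e Cnull// => xC'; apply: xC; rewrite inE.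
  have hT : centered (setT : set (Rn R n)) by [].
  apply: le_trans (gg' setT setT measurableT measurableT hT (lexx _)).
  apply: (@le_trans _ _ (\int[mu]_x (rearr g x * 1))).
    apply: ge0_le_integral => //.
    - by move=> x _; rewrite mule_ge0// lee_fin.
    - by apply: emeasurable_funM => //; exact: measurable_indicE.
    - exact: emeasurable_funM.
    - move=> x _; rewrite mule1 -[leRHS]mul1e lee_wpmul2r// lee_fin indicE.
      by case: (_ \in _).
  rewrite -(integral_sections mD m1)//.
  have -> : \int[mu]_x ((\1_setT x)%:E * g x) = \int[mu]_x (g x * 1).
    by apply: eq_integral => x _; rewrite indicT mul1e mule1.
  rewrite (layer_cake mg g0 m1)//.
  suff DSs s : \int[mu]_y ((\1_(xsection (rearr_layers g) s) y)%:E * cst 1 y) =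
      \int[mu]_y ((\1_(xsection (superlevels g) s) y)%:E * cst 1 y).
    by under eq_integral do rewrite DSs.
  transitivity (mu (xsection (rearr_layers g) s)).
    by rewrite -(integral_indicT mu (mDs s)); apply: eq_integral => y _; rewrite mule1.
  rewrite DS -(integral_indicT mu (mSs s)).
  by apply: eq_integral => y _; rewrite mule1.
move=> /existsNP[y0 /not_implyP[Cy0 g'y0]].
(* A point of [C] is what bounds the values of [g'] off [C]; hence the separate treatment of the
   empty set. *)
have [[x0 Cx0]|/set0P/negP/negPn/eqP ->] := pselect (C !=set0); last first.
  rewrite [leLHS](_ : _ = 0); first by apply: integral_ge0 => x _; rewrite mule_ge0// lee_fin.
  by rewrite integral0_eq// => x _; rewrite indic0 mul0e.
have fg' y : g' y \is a fin_num by rewrite ge0_fin_numE.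
pose T := [set fine (g' y) | y in ~` C].
have supT : has_sup T.
  split; first by exists (fine (g' y0)), y0.
  exists (fine (g' x0)) => _ [y Cy <-]; rewrite fine_le//; apply: hg'.
  exact: ltW (centered_lt hC Cy Cx0).
pose tau := sup T.
have tau_ge y : ~ C y -> g' y <= tau%:E.
  move=> Cy; rewrite -(fineK (fg' y)) lee_fin; apply: ub_le_sup; first by case: supT.
  by exists y.
have tau_le x : C x -> tau%:E <= g' x.
  move=> Cx; rewrite -(fineK (fg' x)) lee_fin; apply: sup_le_ub; first by case: supT.
  move=> _ [y Cy <-]; rewrite fine_le//; apply: hg'.
  exact: ltW (centered_lt hC Cy Cx).
have tau0 : (0 < tau)%R.
  by rewrite -lte_fin (lt_le_trans _ (tau_ge _ Cy0))// lt0e g'0 andbT; apply/eqP.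
have Coo : mu C < +oo.
  apply: (sub_eball_lty (r := enorm y0)) => // x Cx.
  by rewrite /eball /= subr0; exact: (centered_lt hC Cy0 Cx).
pose fS s : \bar R := mu (xsection (superlevels g) s).
have mfS : measurable_fun setT (fS : measurableTypeR R -> \bar R).
  exact: measurable_fun_xsection.
have fS0 s : 0 <= fS s by exact: measure_ge0.
set X := \int[leb]_s ((\1_(`]tau, +oo[%classic : set R) s)%:E * fS s).
have mitv (i : interval R) : measurable_fun setT
    (fun s : measurableTypeR R => (\1_([set` i] : set R) s)%:E : \bar R).
  have mi : measurable ([set` i] : set (measurableTypeR R)) by exact: measurable_itv.
  exact: (measurable_indic_comp mi (phi := id)).
have mpieces c : measurable_fun setT (fun s : measurableTypeR R =>
    (\1_(`]0%R, tau]%classic : set R) s)%:E * c + (\1_(`]tau, +oo[%classic : set R) s)%:E * fS s).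
  by apply: emeasurable_funD; apply: emeasurable_funM.
(* A layer at height at most [tau] meets [C] in measure at most that of [C]; the layers above [tau]
   are counted in full. *)
have upper : \int[mu]_x ((\1_C x)%:E * rearr g x) <= tau%:E * mu C + X.
  rewrite -(integral_two_pieces (ltW tau0) (measure_ge0 _ _) mfS fS0).
  have -> : \int[mu]_x ((\1_C x)%:E * rearr g x) =
      \int[leb]_s mu (xsection (rearr_layers g) s `&` C).
    transitivity (\int[mu]_x (rearr g x * (\1_C x)%:E)).
      by apply: eq_integral => x _; rewrite muleC.
    rewrite -(integral_sections mD (measurable_indicE mC)); last first.
      by move=> y; exact: indic_ge0.
    by apply: eq_integral => s _; exact: integral_indicM.
  apply: ge0_le_integral => //.
  - have mDC : measurable (rearr_layers g `&` (setT `*` C)).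
      by apply: measurableI => //; exact: measurableX.
    rewrite (_ : (fun _ => _) = mu \o xsection (rearr_layers g `&` (setT `*` C))).
      exact: measurable_fun_xsection.
    by apply/funext => s /=; rewrite xsectionI; congr (lebesgue_rV n (_ `&` _));
      rewrite in_xsectionX// inE.
  move=> s _; have [s0|s0] := leP s 0%R.
    rewrite (_ : mu _ = 0).
      by rewrite adde_ge0// mule_ge0// lee_fin.
    apply/eqP; rewrite eq_le measure_ge0 andbT.
    have <- : mu (xsection (rearr_layers g) s) = 0 by rewrite DS superlevels_neg// measure0.
    exact: measureIl.
  have [st|st] := leP s tau.
    rewrite [X in _ <= X + _](_ : _ = mu C).
      apply: (le_trans (measureIr _ _ _)) => //; rewrite leeDl// mule_ge0// lee_fin.
    by rewrite indicE mem_set ?mul1e//= in_itv/= s0 st.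
  rewrite [X in _ <= _ + X](_ : _ = fS s).
    apply: (@le_trans _ _ (fS s)); last by rewrite leeDr// mule_ge0// lee_fin.
    by rewrite /fS -DS; exact: measureIl.
  by rewrite indicE mem_set ?mul1e//= in_itv/= st.
have lower : tau%:E * mu (xsection (superlevels g) tau) + X <=
    \int[mu]_x ((\1_(xsection (superlevels g) tau) x)%:E * g x).
  rewrite -(integral_two_pieces (ltW tau0) (measure_ge0 _ _) mfS fS0).
  have -> : \int[mu]_x ((\1_(xsection (superlevels g) tau) x)%:E * g x) =
      \int[leb]_s mu (xsection (superlevels g) s `&` xsection (superlevels g) tau).
    transitivity (\int[mu]_x (g x * (\1_(xsection (superlevels g) tau) x)%:E)).
      by apply: eq_integral => x _; rewrite muleC.
    rewrite (layer_cake mg g0 (measurable_indicE (mSs tau))); last first.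
      by move=> y; exact: indic_ge0.
    by apply: eq_integral => s _; exact: integral_indicM.
  apply: ge0_le_integral => //.
  - by move=> s _; rewrite adde_ge0// mule_ge0// lee_fin.
  - have mSC : measurable (superlevels g `&` (setT `*` xsection (superlevels g) tau)).
      by apply: measurableI => //; exact: measurableX.
    rewrite (_ : (fun _ => _) =
        mu \o xsection (superlevels g `&` (setT `*` xsection (superlevels g) tau))).
      exact: measurable_fun_xsection.
    by apply/funext => s /=; rewrite xsectionI; congr (lebesgue_rV n (_ `&` _));
      rewrite in_xsectionX// inE.
  move=> s _; have mono a b : (0 < a)%R -> (a <= b)%R ->
      xsection (superlevels g) b `<=` xsection (superlevels g) a.
    move=> a0 ab x; rewrite !xsectionE /superlevels /= => -[_ h]; split => //.
    by apply: le_lt_trans h; rewrite lee_fin.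
  have [s0|s0] := leP s 0%R.
    rewrite [leLHS](_ : _ = 0)//; rewrite !indicE !memNset ?mul0e ?adde0//=; rewrite in_itv/=.
      by rewrite andbT => h; have := lt_trans tau0 h; rewrite ltNge s0.
    by rewrite ltNge s0.
  have [st|st] := leP s tau.
    rewrite !indicE mem_set/=; last by rewrite in_itv/= s0 st.
    rewrite memNset/=; last by rewrite in_itv/= andbT ltNge st.
    by rewrite mul1e mul0e adde0 (setIidr (mono _ _ s0 st)).
  rewrite !indicE memNset/=; last by rewrite in_itv/= s0 leNgt st.
  rewrite mem_set/=; last by rewrite in_itv/= andbT st.
  by rewrite mul1e mul0e add0e (setIidl (mono _ _ tau0 (ltW st))).
set G := xsection (superlevels g) tau in lower.
set D := xsection (rearr_layers g) tau.
have mDtau : measurable D by exact: mDs.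
have DG : mu D = mu G by exact: DS.
have mGD : \int[mu]_x ((\1_G x)%:E * g x) <= \int[mu]_x ((\1_D x)%:E * g' x).
  by apply: (gg' G D (mSs tau) (mDs tau)); [exact: centered_rearr_layers|rewrite DG].
have swap : \int[mu]_x ((\1_D x)%:E * g' x) + tau%:E * mu C <=
    \int[mu]_x ((\1_C x)%:E * g' x) + tau%:E * mu D.
  have tI A : measurable A -> tau%:E * mu A = \int[mu]_x (tau%:E * (\1_A x)%:E).
    move=> mA; rewrite ge0_integralZl//.
    + by rewrite (integral_indicT mu mA).
    + exact: measurable_indicE.
    + by rewrite lee_fin ltW.
  have m2 A : measurable A -> measurable_fun setT (fun x : Rn R n => tau%:E * (\1_A x)%:E).
    by move=> mA; apply: emeasurable_funM => //; exact: measurable_indicE.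
  have m3 A : measurable A -> measurable_fun setT (fun x : Rn R n => (\1_A x)%:E * g' x).
    by move=> mA; apply: emeasurable_funM => //; exact: measurable_indicE.
  have p2 A (x : Rn R n) : 0 <= tau%:E * (\1_A x)%:E by rewrite mule_ge0// lee_fin// ltW.
  have p3 A (x : Rn R n) : 0 <= (\1_A x)%:E * g' x by rewrite mule_ge0// lee_fin.
  rewrite (tI _ mC) (tI _ mDtau) -!ge0_integralD//; try by [exact: m2|exact: m3].
  apply: ge0_le_integral => //.
  - by move=> x _; rewrite adde_ge0.
  - by apply: emeasurable_funD; [exact: m3|exact: m2].
  - by apply: emeasurable_funD; [exact: m3|exact: m2].
  move=> x _; rewrite !indicE.
  have [/set_mem xD|_] := boolP (x \in D); have [/set_mem xC|/negP xC] := boolP (x \in C) => //=.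
  - by rewrite !(mul1e, mul0e, mule1, mule0, adde0, add0e) tau_ge// => /mem_set.
  - by rewrite !(mul1e, mul0e, mule1, mule0, adde0, add0e) tau_le.
have fD : tau%:E * mu D \is a fin_num.
  by rewrite fin_numM// ge0_fin_numE// DG goo.
apply: (le_trans upper); rewrite -(leeD2rE _ _ fD).
apply: le_trans swap; apply: le_trans (leeD (le_trans lower mGD) (lexx _)).
by rewrite DG [leLHS]addeAC [leRHS]addeAC [X in _ <= X + _]addeC.
Qed.

(** The layer cake formula is used twice, with [rearr g] in between. Slicing [g] replaces its layers
    by centered ones of the same measure and [W] by [W']; slicing [W'], whose layers are centered,
    then replaces [rearr g] by [g'] through [rearr_le]. *)
Lemma majorized_integral_mul g g' W W' :
  measurable_fun setT g -> (forall y, 0 <= g y) ->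
  (forall s, mu (xsection (superlevels g) s) < +oo) ->
  measurable_fun setT g' -> (forall y, 0 <= g' y) -> rdec g' -> (forall y, g' y < +oo) ->
  measurable_fun setT W -> (forall y, 0 <= W y) ->
  measurable_fun setT W' -> (forall y, 0 <= W' y) -> rdec W' ->
  majorized g g' -> majorized W W' ->
  \int[mu]_y (g y * W y) <= \int[mu]_y (g' y * W' y).
Proof.
move=> mg g0 goo mg' g'0 hg' g'oo mW W0 mW' W'0 hW' gg' WW'.
have mS := measurable_superlevels mg; have mD := measurable_rearr_layers n0 mg.
have mSW := measurable_superlevels mW'.
have mr := measurable_rearr mg.
have r0 y : 0 <= rearr g y by exact: measure_ge0.
rewrite (layer_cake mg g0 mW W0).
apply: (le_trans (y := \int[mu]_y (rearr g y * W' y))).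
  rewrite -(integral_sections mD mW' W'0).
  apply: le_integral_sections => // s; apply: WW'.
  - exact: measurable_xsection.
  - exact: measurable_xsection.
  - exact: centered_rearr_layers.
  - by rewrite lebesgue_rearr_layers.
rewrite (_ : \int[mu]_y (rearr g y * W' y) = \int[mu]_y (W' y * rearr g y)); last first.
  by apply: eq_integral => y _; rewrite muleC.
rewrite (_ : \int[mu]_y (g' y * W' y) = \int[mu]_y (W' y * g' y)); last first.
  by apply: eq_integral => y _; rewrite muleC.
rewrite (layer_cake mW' W'0 mr r0) (layer_cake mW' W'0 mg' g'0).
apply: le_integral_sections => // s.
apply: rearr_le => //; first exact: measurable_xsection.
exact: centered_superlevels.
Qed.

Lemma majorized_indic A C : measurable A -> measurable C -> centered C -> mu A <= mu C ->
  majorized (EFin \o \1_A) (EFin \o \1_C).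
Proof.
move=> mA mC hC AC A' C' mA' mC' hC' AC' /=.
by rewrite !integral_indicM//; exact: le_measureI.
Qed.

Lemma majorized_add g g' W W' :
  measurable_fun setT g -> (forall y, 0 <= g y) ->
  measurable_fun setT g' -> (forall y, 0 <= g' y) ->
  measurable_fun setT W -> (forall y, 0 <= W y) ->
  measurable_fun setT W' -> (forall y, 0 <= W' y) ->
  majorized g g' -> majorized W W' -> majorized (g \+ W) (g' \+ W').
Proof.
move=> mg g0 mg' g'0 mW W0 mW' W'0 gg' WW' A C mA mC hC AC.
have add B f h : measurable B -> measurable_fun setT f -> (forall y, 0 <= f y) ->
    measurable_fun setT h -> (forall y, 0 <= h y) ->
    \int[mu]_x ((\1_B x)%:E * (f \+ h) x) =
    \int[mu]_x ((\1_B x)%:E * f x) + \int[mu]_x ((\1_B x)%:E * h x).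
  move=> mB mf f0 mh h0; rewrite -ge0_integralD//.
  - by apply: eq_integral => x _; rewrite /= ge0_muleDr.
  - by move=> x _; rewrite mule_ge0// lee_fin.
  - by apply: emeasurable_funM => //; exact: measurable_indicE.
  - by move=> x _; rewrite mule_ge0// lee_fin.
  - by apply: emeasurable_funM => //; exact: measurable_indicE.
by rewrite !add// leeD// ?gg' ?WW'.
Qed.

Lemma majorized_restrict W W' A C : majorized W W' ->
  measurable A -> measurable C -> centered C -> mu A <= mu C ->
  majorized (fun x => (\1_A x)%:E * W x) (fun x => (\1_C x)%:E * W' x).
Proof.
move=> WW' mA mC hC AC A' C' mA' mC' hC' AC'.
have E B B' f : \int[mu]_x ((\1_B x)%:E * ((\1_B' x)%:E * f x)) =
    \int[mu]_x ((\1_(B `&` B') x)%:E * f x).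
  by apply: eq_integral => x _; rewrite indicI EFinM muleA.
rewrite !E; apply: WW'.
- exact: measurableI.
- exact: measurableI.
- exact: centeredI.
- exact: le_measureI.
Qed.

Lemma rdec_mul g W : (forall y, 0 <= g y) -> (forall y, 0 <= W y) -> rdec g -> rdec W ->
  rdec (fun y => g y * W y).
Proof. by move=> g0 W0 hg hW x y xy; apply: lee_pmul => //; [exact: hg|exact: hW]. Qed.

Lemma rdec_indic C : centered C -> rdec (fun x => (\1_C x)%:E : \bar R).
Proof.
move=> hC x y xy; rewrite lee_fin !indicE ler_nat.
have [/set_mem Cy|//] := boolP (y \in C).
by rewrite mem_set//; exact: hC Cy xy.
Qed.

(** The indicator of the test set is absorbed into the second factor, which stays majorized by
    [majorized_restrict]. *)
Lemma majorized_mul g g' W W' :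
  measurable_fun setT g -> (forall y, 0 <= g y) ->
  (forall s, mu (xsection (superlevels g) s) < +oo) ->
  measurable_fun setT g' -> (forall y, 0 <= g' y) -> rdec g' -> (forall y, g' y < +oo) ->
  measurable_fun setT W -> (forall y, 0 <= W y) ->
  measurable_fun setT W' -> (forall y, 0 <= W' y) -> rdec W' ->
  majorized g g' -> majorized W W' ->
  majorized (fun y => g y * W y) (fun y => g' y * W' y).
Proof.
move=> mg g0 goo mg' g'0 hg' g'oo mW W0 mW' W'0 hW' gg' WW' A C mA mC hC AC.
have E B (f h : Rn R n -> \bar R) : \int[mu]_x ((\1_B x)%:E * (f x * h x)) =
    \int[mu]_x (f x * ((\1_B x)%:E * h x)).
  by apply: eq_integral => x _; rewrite muleCA.
rewrite !E; apply: majorized_integral_mul => //.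
- by apply: emeasurable_funM => //; exact: measurable_indicE.
- by move=> y; rewrite mule_ge0// lee_fin.
- by apply: emeasurable_funM => //; exact: measurable_indicE.
- by move=> y; rewrite mule_ge0// lee_fin.
- apply: rdec_mul => //; last exact: rdec_indic.
- exact: majorized_restrict.
Qed.

End majorization.

(** * Potentials of majorized densities *)

Section majorized_potentials.
Context {R : realType} {n : nat}.
Hypothesis n0 : (0 < n)%N.
Local Open Scope ereal_scope.
Local Notation mu := (lebesgue_rV n : {sigma_finite_measure set (Rn R n) -> \bar R}).
Implicit Types (A C D E : set (Rn R n)) (g W : Rn R n -> \bar R).
Variable k : Rn R n -> \bar R.
Hypotheses (mk : measurable_fun setT k) (k0 : forall x, 0 <= k x) (hk : rdec k).

Let indic_pos A y : 0 <= (EFin \o \1_A : Rn R n -> \bar R) y.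
Proof. by rewrite /= lee_fin. Qed.

Let measurable_EFin_indic A : measurable A ->
  measurable_fun setT (EFin \o \1_A : Rn R n -> \bar R).
Proof. by move=> mA; exact: measurable_indicE. Qed.

(** Self-adjointness of the potential, by Tonelli and the evenness of the kernel, which follows from
    its radial monotonicity. *)
Lemma pot_swap A g : measurable A -> measurable_fun setT g -> (forall y, 0 <= g y) ->
  \int[mu]_x ((\1_A x)%:E * pot k g x) = \int[mu]_y (g y * pot k (EFin \o \1_A) y).
Proof.
move=> mA mg g0.
pose f (p : Rn R n * Rn R n) : \bar R := (\1_A p.1)%:E * (k (p.1 - p.2)%R * g p.2).
have mf : measurable_fun setT f.
  apply: emeasurable_funM; first exact: (measurable_indic_comp mA measurable_fst).
  exact: measurable_pot_fun.
have f0 p : 0 <= f p by rewrite !mule_ge0// lee_fin.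
transitivity (\int[mu]_x \int[mu]_y f (x, y)).
  apply: eq_integral => x _; rewrite -ge0_integralZl//.
  - by apply: emeasurable_funM => //; exact: measurable_kernel.
  - by move=> y _; exact: mule_ge0.
rewrite (fubini_tonelli _ mf f0); apply: eq_integral => y _.
rewrite -ge0_integralZl//.
- by apply: eq_integral => x _; rewrite /f /= (rdec_sym x y hk) muleA muleC (muleC (\1_A x)%:E).
- by apply: emeasurable_funM; [exact: measurable_kernel|exact: measurable_EFin_indic].
- by move=> x _; rewrite mule_ge0.
Qed.

(** The integral over [E] of the potential of [A] is the interaction of [E] and [A], so this is
    Riesz' inequality. *)
Lemma majorized_pot_indic A C : measurable A -> measurable C -> centered C ->
  mu A <= mu C -> majorized (pot k (EFin \o \1_A)) (pot k (EFin \o \1_C)).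
Proof.
move=> mA mC hC AC E D mE mD hD ED.
have K B F : measurable B -> measurable F ->
    \int[mu]_x ((\1_F x)%:E * pot k (EFin \o \1_B) x) =
    integral2 mu mu (extended_interaction_fun k F B).
  move=> mB mF; apply: eq_integral => x _; rewrite -ge0_integralZl//.
  - by apply: eq_integral => y _; rewrite /extended_interaction_fun /= (muleC (k _)).
  - by apply: emeasurable_funM; [exact: measurable_kernel|exact: measurable_EFin_indic].
  - by move=> y _; rewrite mule_ge0.
by rewrite (K A E mA mE) (K C D mC mD); exact: riesz.
Qed.

(** After [pot_swap] the density is integrated against the potential of the test set. Riesz'
    inequality majorizes that potential by the one of [C], which is radially nonincreasing by
    [pot_rdec], and the product lemma applies. *)
Lemma majorized_pot g g' :
  measurable_fun setT g -> (forall y, 0 <= g y) ->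
  (forall s, mu (xsection (superlevels g) s) < +oo) ->
  measurable_fun setT g' -> (forall y, 0 <= g' y) -> rdec g' -> (forall y, g' y < +oo) ->
  majorized g g' -> majorized (pot k g) (pot k g').
Proof.
move=> mg g0 goo mg' g'0 hg' g'oo gg' A C mA mC hC AC.
have mI B := @measurable_EFin_indic B.
have mW := measurable_pot mk k0 (mI A mA) (indic_pos A).
have mW' := measurable_pot mk k0 (mI C mC) (indic_pos C).
have W0 B y := pot_ge0 y k0 (indic_pos B).
have hW' := pot_rdec mk k0 hk (mI C mC) (indic_pos C) (rdec_indic hC).
have WW' := majorized_pot_indic mA mC hC AC.
rewrite [leLHS](pot_swap mA mg g0) [leRHS](pot_swap mC mg' g'0).
exact: (majorized_integral_mul n0 mg g0 goo mg' g'0 hg' g'oo mW (W0 A) mW' (W0 C) hW' gg' WW').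
Qed.

(** The layers of the translated kernel are translates of the centered layers of [k], hence have the
    same measure. *)
Lemma majorized_kernel x : majorized (fun y => k (x - y)%R) k.
Proof.
move=> A C mA mC hC AC.
have mkx := measurable_kernel x mk.
have E B f : \int[mu]_y ((\1_B y)%:E * f y) = \int[mu]_y (f y * (\1_B y)%:E).
  by apply: eq_integral => y _; rewrite muleC.
rewrite !E (layer_cake mkx (fun y => k0 _) (measurable_indicE mA) (fun y => indic_pos A y)).
rewrite (layer_cake mk k0 (measurable_indicE mC) (fun y => indic_pos C y)).
have mS := measurable_superlevels mk; have mSx := measurable_superlevels mkx.
apply: le_integral_sections => //; try exact: measurable_indicE.
move=> s; rewrite !integral_indicM//; try exact: measurable_xsection.
apply: le_measureI => //; try exact: measurable_xsection.
  exact: centered_superlevels.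
rewrite -[leRHS](lebesgue_rV_translate (- x)%R); last exact: measurable_xsection.
apply: le_measure; rewrite ?inE; first exact: measurable_xsection.
  apply: (measurable_preimage (phi := fun y : Rn R n => (y - x)%R : Rn R n)).
    exact: measurable_rVB.
  exact: measurable_xsection.
move=> y; rewrite !xsectionE /superlevels /= => -[s0 h]; split => //.
by rewrite -(rdec_sym x y hk).
Qed.

(** Evaluation at [x] is an integral against the translated kernel, so the product lemma yields the
    bound at every point and not merely almost everywhere. *)
Lemma pot_le_center g g' x :
  measurable_fun setT g -> (forall y, 0 <= g y) ->
  (forall s, mu (xsection (superlevels g) s) < +oo) ->
  measurable_fun setT g' -> (forall y, 0 <= g' y) -> rdec g' -> (forall y, g' y < +oo) ->
  majorized g g' -> pot k g x <= pot k g' 0%R.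
Proof.
move=> mg g0 goo mg' g'0 hg' g'oo gg'.
have -> : pot k g x = \int[mu]_y (g y * k (x - y)%R).
  by apply: eq_integral => y _; rewrite muleC.
have -> : pot k g' 0%R = \int[mu]_y (g' y * k y).
  by apply: eq_integral => y _; rewrite muleC (rdec_sym _ _ hk) subr0.
apply: majorized_integral_mul => //; first exact: measurable_kernel.
exact: majorized_kernel.
Qed.

End majorized_potentials.

(** * The minimal solution *)

Section open_bounded.
Context {R : realType} {n : nat}.
Local Open Scope ereal_scope.
Local Notation mu := (lebesgue_rV n : {sigma_finite_measure set (Rn R n) -> \bar R}).

(** The sigma-algebra comes from the coordinates and openness from the sup norm; they meet in the
    countably many boxes with rational centers and half-widths $1/(m+1)$, and [U] is the union of
    those it contains. *)
Lemma open_measurable_rV (U : set 'rV[R]_n) : open U -> measurable (U : set (Rn R n)).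
Proof.
move=> oU.
pose box (q : 'rV[rat]_n * nat) : set (Rn R n) :=
  [set y | forall i, `](ratr (q.1 ord0 i) - q.2.+1%:R^-1)%R,
                       (ratr (q.1 ord0 i) + q.2.+1%:R^-1)%R[%classic (y ord0 i : R)].
have mbox q : measurable (box q).
  have -> : box q = \bigcap_(i in [set: 'I_n]) ((fun x : Rn R n => x ord0 i) @^-1`
      `](ratr (q.1 ord0 i) - q.2.+1%:R^-1)%R, (ratr (q.1 ord0 i) + q.2.+1%:R^-1)%R[%classic).
    by apply/seteqP; split => [x /= Bx i _|x /= Bx i]; exact: Bx.
  apply: fin_bigcap_measurable => // i _.
  by apply: (measurable_preimage (measurable_rV_coord i)); exact: measurable_itv.
pose F q := if `[< box q `<=` U >] then box q else set0.
have mF q : measurable (F q) by rewrite /F; case: ifPn => _; [exact: mbox|exact: measurable0].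
suff -> : U = \bigcup_q F q by exact: countable_bigcupT_measurable.
apply/seteqP; split => [x Ux|x [q _]]; last first.
  by rewrite /F; case: asboolP => // qU /qU.
have /nbhs_ballP[e /= e0 eU] : nbhs x U by exact: open_nbhs_nbhs.
(* A box of half-width $1/(N+1) < e/2$, centered at a rational point closer to [x] than $1/(N+1)$,
   contains [x] and stays within distance [e] of it. *)
pose N := (Num.truncn (2 / e)).
have Ne : (N.+1%:R^-1 < e / 2 :> R)%R.
  rewrite -[(e / 2)%R]invrK ltf_pV2 ?posrE ?invr_gt0 ?divr_gt0// invfM invrK mulrC.
  exact: truncnS_gt.
have d0 : (0 < N.+1%:R^-1 :> R)%R by rewrite invr_gt0.
have [h hE] : exists h : R, h = (N.+1%:R^-1)%R by exists (N.+1%:R^-1)%R.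
rewrite -hE in Ne d0.
have [q qx] : exists q : 'rV[rat]_n, forall i, (`|x ord0 i - ratr (q ord0 i)| < h)%R.
  have /choice[q qx] : forall i : 'I_n, exists a : rat, (`|x ord0 i - ratr a| < h)%R.
    move=> i; have lt : (x ord0 i - h < x ord0 i + h)%R by lra.
    have [a] := rat_in_itvoo lt; rewrite in_itv/= => /andP[a1 a2].
    by exists a; rewrite ltr_norml; lra.
  by exists (\row_i q i) => i; rewrite mxE.
exists (q, N) => //; rewrite /F asboolT.
  by move=> i; rewrite /= in_itv/= -hE; have := qx i; rewrite ltr_norml; lra.
move=> y By; apply: eU; split => // a i; rewrite (ord1 a) /ball /=.
have := By i; rewrite /= in_itv/= -hE; have := qx i; rewrite !ltr_norml; lra.
Qed.

Lemma bounded_lty (U : set 'rV[R]_n) : bounded_set U -> measurable (U : set (Rn R n)) ->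
  mu U < +oo.
Proof.
move=> [M [Mreal UM]] mU.
pose a := (Num.max 0 M + 1)%R.
have Ma : (M < a)%R by rewrite /a ltr_pwDr// le_max lexx orbT.
have a0 : (0 <= a)%R by rewrite addr_ge0// le_max lexx.
apply: (@le_lt_trans _ _ (mu (cube a))); last by rewrite lebesgue_cube// ltry.
apply: le_measure; rewrite ?inE//; first exact: measurable_cube.
move=> x Ux i; rewrite -ler_norml; have := UM _ Ma _ Ux; apply: le_trans.
rewrite [leRHS]/Num.norm/= mx_normrE.
exact: (le_bigmax _ (fun ij : 'I_1 * 'I_n => `|x ij.1 ij.2|%R) (ord0, i)).
Qed.

Lemma measurable_point (x : Rn R n) : measurable [set x].
Proof.
have -> : [set x] = \bigcap_(i in [set: 'I_n]) ((fun y : Rn R n => y ord0 i) @^-1`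
    [set x ord0 i : measurableTypeR R]).
  by apply/seteqP; split => y /=; [move=> -> i|move=> h; apply/rowP => i; rewrite h].
apply: fin_bigcap_measurable => // i _.
by apply: (measurable_preimage (measurable_rV_coord i)); exact: measurable_set1.
Qed.

Lemma lebesgue_point (x : Rn R n) : (0 < n)%N -> mu [set x] = 0.
Proof.
move=> n0; have -> : [set x] = [set y | forall i, [set x ord0 i : measurableTypeR R] (y ord0 i)].
  by apply/seteqP; split => y /=; [move=> ->|move=> h; apply/rowP => i; rewrite h].
rewrite (lebesgue_rV_box (A := fun i => [set x ord0 i : measurableTypeR R])); last first.
  by move=> i; exact: measurable_set1.
under eq_bigr do rewrite lebesgue_measure_set1.
by rewrite prodEFin prodr_const card_ord expr0n gtn_eqF.
Qed.

End open_bounded.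

(** * The fundamental solution as a radially nonincreasing kernel *)

Section kernel.
Context {R : realType} {d : nat}.
Variable lambda : R.
Hypothesis lambda0 : (0 <= lambda).
Local Notation mu := (lebesgue_rV d : {sigma_finite_measure set (Rn R d) -> \bar R}).

Lemma sphere_area_ge0 : 0 <= sphere_area d :> R.
Proof.
rewrite divr_ge0// ?mulr_ge0 ?powR_ge0//.
apply: Rintegral_ge0 => t _.
by rewrite mulr_ge0 ?powR_ge0 ?expR_ge0.
Qed.

Lemma fund_sol_base_ge0 (z : Rn R d) :
  0 <= (d - 2)%:R * sphere_area d * enorm z ^+ (d - 2) :> R.
Proof. by rewrite mulr_ge0 ?exprn_ge0 ?enorm_ge0// mulr_ge0 ?sphere_area_ge0. Qed.

Lemma fund_sol_ge0 (z : Rn R d) : 0 <= fund_sol z.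
Proof. by rewrite invr_ge0 fund_sol_base_ge0. Qed.

Lemma measurable_fund_sol : measurable_fun setT (@fund_sol R d : Rn R d -> R).
Proof.
have -> : @fund_sol R d = fun z : Rn R d =>
    ((d - 2)%:R * sphere_area d * enorm z ^+ (d - 2)) `^ (-1).
  by apply/funext => z; rewrite powR_inv1// fund_sol_base_ge0.
apply: (measurableT_comp (measurable_powR _)).
apply: measurable_funM => //; apply: measurable_funX; exact: measurable_enorm.
Qed.

(* The value at the origin makes the kernel symmetric decreasing; it is irrelevant to the
   integrals. *)
Definition kernel (z : Rn R d) : \bar R :=
  if z == 0 then +oo%E else (lambda * fund_sol z)%:E.

Lemma kernel_ge0 z : (0 <= kernel z)%E.
Proof. by rewrite /kernel; case: ifPn => // _; rewrite lee_fin mulr_ge0 ?fund_sol_ge0. Qed.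

Lemma kernel_rdec : rdec kernel.
Proof.
move=> x y xy; rewrite /kernel; case: ifPn => [/eqP y0|y0].
  suff -> : x == 0 by [].
  by rewrite -enorm_eq0 eq_le enorm_ge0 andbT (le_trans xy)// y0 enorm0.
case: ifPn => [_|x0]; first by rewrite leey.
rewrite lee_fin ler_wpM2l// /fund_sol.
have a0 : 0 <= (d - 2)%:R * sphere_area d :> R by rewrite mulr_ge0 ?sphere_area_ge0.
(* Only nonnegativity of the constant is at hand; if it is 0, [fund_sol] vanishes identically. *)
have [->|a1] := eqVneq ((d - 2)%:R * sphere_area d : R) 0; first by rewrite !mul0r.
have a2 : 0 < (d - 2)%:R * sphere_area d :> R by rewrite lt_def a1.
have pos (z : Rn R d) : z != 0 -> 0 < (d - 2)%:R * sphere_area d * enorm z ^+ (d - 2) :> R.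
  by move=> z0; rewrite pmulr_rgt0// exprn_gt0// lt_def enorm_eq0 z0 enorm_ge0.
rewrite lef_pV2 ?posrE ?pos//.
by rewrite ler_pM2l// lerXn2r ?nnegrE ?enorm_ge0.
Qed.

Lemma measurable_kernel_fun : measurable_fun setT kernel.
Proof.
have -> : kernel = fun z : Rn R d => if enorm z == 0 then +oo%E else (lambda * fund_sol z)%:E.
  by apply/funext => z; rewrite /kernel enorm_eq0.
apply: measurable_fun_ifT => //.
- by apply: measurable_fun_eqr => //; exact: measurable_enorm.
- apply/measurable_EFinP; apply: measurable_funM => //; exact: measurable_fund_sol.
Qed.

(** The two integrands can differ only at [y = x], a null set in positive dimension. *)
Lemma pot_kernel (g : Rn R d -> \bar R) x : (0 < d)%N ->
  measurable_fun setT g -> (forall y, 0 <= g y)%E ->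
  pot kernel g x = (\int[mu]_y ((lambda * fund_sol (x - y)%R)%:E * g y))%E.
Proof.
move=> d0 mg g0; apply: ge0_ae_eq_integral => //.
- apply: emeasurable_funM => //; apply: measurable_kernel; exact: measurable_kernel_fun.
- apply: emeasurable_funM => //; apply/measurable_EFinP; apply: measurable_funM => //.
  by apply: (measurableT_comp measurable_fund_sol); exact: measurable_rVB.
- by move=> y _; rewrite mule_ge0// kernel_ge0.
- by move=> y _; rewrite mule_ge0// lee_fin mulr_ge0 ?fund_sol_ge0.
exists [set x]; split.
- by rewrite -[[set x]]/(set1 (x : Rn R d)); exact: measurable_point.
- exact: lebesgue_point.
move=> y; apply: contra_notP => /= yx _; rewrite /kernel subr_eq0; case: ifPn => // /eqP xy.
by case: yx.
Qed.

End kernel.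

(** * The monotone iteration and its comparison between a set and a ball *)

Section iteration.
Context {R : realType} {n : nat}.
Hypothesis n0 : (0 < n)%N.
Local Open Scope ereal_scope.
Local Notation mu := (lebesgue_rV n : {sigma_finite_measure set (Rn R n) -> \bar R}).
Implicit Types (A E : set (Rn R n)).
Variable k : Rn R n -> \bar R.
Hypotheses (mk : measurable_fun setT k) (k0 : forall x, 0 <= k x) (hk : rdec k).

(* The components approximate [1_E / (1 - u)] and [u]. *)
Fixpoint picard E (m : nat) : (Rn R n -> \bar R) * (Rn R n -> \bar R) :=
  if m is m'.+1 then
    (fun x => (\1_E x)%:E + (picard E m').1 x * (picard E m').2 x,
     pot k (fun y => (picard E m').1 y * (picard E m').1 y))
  else (cst 0, cst 0).

Lemma picard_ge0 E m x : 0 <= (picard E m).1 x /\ 0 <= (picard E m).2 x.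
Proof.
elim: m x => [|m IH] x //=; split.
  by rewrite adde_ge0 ?lee_fin// mule_ge0//; have [] := IH x.
by apply: pot_ge0 => // y; rewrite mule_ge0//; have [] := IH y.
Qed.

Lemma picard1_ge0 E m x : 0 <= (picard E m).1 x.
Proof. by have [] := picard_ge0 E m x. Qed.

Lemma picard2_ge0 E m x : 0 <= (picard E m).2 x.
Proof. by have [] := picard_ge0 E m x. Qed.

Lemma picard_sq_ge0 E m x : 0 <= (picard E m).1 x * (picard E m).1 x.
Proof. by rewrite mule_ge0// picard1_ge0. Qed.

Lemma measurable_picard E m : measurable E ->
  measurable_fun setT (picard E m).1 /\ measurable_fun setT (picard E m).2.
Proof.
move=> mE; elim: m => [|m [IH1 IH2]] /=; first by split; exact: measurable_cst.
split.
  by apply: emeasurable_funD; [exact: measurable_indicE|exact: emeasurable_funM].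
by apply: measurable_pot => //; [exact: emeasurable_funM|exact: picard_sq_ge0].
Qed.

Lemma picard_nd E m x : measurable E ->
  (picard E m).1 x <= (picard E m.+1).1 x /\ (picard E m).2 x <= (picard E m.+1).2 x.
Proof.
move=> mE; elim: m x => [|m IH] x.
  by split; [exact: picard1_ge0|exact: picard2_ge0].
have [m1 _] := measurable_picard m mE; have [m2 _] := measurable_picard m.+1 mE.
split.
  have [h1 h2] := IH x.
  by rewrite [leLHS]/= [leRHS]/= leeD2l// lee_pmul// ?picard1_ge0 ?picard2_ge0.
apply: ge0_le_integral => //.
- by move=> y _; rewrite mule_ge0// picard_sq_ge0.
- by apply: emeasurable_funM; [exact: measurable_kernel|exact: emeasurable_funM].
- by apply: emeasurable_funM; [exact: measurable_kernel|exact: emeasurable_funM].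
move=> y _; have [h1 _] := IH y; rewrite lee_wpmul2l//.
by rewrite lee_pmul// picard1_ge0.
Qed.

(** This gives the first component superlevel sets of finite measure, as the rearrangement lemmas
    demand. *)
Lemma picard_support E m x : ~ E x -> (picard E m).1 x = 0.
Proof.
move=> Ex; elim: m => [|m IH] //=.
by rewrite IH mul0e adde0 indicE memNset.
Qed.

Lemma picard_rdec E m : measurable E -> centered E ->
  rdec (picard E m).1 /\ rdec (picard E m).2.
Proof.
move=> mE hE; elim: m => [|m [IH1 IH2]]; first by split => x y _ /=.
have [m1 _] := measurable_picard m mE.
split.
  move=> x y xy /=; apply: leeD; first exact: (rdec_indic hE).
  by apply: (rdec_mul _ _ IH1 IH2 xy) => z; [exact: picard1_ge0|exact: picard2_ge0].
apply: pot_rdec => //; first exact: emeasurable_funM.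
  exact: picard_sq_ge0.
by apply: rdec_mul => // z; exact: picard1_ge0.
Qed.

(** The factor [lambda] is absorbed into [k]. *)
Definition integral_solution E (v : Rn R n -> R) := (forall x, 0 <= v x < 1)%R /\
  forall x, (v x)%:E = pot k (fun y => (\1_E y)%:E * ((1 - v y) ^- 2)%:E) x.

(** The pair formed by $1_E/(1-v)$ and [v] is a fixed point of the iteration, which is monotone and
    starts from 0. *)
Lemma picard_le E m v x : measurable E -> measurable_fun setT v -> integral_solution E v ->
  (picard E m).1 x <= (\1_E x * (1 - v x)^-1)%:E /\ (picard E m).2 x <= (v x)%:E.
Proof.
move=> mE mv [v01 vE]; elim: m x => [|m IH] x /=.
  by have /andP[v0 v1] := v01 x; rewrite !lee_fin mulr_ge0// invr_ge0 subr_ge0 ltW.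
have v1 y : (0 < 1 - v y)%R by rewrite subr_gt0; have /andP[] := v01 y.
have [h1 h2] := IH x; split.
  apply: (@le_trans _ _ ((\1_E x)%:E + (\1_E x * (1 - v x)^-1)%:E * (v x)%:E)).
    by rewrite leeD2l// lee_pmul// ?picard1_ge0 ?picard2_ge0.
  rewrite -EFinM -EFinD lee_fin le_eqVlt; apply/orP; left; apply/eqP.
  by field; rewrite gt_eqF.
rewrite vE; have [m1 _] := measurable_picard m mE.
have mv2 : measurable_fun setT (fun y => (\1_E y)%:E * ((1 - v y) ^- 2)%:E : \bar R).
  apply: emeasurable_funM; first exact: measurable_indicE.
  apply/measurable_EFinP.
  rewrite (_ : (fun _ => _) = fun y => powR ((1 - v y) ^+ 2)%R (-1)); last first.
    by apply/funext => y; rewrite powR_inv1// sqr_ge0.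
  apply: (measurableT_comp (measurable_powR _)).
  by apply: measurable_funX; exact: measurable_funB.
apply: ge0_le_integral => //.
- by move=> y _; rewrite mule_ge0// picard_sq_ge0.
- by apply: emeasurable_funM; [exact: measurable_kernel|exact: emeasurable_funM].
- by apply: emeasurable_funM => //; exact: measurable_kernel.
move=> y _; rewrite lee_wpmul2l//; have [h _] := IH y.
apply: (le_trans (lee_pmul (picard1_ge0 _ _ _) (picard1_ge0 _ _ _) h h)).
rewrite -!EFinM lee_fin -exprVn expr2 mulrACA indicE.
by case: (_ \in _); rewrite ?mul0r ?mulr1 ?mul1r.
Qed.

Lemma superlevels_lty A (f : Rn R n -> \bar R) s : measurable A -> mu A < +oo ->
  measurable_fun setT f -> (forall x, ~ A x -> f x = 0) ->
  mu (xsection (superlevels f) s) < +oo.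
Proof.
move=> mA Aoo mf fA.
apply: (le_lt_trans _ Aoo); apply: le_measure; rewrite ?inE//.
  by apply: measurable_xsection; exact: measurable_superlevels.
move=> x; rewrite xsectionE /superlevels /= => -[s0 h]; apply: contrapT => Ax.
by move: h; rewrite fA// lte_fin ltNge ltW.
Qed.

Section comparison.
Variables (A E : set (Rn R n)) (v : Rn R n -> R).
Hypotheses (mA : measurable A) (mE : measurable E) (hE : centered E).
Hypotheses (AE : mu A <= mu E) (Aoo : mu A < +oo).
Hypotheses (mv : measurable_fun setT v) (sv : integral_solution E v).

Let p_lty j y : (picard E j).1 y < +oo.
Proof. by have [h _] := picard_le j y mE mv sv; exact: le_lt_trans h (ltry _). Qed.

Let psq_lty j y : (picard E j).1 y * (picard E j).1 y < +oo.
Proof.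
have := p_lty j y; rewrite -ge0_fin_numE ?picard1_ge0// => fy.
by rewrite -(fineK fy) -EFinM ltry.
Qed.

Let p_level j s : mu (xsection (superlevels (picard A j).1) s) < +oo.
Proof.
apply: (superlevels_lty _ mA Aoo); first by have [] := measurable_picard j mA.
by move=> x; exact: picard_support.
Qed.

Let psq_level j s :
  mu (xsection (superlevels (fun y => (picard A j).1 y * (picard A j).1 y)) s) < +oo.
Proof.
apply: (superlevels_lty _ mA Aoo).
  by have [] := measurable_picard j mA => ? _; exact: emeasurable_funM.
by move=> x Ax; rewrite picard_support// mul0e.
Qed.

Let majorized_sq j : majorized (picard A j).1 (picard E j).1 ->
  majorized (fun y => (picard A j).1 y * (picard A j).1 y)
            (fun y => (picard E j).1 y * (picard E j).1 y).
Proof.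
move=> maj.
have [ma1 _] := measurable_picard j mA; have [me1 _] := measurable_picard j mE.
have [r1 _] := picard_rdec j mE hE.
by apply: majorized_mul => //; exact: picard1_ge0.
Qed.

(** In the product the first component plays the part of [g] in [majorized_mul]: it vanishes off
    [A], whereas the superlevel sets of the potential are not controlled. *)
Lemma majorized_picard m :
  majorized (picard A m).1 (picard E m).1 /\ majorized (picard A m).2 (picard E m).2.
Proof.
elim: m => [|m [IH1 IH2]].
  by split => B C mB mC hC BC /=; rewrite !integral0_eq// => x _; rewrite mule0.
have [ma1 ma2] := measurable_picard m mA; have [me1 me2] := measurable_picard m mE.
have [r1 r2] := picard_rdec m mE hE.
have pos F y : 0 <= (picard F m).1 y * (picard F m).2 y.
  by rewrite mule_ge0// ?picard1_ge0 ?picard2_ge0.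
split.
  apply: (majorized_add (g := EFin \o \1_A) (g' := EFin \o \1_E)
    (W := fun x => (picard A m).1 x * (picard A m).2 x)
    (W' := fun x => (picard E m).1 x * (picard E m).2 x)) => //.
  - exact: measurable_indicE.
  - by move=> y; rewrite /= lee_fin.
  - exact: measurable_indicE.
  - by move=> y; rewrite /= lee_fin.
  - exact: emeasurable_funM.
  - exact: emeasurable_funM.
  - exact: majorized_indic.
  - by apply: majorized_mul => //; do ?[exact: picard2_ge0|exact: picard1_ge0].
apply: majorized_pot => //.
- exact: emeasurable_funM.
- exact: picard_sq_ge0.
- exact: emeasurable_funM.
- exact: picard_sq_ge0.
- by apply: rdec_mul => // y; exact: picard1_ge0.
- exact: majorized_sq.
Qed.

Lemma picard2_le_center m x : (picard A m).2 x <= (v 0%R)%:E.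
Proof.
case: m => [|m].
  by rewrite /= lee_fin; have [/(_ 0%R) /andP[]] := sv.
have [_ h] := picard_le m.+1 0%R mE mv sv; apply: le_trans h.
have [ma1 _] := measurable_picard m mA; have [me1 _] := measurable_picard m mE.
have [r1 _] := picard_rdec m mE hE.
have [maj _] := majorized_picard m.
apply: pot_le_center => //.
- exact: emeasurable_funM.
- exact: picard_sq_ge0.
- exact: emeasurable_funM.
- exact: picard_sq_ge0.
- by apply: rdec_mul => // y; exact: picard1_ge0.
- exact: majorized_sq.
Qed.

(** With [s = v 0], the bound $1/(1-s)$ is the fixed point of $q \mapsto 1 + qs$. *)
Lemma picard1_le m x : (picard A m).1 x <= ((1 - v 0%R)^-1)%:E.
Proof.
have [/(_ 0%R) /andP[v0 v1] _] := sv.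
have v1' : (0 < 1 - v 0)%R by rewrite subr_gt0.
elim: m => [|m IH]; first by rewrite /= lee_fin invr_ge0 ltW.
apply: (@le_trans _ _ (1 + ((1 - v 0%R)^-1)%:E * (v 0%R)%:E)).
  apply: leeD; first by rewrite lee_fin indicE; case: (_ \in _).
  by apply: lee_pmul; rewrite ?picard1_ge0 ?picard2_ge0// picard2_le_center.
rewrite -EFinM -EFinD lee_fin le_eqVlt; apply/orP; left; apply/eqP.
by field; rewrite gt_eqF.
Qed.

(* A real-valued representative of the kernel, needed for the passage to the limit. *)
Variable kr : Rn R n -> R.
Hypotheses (mkr : measurable_fun setT kr) (kr0 : forall x, (0 <= kr x)%R).
Hypothesis potE : forall g x, measurable_fun setT g -> (forall y, 0 <= g y) ->
  pot k g x = \int[mu]_y ((kr (x - y)%R)%:E * g y).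

(** The uniform bounds make both suprema finite, with [U] at most [v 0 < 1], so limits may be taken
    in both recursions. The first becomes $P = 1_A + PU$, that is, $P = 1_A/(1-U)$; inserted into
    the second, this is the equation for [U]. *)
Lemma integral_solution_compare :
  exists u, measurable_fun setT u /\ integral_solution A u.
Proof.
have [/(_ 0%R) /andP[v0 v1] _] := sv.
pose s := v 0%R.
pose P x := ereal_sup (range (fun m => (picard A m).1 x)).
pose U x := ereal_sup (range (fun m => (picard A m).2 x)).
have nd1 x : nondecreasing_seq (fun m => (picard A m).1 x).
  by apply/nondecreasing_seqP => m; have [] := picard_nd m x mA.
have nd2 x : nondecreasing_seq (fun m => (picard A m).2 x).
  by apply/nondecreasing_seqP => m; have [] := picard_nd m x mA.
have cP x : (picard A m).1 x @[m --> \oo] --> P x.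
  exact: (ereal_nondecreasing_cvgn (nd1 x)).
have cU x : (picard A m).2 x @[m --> \oo] --> U x.
  exact: (ereal_nondecreasing_cvgn (nd2 x)).
have P0 x : 0 <= P x by apply: ereal_sup_ubound; exists 0%N.
have U0 x : 0 <= U x by apply: ereal_sup_ubound; exists 0%N.
have Ps x : P x <= ((1 - s)^-1)%:E.
  by apply: ge_ereal_sup => _ [m _ <-]; exact: picard1_le.
have Us x : U x <= s%:E.
  by apply: ge_ereal_sup => _ [m _ <-]; exact: picard2_le_center.
have fP x : P x \is a fin_num by rewrite ge0_fin_numE// (le_lt_trans (Ps x))// ltry.
have fU x : U x \is a fin_num by rewrite ge0_fin_numE// (le_lt_trans (Us x))// ltry.
have mU : measurable_fun setT U.
  apply: (emeasurable_fun_cvg (fun m => (picard A m).2)).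
    by move=> m; have [] := measurable_picard m mA.
  by move=> x _; exact: cU.
have mP : measurable_fun setT P.
  apply: (emeasurable_fun_cvg (fun m => (picard A m).1)).
    by move=> m; have [] := measurable_picard m mA.
  by move=> x _; exact: cP.
have PE x : P x = (\1_A x)%:E + P x * U x.
  have c1 : (picard A m.+1).1 x @[m --> \oo] --> P x by rewrite (cvg_shiftS (fun m => (picard A m).1 x)).
  apply: (cvg_unique _ c1) => //=.
  apply: cvgeD; [by rewrite fin_num_adde_defr|exact: cvg_cst|].
  apply: cvgeM; [|exact: cP|exact: cU].
  by rewrite -(fineK (fP x)) -(fineK (fU x)).
have UE x : U x = pot k (fun y => P y * P y) x.
  have c2 : (picard A m.+1).2 x @[m --> \oo] --> U x by rewrite (cvg_shiftS (fun m => (picard A m).2 x)).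
  apply: (cvg_unique _ c2) => //=.
  rewrite potE; [|exact: emeasurable_funM|by move=> y; exact: mule_ge0].
  pose f m y := (kr (x - y)%R)%:E * ((picard A m).1 y * (picard A m).1 y).
  have mf m : measurable_fun setT (f m).
    have [mp _] := measurable_picard m mA.
    apply: emeasurable_funM; last exact: emeasurable_funM.
    by apply/measurable_EFinP; apply: (measurableT_comp mkr); exact: measurable_rVB.
  rewrite (_ : (fun m => _) = fun m => \int[mu]_y f m y); last first.
    apply/funext => m; have [mp _] := measurable_picard m mA.
    by rewrite potE//; [exact: emeasurable_funM|exact: picard_sq_ge0].
  rewrite (_ : \int[mu]_y _ = \int[mu]_y limn (f ^~ y)); last first.
    apply: eq_integral => y _; apply/esym/cvg_lim => //.
    apply: cvgeZl => //; apply: cvgeM; [|exact: cP|exact: cP].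
    by rewrite -(fineK (fP y)).
  apply: cvg_monotone_convergence => //.
  - by move=> m y _; rewrite mule_ge0 ?lee_fin// picard_sq_ge0.
  - move=> y _ i j ij; rewrite lee_wpmul2l ?lee_fin//.
    by rewrite lee_pmul ?picard1_ge0//; exact: nd1.
exists (fine \o U); split.
  by apply: measurableT_comp => //; exact: fine_measurable.
have u01 x : (0 <= (fine \o U) x < 1)%R.
  rewrite /= fine_ge0//= -lte_fin fineK// (le_lt_trans (Us x))// lte_fin.
split=> // x.
rewrite /= fineK// UE; apply: eq_integral => y _; congr (_ * _).
have /andP[_ uy1] := u01 y.
have := PE y; rewrite -(fineK (fP y)) -(fineK (fU y)) -!EFinM -EFinD => -[PE'].
have u1 : (1 - fine (U y) != 0)%R by rewrite subr_eq0 gt_eqF.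
have -> : fine (P y) = (\1_A y / (1 - fine (U y)))%R.
  by apply: (mulIf u1); rewrite divfK// mulrBr mulr1 {1}PE' addrK.
rewrite -exprVn expr2 mulrACA; congr (_%:E); congr (_ * _)%R.
by rewrite indicE; case: (_ \in _); rewrite ?mulr1 ?mulr0.
Qed.

End comparison.

End iteration.

(** * The rearranged profile and the comparison of the voltages *)

Section rearranged_indicator.
Context {R : realType} {d : nat}.
Hypothesis d0 : (0 < d)%N.
Local Open Scope ereal_scope.
Local Notation mu := (lebesgue_rV d : {sigma_finite_measure set (Rn R d) -> \bar R}).

Lemma set_rearrP (A : set (Rn R d)) : mu A < +oo ->
  exists r : R, set_rearr A = eball 0 r /\ mu (eball 0 r) = mu A.
Proof.
move=> Aoo; have [r r0 rE] := lebesgue_eball_radius d0 (measure_ge0 mu A) Aoo.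
rewrite /set_rearr; set S := [set r : R | _].
have [_ h] : S (xget 0%R S) by apply: (@xgetPex _ 0%R S); exists r.
by exists (xget 0%R S).
Qed.

Lemma set_rearr0 : set_rearr (set0 : set (Rn R d)) = set0.
Proof.
have [|r [-> ]] := @set_rearrP set0; first by rewrite measure0 ltry.
rewrite measure0 => rE; apply: eball_eq0; rewrite leNgt; apply/negP => r0.
by have := @lebesgue_eball_gt0 R d r r0; rewrite rE ltxx.
Qed.

(** Only heights below 1 contribute: from 1 on the superlevel set is empty, and its rearrangement is
    a ball of measure 0, hence empty. *)
Lemma fun_rearr_indic (A : set (Rn R d)) :
  fun_rearr (EFin \o (\1_A)%R) = EFin \o (\1_(set_rearr A))%R.
Proof.
apply/funext => x; rewrite /fun_rearr /=.
have level (t : R) : (0 < t)%R ->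
    superlevel (EFin \o (\1_A : Rn R d -> R)) t = if (t < 1)%R then A else set0.
  move=> t0; apply/seteqP; split => y; rewrite /superlevel /= lte_fin indicE.
    have [/set_mem yA|_] := boolP (y \in A); first by move=> /= ->.
    by rewrite ltNge ltW.
  case: ifPn => [t1 yA|//]; by rewrite mem_set.
have E : \int[lebesgue_measure]_(t in `]0%R, +oo[)
      (\1_(set_rearr (superlevel (EFin \o (\1_A)%R) t)) x)%:E =
    \int[lebesgue_measure]_(t in `]0%R, +oo[)
      ((\1_(`]0%R, 1%R[%classic : set R) t)%:E * (\1_(set_rearr A) x)%:E).
  apply: eq_integral => t; rewrite inE /= in_itv/= andbT => t0.
  rewrite level// [in RHS]indicE; case: ifPn => t1.
    by rewrite mem_set ?mul1e//= in_itv/= t0 t1.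
  rewrite set_rearr0 indic0 memNset ?mul0e//= in_itv/= t0.
  by apply/negP.
have m01 : measurable (`]0%R, 1%R[%classic : set (measurableTypeR R)) by exact: measurable_itv.
rewrite E ge0_integralZr//; last first.
  by apply/measurable_EFinP; apply: measurable_funTS; exact: measurable_indic.
rewrite integral_indic// setIidl; last first.
  by move=> t /=; rewrite !in_itv/= andbT => /andP[].
by rewrite /= lebesgue_measure_itv/= lte_fin ltr01 oppr0 adde0 mul1e.
Qed.

End rearranged_indicator.

Local Open Scope ereal_scope.

(** Passes from [fund_sol], with [lambda] in front of the integral and value 0 at the origin, to
    [kernel], which contains [lambda] and is infinite there. *)
Lemma is_solutionE (R : realType) (d : nat) (lambda : R) (A : set (Rn R d)) (v : Rn R d -> R) :
  (0 < d)%N -> (0 <= lambda)%R -> measurable A -> measurable_fun setT v ->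
  is_solution lambda (EFin \o (\1_A)%R) v <-> integral_solution (kernel lambda) A v.
Proof.
move=> d0 l0 mA mv.
pose g (y : Rn R d) : \bar R := (\1_A y)%:E * ((1 - v y) ^- 2)%:E.
have mg : measurable_fun setT g.
  apply: emeasurable_funM; first exact: measurable_indicE.
  apply/measurable_EFinP.
  rewrite (_ : (fun _ => _) = fun y => powR ((1 - v y) ^+ 2)%R (-1)); last first.
    by apply/funext => y; rewrite powR_inv1// sqr_ge0.
  apply: (measurableT_comp (measurable_powR _)).
  by apply: measurable_funX; exact: measurable_funB.
have g0 y : 0 <= g y by rewrite mule_ge0// lee_fin// invr_ge0 sqr_ge0.
have E x : pot (kernel lambda) g x =
    lambda%:E * \int[lebesgue_rV d]_y ((fund_sol (x - y)%R)%:E * g y).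
  rewrite pot_kernel// -ge0_integralZl//.
  - by apply: eq_integral => y _; rewrite [RHS]muleA; congr (_ * _); exact: erefl.
  - apply: emeasurable_funM => //; apply/measurable_EFinP.
    by apply: (measurableT_comp measurable_fund_sol); exact: measurable_rVB.
  - by move=> y _; rewrite mule_ge0// lee_fin fund_sol_ge0.
split => [[_ v01 vE]|[v01 vE]]; split => //.
  by move=> x; rewrite vE -E.
by move=> x; rewrite vE E.
Qed.

Theorem theorem3p3 (R : realType) (d : nat) (d_ge3 : (3 <= d)%N)
    (Omega : set 'rV[R]_d) (Omega_dom : smooth_bounded_domain Omega) :
  pull_in_voltage (fun_rearr (EFin \o (\1_Omega)%R)) <=
  pull_in_voltage (EFin \o (\1_Omega)%R).
Proof.
have d0 : (0 < d)%N by exact: leq_trans d_ge3.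
have [oO _ _ bO _] := Omega_dom.
have mO := open_measurable_rV oO; have Ooo := bounded_lty bO mO.
have [r [BE muB]] := set_rearrP d0 Ooo.
have -> : fun_rearr (EFin \o (\1_Omega)%R) = EFin \o (\1_(eball 0 r : set 'rV[R]_d))%R.
  by rewrite -BE; exact: fun_rearr_indic.
apply: ge_ereal_sup => _ [lambda [l0 [v sv]] <-].
apply: ereal_sup_ubound; exists lambda => //; split => //.
have mB : measurable (eball 0 r : set (Rn R d)) by exact: measurable_eball.
have mv : measurable_fun setT (v : Rn R d -> R) by case: sv.
have l0' := ltW l0.
have /is_solutionE sv' := sv.
have mkr : measurable_fun setT (fun z : Rn R d => (lambda * fund_sol z)%R).
  by apply: measurable_funM => //; exact: measurable_fund_sol.
have kr0 (z : Rn R d) : (0 <= lambda * fund_sol z)%R by rewrite mulr_ge0// fund_sol_ge0.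
have OB : lebesgue_rV d Omega <= lebesgue_rV d (eball 0 r) by rewrite muB.
have [u [mu su]] := integral_solution_compare d0 (measurable_kernel_fun lambda)
  (kernel_ge0 l0') (kernel_rdec l0') mO mB (@eball_centered R d r) OB Ooo mv
  (sv' d0 l0' mB mv) mkr kr0 (fun g x => @pot_kernel R d lambda l0' g x d0).
by exists u; apply/is_solutionE.
Qed.
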